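(* Let $n\ge 1$, $0<s<1$, let $\Omega\subset\mathbb{R}^n$ be a bounded open set with Lipschitz continuous boundary, and let $\beta\in L^1(\mathbb{R}^n\setminus\Omega)$ be a non-negative function. Let $$D(\mathfrak a_R):=\{u\in L^2(\Omega):\ u_R\in W^{s,2}_{\beta,\Omega}\},\qquad \mathfrak a_R(u,v):=\mathcal E(u_R,v_R)+\int_{\mathbb{R}^n\setminus\Omega}\beta u_Rv_R\,dx\quad(u,v\in D(\mathfrak a_R)).$$ Then $\mathfrak a_R$ is a closed, symmetric and densely defined bilinear form on $L^2(\Omega)$. The selfadjoint operator $A_R$ associated with $\mathfrak a_R$ is given by $$D(A_R)=\{u\in L^2(\Omega):\ u_R\in W^{s,2}_{\beta,\Omega}\text{ and there exists } f\in L^2(\Omega)\text{ such that } u_R\text{ is a weak solution of the Robin problem with right hand side } f\},\qquad A_Ru=f.$$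
   Context: Functions are real-valued and identified when equal almost everywhere. $C_{n,s}:=\frac{s2^{2s}\Gamma(\frac{2s+n}{2})}{\pi^{n/2}\Gamma(1-s)}$. The space $W^{s,2}_{\beta,\Omega}$ consists of all measurable $u:\mathbb{R}^n\to\mathbb{R}$ with $\|u\|_{W^{s,2}_{\beta,\Omega}}^2:=\int_\Omega|u|^2dx+\int_{\mathbb{R}^n\setminus\Omega}|u|^2|\beta|dx+\iint_{\mathbb{R}^{2n}\setminus(\mathbb{R}^n\setminus\Omega)^2}\frac{|u(x)-u(y)|^2}{|x-y|^{n+2s}}dxdy<\infty$. For $u,v\in W^{s,2}_{\beta,\Omega}$, $$\mathcal E(u,v):=\frac{C_{n,s}}{2}\int_\Omega\int_\Omega\frac{(u(x)-u(y))(v(x)-v(y))}{|x-y|^{n+2s}}dydx+C_{n,s}\int_\Omega\int_{\mathbb{R}^n\setminus\Omega}\frac{(u(x)-u(y))(v(x)-v(y))}{|x-y|^{n+2s}}dydx.$$ Robin extension: with $\rho(x):=\int_\Omega\frac{dy}{|x-y|^{n+2s}}$ for $x\in\mathbb{R}^n\setminus\overline\Omega$, for $u\in L^2(\Omega)$ put $u_R(x):=u(x)$ if $x\in\Omega$ and $u_R(x):=\frac{C_{n,s}}{C_{n,s}\rho(x)+\beta(x)}\int_\Omega\frac{u(y)}{|x-y|^{n+2s}}dy$ if $x\in\mathbb{R}^n\setminus\overline\Omega$ (defined a.e., since $\partial\Omega$ is a null set). Robin problem with right hand side $f\in L^2(\Omega)$: $(-\Delta)^su=f$ in $\Omega$,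 $\mathcal N^su+\beta u=0$ in $\mathbb{R}^n\setminus\overline\Omega$, where $\mathcal N^su(x)=C_{n,s}\int_\Omega\frac{u(x)-u(y)}{|x-y|^{n+2s}}dy$. A weak solution is a function $u\in W^{s,2}_{\beta,\Omega}$ such that $\mathcal E(u,v)+\int_{\mathbb{R}^n\setminus\Omega}\beta uv\,dx=\int_\Omega fv\,dx$ for every $v\in W^{s,2}_{\beta,\Omega}$. A symmetric non-negative bilinear form $\mathfrak a$ on $D(\mathfrak a)\subset L^2(\Omega)$ is closed if $D(\mathfrak a)$ is complete for the norm $(\mathfrak a(u,u)+\|u\|_{L^2(\Omega)}^2)^{1/2}$. The operator $A$ associated with $\mathfrak a$ is $D(A)=\{u\in D(\mathfrak a):\exists f\in L^2(\Omega)\ \mathfrak a(u,v)=(f,v)_{L^2(\Omega)}\ \forall v\in D(\mathfrak a)\}$, $Au=f$. *)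

(* Defs.v *)
From HB Require Import structures.
From mathcomp Require Import all_boot all_order all_algebra.
From mathcomp Require Import all_classical all_reals all_analysis.
From mathcomp Require Import measurable_realfun.

Set Implicit Arguments.
Unset Strict Implicit.
Unset Printing Implicit Defensive.
Import Order.TTheory GRing.Theory Num.Theory.
Import numFieldNormedType.Exports.

Local Open Scope classical_set_scope.
Local Open Scope ring_scope.

(** Measurability on R^n is Borel measurability: the product sigma-algebra is
    generated by the open sets (rV_measurableE). Every Lebesgue measurable
    function is almost everywhere equal to a Borel one, so this does not affect
    spaces of functions considered up to null sets. *)
Definition rV_display : measure_display.
Proof. exact: default_measure_display. Qed.

Section measurable_rV.
Context {R : realType} (n : nat).

Definition rV_measurable : set (set 'rV[R]_n) :=
  g_sigma_preimage (fun (i : 'I_n) (x : 'rV[R]_n) =>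
    x ord0 i : measurableTypeR R).

Let rV_set0 : rV_measurable set0.
Proof. exact: sigma_algebra0. Qed.

Let rV_setC A : rV_measurable A -> rV_measurable (~` A).
Proof. exact: sigma_algebraC. Qed.

Let rV_bigcup (F : _^nat) :
  (forall i, rV_measurable (F i)) -> rV_measurable (\bigcup_i (F i)).
Proof. exact: sigma_algebra_bigcup. Qed.

HB.instance Definition _ := @isMeasurable.Build
  rV_display 'rV[R]_n rV_measurable
  rV_set0 rV_setC rV_bigcup.

End measurable_rV.

Section lebesgue_measure_rV.
Context {R : realType}.
Local Open Scope ereal_scope.

Lemma measurable_coord_rV n (i : 'I_n) :
  measurable_fun [set: 'rV[R]_n] (fun x => x ord0 i : measurableTypeR R).
Proof.
move=> _ Y mY; rewrite setTI; apply: sub_sigma_algebra => /=.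
rewrite -bigcup_seq/=; exists i => /=; first by rewrite mem_index_enum.
by exists Y => //; rewrite setTI.
Qed.

Lemma measurable_fun_coord_rVP d (T : measurableType d) n (f : T -> 'rV[R]_n) :
  measurable_fun setT f <->
  forall i, measurable_fun setT (fun t => f t ord0 i : measurableTypeR R).
Proof.
split=> [mf i|mf]; first exact: (measurableT_comp (measurable_coord_rV i) mf).
move=> _ A mA; rewrite setTI.
suff: @rV_measurable R n `<=` [set B : set 'rV[R]_n | measurable (f @^-1` B)].
  exact.
apply: smallest_sub.
  split.
  - by rewrite /= preimage_set0.
  - by move=> B mB; rewrite /= setTD preimage_setC; exact: measurableC.
  - move=> F mF; rewrite /= preimage_bigcup; apply: bigcup_measurable => k _.
    exact: mF.
rewrite -bigcup_seq; apply: bigcup_sub => i _ _ [B mB <-] /=.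
by have := mf i measurableT B mB; rewrite !setTI.
Qed.

Definition cons_rV n (p : measurableTypeR R * 'rV[R]_n) : 'rV[R]_n.+1 :=
  row_mx (const_mx p.1 : 'rV_1) p.2.

Lemma cons_rV0 n p : @cons_rV n p ord0 ord0 = p.1.
Proof.
transitivity (row_mx (const_mx p.1 : 'rV_1) p.2 ord0 (lshift n ord0)).
  by congr fun_of_matrix; exact: val_inj.
by rewrite row_mxEl mxE.
Qed.

Lemma cons_rV_lift n p i : @cons_rV n p ord0 (lift ord0 i) = p.2 ord0 i.
Proof.
transitivity (row_mx (const_mx p.1 : 'rV_1) p.2 ord0 (rshift 1 i)).
  by congr fun_of_matrix; exact: val_inj.
by rewrite row_mxEr.
Qed.

Lemma measurable_cons_rV n : measurable_fun setT (@cons_rV n).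
Proof.
apply/measurable_fun_coord_rVP => i.
case: (unliftP ord0 i) => [j ->|->].
- under eq_fun do rewrite cons_rV_lift.
  exact: (measurableT_comp (measurable_coord_rV j) measurable_snd).
- under eq_fun do rewrite cons_rV0.
  exact: measurable_fst.
Qed.

Definition uncons_rV n (v : 'rV[R]_n.+1) : measurableTypeR R * 'rV[R]_n :=
  (v ord0 ord0, \row_j v ord0 (lift ord0 j)).

Lemma cons_rVK n : cancel (@cons_rV n) (@uncons_rV n).
Proof.
case=> a v; rewrite /uncons_rV cons_rV0; congr pair.
by apply/rowP => j; rewrite mxE cons_rV_lift.
Qed.

Lemma uncons_rVK n : cancel (@uncons_rV n) (@cons_rV n).
Proof.
move=> v; apply/rowP => i; case: (unliftP ord0 i) => [j ->|->].
- by rewrite cons_rV_lift mxE.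
- by rewrite cons_rV0.
Qed.

Lemma measurable_uncons_rV n : measurable_fun setT (@uncons_rV n).
Proof.
apply/measurable_fun_pair => /=; first exact: measurable_coord_rV.
apply/measurable_fun_coord_rVP => j.
under eq_fun do rewrite mxE.
exact: measurable_coord_rV.
Qed.

Section step.
Variables (n : nat) (m : {sigma_finite_measure set 'rV[R]_n -> \bar R}).

Definition lebesgue_cons : set 'rV[R]_n.+1 -> \bar R :=
  pushforward (lebesgue_measure \x m) (@cons_rV n).

Let lebesgue_cons0 : lebesgue_cons set0 = 0.
Proof. by rewrite /lebesgue_cons /pushforward preimage_set0 measure0. Qed.

Let lebesgue_cons_ge0 A : 0 <= lebesgue_cons A.
Proof. exact: (measure_ge0 (lebesgue_measure \x m)). Qed.

Let lebesgue_cons_sigma_additive : semi_sigma_additive lebesgue_cons.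
Proof.
rewrite /lebesgue_cons; apply: measure_semi_sigma_additive.
exact: measurable_cons_rV.
Qed.

HB.instance Definition _ := isMeasure.Build _ _ _ lebesgue_cons
  lebesgue_cons0 lebesgue_cons_ge0 lebesgue_cons_sigma_additive.

Let lebesgue_cons_sigma_finite : sigma_finite setT lebesgue_cons.
Proof.
have /sigma_finiteP[F [TF ndF Foo]] := sigma_finiteT (@lebesgue_measure R).
have /sigma_finiteP[G [TG ndG Goo]] := sigma_finiteT m.
exists (fun k => @uncons_rV n @^-1` (F k `*` G k)).
  rewrite -preimage_bigcup [X in _ @^-1` X](_ : _ = setT) ?preimage_setT//.
  rewrite -setXTT TF TG predeqE => -[x y]; split.
    by move=> [k _ []/= ? ?]; split; exists k.
  move=> [/= [i _ Fix] [k _ Gky]]; exists (maxn i k) => //; split.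
  - by move: x Fix; exact/subsetPset/ndF/leq_maxl.
  - by move: y Gky; exact/subsetPset/ndG/leq_maxr.
move=> k; have [? ?] := Foo k; have [? ?] := Goo k; split.
  rewrite -[X in measurable X]setTI.
  by apply: measurable_uncons_rV => //; exact: measurableX.
rewrite /lebesgue_cons /pushforward -comp_preimage.
rewrite (_ : _ \o _ = id) ?preimage_id; last exact/funext/cons_rVK.
by rewrite product_measure1E// lte_mul_pinfty// ge0_fin_numE.
Qed.

HB.instance Definition _ := Measure_isSigmaFinite.Build _ _ _ lebesgue_cons
  lebesgue_cons_sigma_finite.

End step.

(** The n-fold product of the Lebesgue measure on R, which is determined by
    lebesgue_measure_rV_box. *)
Fixpoint lebesgue_measure_rV n :
    {sigma_finite_measure set 'rV[R]_n -> \bar R} :=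
  match n with
  | 0%N => [the {sigma_finite_measure set 'rV[R]_0 -> \bar R} of
      \d_ (0%R : 'rV[R]_0)]
  | n.+1 => [the {sigma_finite_measure set 'rV[R]_n.+1 -> \bar R} of
      lebesgue_cons (lebesgue_measure_rV n)]
  end.

Lemma lebesgue_measure_rV_box n (A : 'I_n -> set (measurableTypeR R)) :
  (forall i, measurable (A i)) ->
  lebesgue_measure_rV n [set x | forall i, A i (x ord0 i)] =
  \prod_(i < n) lebesgue_measure (A i).
Proof.
elim: n => [|n IH] in A *; move=> mA.
  by rewrite big_ord0 /= diracE mem_set// => -[].
rewrite big_ord_recl.
pose B := [set x : 'rV[R]_n | forall i, A (lift ord0 i) (x ord0 i)].
have mB : measurable B.
  rewrite (_ : B = \big[setI/setT]_(i < n)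
    ((fun x : 'rV[R]_n => x ord0 i : measurableTypeR R) @^-1` A (lift ord0 i))).
    apply: bigsetI_measurable => i _; rewrite -[X in measurable X]setTI.
    exact: measurable_coord_rV.
  rewrite -bigcap_seq; apply/seteqP; split => x /=.
    by move=> xA i _; exact: xA.
  by move=> xA i; apply: xA => /=; rewrite mem_index_enum.
transitivity ((lebesgue_measure \x lebesgue_measure_rV n) (A ord0 `*` B)).
  congr product_measure1; apply/seteqP; split=> -[a v] /=.
    move=> H; split; first by have := H ord0; rewrite cons_rV0.
    by move=> i; have := H (lift ord0 i); rewrite cons_rV_lift.
  move=> [H0 Hl] i; case: (unliftP ord0 i) => [j ->|->].
  - by rewrite cons_rV_lift; exact: Hl.
  - by rewrite cons_rV0.
rewrite product_measure1E//; congr mule.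
by apply: IH => i; exact: mA.
Qed.

Lemma rV_measurableE n : @measurable _ 'rV[R]_n = <<s @open 'rV[R]_n >>.
Proof.
apply/seteqP; split.
  apply: smallest_sub; first exact: smallest_sigma_algebra.
  rewrite -bigcup_seq; apply: bigcup_sub => i _ _ [B mB <-] /=.
  have mi : measurable_fun [set: g_sigma_algebraType (@open 'rV[R]_n)]
      (fun x => x ord0 i : measurableTypeR R).
    apply: (measurability _ (RGenOpens.measurableE R)).
    move=> _ [_ [a [b ->] <-]]; rewrite setTI; apply: sub_sigma_algebra.
    apply: open_comp; last exact: interval_open.
    by move=> x _; exact: coord_continuous.
  exact: mi.
apply: smallest_sub; first exact: sigma_algebra_measurable.
move=> U oU.
pose box (q : 'rV[rat]_n) (k : nat) : set 'rV[R]_n :=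
  [set y | forall i, `|y ord0 i - ratr (q ord0 i)| < k.+1%:R^-1]%R.
pose F m := if unpickle m is Some (q, k) then
  (if `[< box q k `<=` U >] then box q k else set0) else set0.
rewrite (_ : U = \bigcup_m F m).
  apply: bigcup_measurable => m _; rewrite /F.
  case: unpickle => [[q k]|//]; case: ifP => // _.
  rewrite (_ : box q k = \big[setI/setT]_(i < n)
    ((fun x : 'rV[R]_n => x ord0 i : measurableTypeR R) @^-1`
       ball (ratr (q ord0 i) : R) k.+1%:R^-1)).
    apply: bigsetI_measurable => i _; rewrite -[X in measurable X]setTI.
    by apply: measurable_coord_rV => //; exact: measurable_ball.
  rewrite -bigcap_seq; apply/seteqP; split => x /=.
    by move=> xA i _ /=; rewrite /ball /= distrC; exact: xA.
  by move=> xA i; rewrite distrC; apply: (xA i) => /=; rewrite mem_index_enum.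
apply/seteqP; split => [x Ux|x [m _]]; last first.
  rewrite /F; case: unpickle => [[q k]|//]; case: ifP => // /asboolP qkU.
  exact: qkU.
have /nbhs_ballP[e /= e0 xeU] := open_nbhs_nbhs (conj oU Ux).
have [k ke] : exists k : nat, (k.+1%:R^-1 < e / 2)%R.
  have e20 : (0 < e / 2)%R by rewrite divr_gt0.
  have [k _ /(_ k (leqnn k))] := near_infty_natSinv_lt (PosNum e20).
  by exists k.
have [q qx] : exists q : 'rV[rat]_n, box q k x.
  pose e' : R := (k.+1%:R^-1)%R.
  have e'0 : (0 < e')%R by rewrite invr_gt0.
  have H i : exists q : rat, (`|x ord0 i - ratr q| < e')%R.
    have /rat_in_itvoo[q] : (x ord0 i - e' < x ord0 i + e')%R.
      by rewrite ltrBlDr -addrA ltrDl addr_gt0.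
    rewrite in_itv /= => /andP[q1 q2]; exists q.
    by rewrite ltr_distlC q1 q2.
  exists (\row_i xchoose (H i)) => i; rewrite mxE.
  exact: (xchooseP (H i)).
have qkU : box q k `<=` U.
  move=> y yqk; apply: xeU; split=> // i j.
  rewrite (ord1 i) /ball /=.
  apply: le_lt_trans (ler_distD (ratr (q ord0 j)) _ _) _.
  rewrite (splitr e) ltrD//; first exact: lt_trans (qx j) ke.
  by rewrite distrC; exact: lt_trans (yqk j) ke.
exists (pickle (q, k)) => //.
by rewrite /F pickleK asboolT.
Qed.
End lebesgue_measure_rV.

(** Bilinear forms and operators on L^2(X). Elements of L^2(X) are represented
    by functions defined on the whole space, of which only the values on X
    matter, up to a null set. *)
Section L2_forms.
Context {d} {T : measurableType d} {R : realType}.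
Variables (mu : {measure set T -> \bar R}) (X : set T).

Definition L2 : set (T -> R) :=
  [set u : T -> R | measurable_fun X u /\
           (\int[mu]_(x in X) (`|u x| ^+ 2)%:E < +oo)%E].

Definition L2dot (u v : T -> R) : R := \int[mu]_(x in X) (u x * v x).

Definition L2norm (u : T -> R) : R := Num.sqrt (L2dot u u).

Definition densely_defined (D : set (T -> R)) : Prop :=
  forall u e, L2 u -> 0 < e -> exists2 v, D v & L2norm (u \- v) < e.

(** [D] and [a] are assumed compatible with equality almost everywhere on X, so
    that they descend to a subspace of L^2(X) and a form on it. *)
Record bilinear_form_on (D : set (T -> R)) (a : (T -> R) -> (T -> R) -> R)
    : Prop := BilinearFormOn {
  form_dom_sub : D `<=` L2 ;
  form_dom_ae : forall u v, D u -> L2 v -> u = v %[ae mu in X] -> D v ;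
  form_dom0 : D (fun=> 0) ;
  form_dom_lin : forall (c : R) u v,
    D u -> D v -> D (fun x => c * u x + v x) ;
  form_ae : forall u u' v, D u -> D u' -> D v -> u = u' %[ae mu in X] ->
    a u v = a u' v /\ a v u = a v u' ;
  form_linl : forall (c : R) u v w, D u -> D v -> D w ->
    a (fun x => c * u x + v x) w = c * a u w + a v w ;
  form_linr : forall (c : R) u v w, D u -> D v -> D w ->
    a w (fun x => c * u x + v x) = c * a w u + a w v }.

Definition symmetric_on (D : set (T -> R))
    (a : (T -> R) -> (T -> R) -> R) : Prop :=
  forall u v, D u -> D v -> a u v = a v u.

Definition nonneg_on (D : set (T -> R))
    (a : (T -> R) -> (T -> R) -> R) : Prop :=
  forall u, D u -> 0 <= a u u.

Definition form_norm (a : (T -> R) -> (T -> R) -> R) (u : T -> R) : R :=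
  Num.sqrt (a u u + L2norm u ^+ 2).

Definition closed_form (D : set (T -> R))
    (a : (T -> R) -> (T -> R) -> R) : Prop :=
  forall u : nat -> T -> R, (forall k, D (u k)) ->
    (forall e, 0 < e -> exists N, forall j k, (N <= j)%N -> (N <= k)%N ->
       form_norm a (u j \- u k) < e) ->
    exists2 w, D w & form_norm a (u k \- w) @[k --> \oo] --> 0.

(** An operator on L^2(X) is represented by its graph: [G u f] means that
    u is in the domain and is mapped to f. *)
Definition op_dom (G : (T -> R) -> (T -> R) -> Prop) : set (T -> R) :=
  [set u | exists f, G u f].

Definition op_adjoint (G : (T -> R) -> (T -> R) -> Prop) (w g : T -> R) : Prop :=
  [/\ L2 w, L2 g & forall u f, G u f -> L2dot f w = L2dot u g].

Record selfadjoint_operator (G : (T -> R) -> (T -> R) -> Prop) : Prop :=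
  SelfadjointOperator {
  op_sub : forall u f, G u f -> L2 u /\ L2 f ;
  op_fun : forall u f g, G u f -> G u g -> f = g %[ae mu in X] ;
  op_dense : densely_defined (op_dom G) ;
  op_adjointE : forall w g, op_adjoint G w g <-> G w g }.

Definition form_operator (D : set (T -> R)) (a : (T -> R) -> (T -> R) -> R)
    (u f : T -> R) : Prop :=
  [/\ D u, L2 f & forall v, D v -> a u v = L2dot f v].

End L2_forms.

(** The norm of the normed space 'rV[R]_n is the sup norm, hence [enorm]. *)
Definition enorm {R : realType} {n} (x : 'rV[R]_n) : R :=
  Num.sqrt (\sum_i x ord0 i ^+ 2).

Definition edot {R : realType} {n} (x y : 'rV[R]_n) : R :=
  \sum_i x ord0 i * y ord0 i.

(** Near each boundary point, and with the unit vector [e] as vertical axis,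
    [Omega] is the strict subgraph of a Lipschitz function [g] of the component
    of [x] orthogonal to [e]. Only the values of [g] on the hyperplane
    orthogonal to [e] matter. *)
Definition lipschitz_boundary {R : realType} {n} (Omega : set 'rV[R]_n) : Prop :=
  forall z, (closure Omega `\` Omega°) z ->
  exists (r : R) (e : 'rV[R]_n) (g : 'rV[R]_n -> R),
    [/\ 0 < r, enorm e = 1,
        exists L : R, forall x y, `|g x - g y| <= L * enorm (x - y) &
        forall x, enorm (x - z) < r ->
          (Omega x <-> edot x e < g (x - edot x e *: e))].

Definition Gamma {R : realType} (z : R) : R :=
  \int[lebesgue_measure]_(t in `]0, +oo[) (t `^ (z - 1) * expR (- t)).

Definition frac_const (R : realType) (n : nat) (s : R) : R :=
  s * 2 `^ (2 * s) * Gamma ((2 * s + n%:R) / 2) /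
  (pi `^ (n%:R / 2) * Gamma (1 - s)).

Section robin.
Context {R : realType} {n : nat}.
Variables (s : R) (Omega : set 'rV[R]_n) (beta : 'rV[R]_n -> R).
Local Notation mu := (lebesgue_measure_rV n).
Local Notation C := (frac_const n s).

(** Since 0 `^ p = 0 for p != 0 and 0^-1 = 0, this is 0 on the diagonal, a null
    set. *)
Definition frac_kernel (x y : 'rV[R]_n) : R :=
  (enorm (x - y) `^ (n%:R + 2 * s))^-1.

Definition Wnorm_sqr (u : 'rV[R]_n -> R) : \bar R :=
  (\int[mu]_(x in Omega) (`|u x| ^+ 2)%:E +
   \int[mu]_(x in ~` Omega) (`|u x| ^+ 2 * `|beta x|)%:E +
   \int[mu \x mu]_(z in ~` (~` Omega `*` ~` Omega))
      (`|u z.1 - u z.2| ^+ 2 * frac_kernel z.1 z.2)%:E)%E.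

Definition W_space : set ('rV[R]_n -> R) :=
  [set u : 'rV[R]_n -> R | measurable_fun setT u /\ (Wnorm_sqr u < +oo)%E].

Definition energy (u v : 'rV[R]_n -> R) : R :=
  C / 2 * \int[mu]_(x in Omega) (\int[mu]_(y in Omega)
            ((u x - u y) * (v x - v y) * frac_kernel x y)) +
  C * \int[mu]_(x in Omega) (\int[mu]_(y in ~` Omega)
            ((u x - u y) * (v x - v y) * frac_kernel x y)).

Definition rho (x : 'rV[R]_n) : R := \int[mu]_(y in Omega) frac_kernel x y.

(** The value 0 on the boundary of [Omega] is arbitrary. *)
Definition robin_ext (u : 'rV[R]_n -> R) (x : 'rV[R]_n) : R :=
  if x \in Omega then u x
  else if x \in closure Omega then 0
  else C / (C * rho x + beta x) *
       \int[mu]_(y in Omega) (u y * frac_kernel x y).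

Definition robin_energy (u v : 'rV[R]_n -> R) : R :=
  energy u v + \int[mu]_(x in ~` Omega) (beta x * u x * v x).

Definition robin_weak_solution (f u : 'rV[R]_n -> R) : Prop :=
  W_space u /\
  forall v, W_space v -> robin_energy u v = \int[mu]_(x in Omega) (f x * v x).

Definition robin_dom : set ('rV[R]_n -> R) :=
  [set u : 'rV[R]_n -> R | L2 mu Omega u /\ W_space (robin_ext u)].

Definition robin_form (u v : 'rV[R]_n -> R) : R :=
  robin_energy (robin_ext u) (robin_ext v).

End robin.

(* Main.v *)
Require Import Defs.
From HB Require Import structures.
From mathcomp Require Import all_boot all_order all_algebra.
From mathcomp Require Import all_classical all_reals all_analysis.
From mathcomp Require Import measurable_realfun.
From mathcomp Require Import ring lra.

Set Implicit Arguments.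
Unset Strict Implicit.
Unset Printing Implicit Defensive.
Import Order.TTheory GRing.Theory Num.Theory.
Import numFieldNormedType.Exports.

Local Open Scope classical_set_scope.
Local Open Scope ring_scope.

(** The energy is a pull-back of L^2 inner products: up to the weights,
    [E(u, v)] is the inner product in L^2(R^n x R^n) of the increments
    [u x - u y] times the square root of the kernel, and the Robin term is the
    inner product of [u sqrt beta] and [v sqrt beta]. For fixed values of [u] on
    [Omega] the energy splits, outside [Omega], into an integral over [y] of a
    convex quadratic polynomial in [u y], whose minimizer is exactly the Robin
    extension. Hence [robin_ext] maps [W_space] to itself, decreases the energy,
    and is energy-orthogonal to the functions vanishing on [Omega]; so testing
    [a u v] against [v] in the domain amounts to testing the weak formulation
    against all of [W_space], which identifies the operator. Closedness is
    Fatou's lemma along an almost everywhere convergent subsequence. The domain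
    contains the bounded Lipschitz functions, which are dense. A closed, densely
    defined, nonnegative symmetric form has a selfadjoint operator because its
    resolvent exists everywhere, by minimization. The Lipschitz boundary is only
    used to see that it is a null set: small translates of a graph along the
    vertical axis are disjoint. *)

(** * Square-integrable functions *)

(** Everything is reduced to L^2 facts about representatives: [u] is in [W_space] when it is
    measurable and [u] on [Omega], [jump u] and [killing u] are square-integrable, so one limit
    lemma, applied three times along the same subsequence, stands for completeness of [W_space]. One
    subsequence is enough because, up to a factor independent of [u], the value of [robin_ext u] at
    a point off the closure of [Omega] is an L^2 inner product of [u] with the kernel, hence follows
    the convergence of [u] in L^2. A Robin extension is not known beforehand to have finite energy,
    so minimality is proved between extended real integrals; the value 0 chosen on the boundary
    could spoil the comparison there, hence the null boundary. The energy of a bounded Lipschitz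
    function is finite through the bound min(1, r^2) r^(-n-2s), integrable at both ends because 0 <
    s < 1. Summation over dyadic shells replaces polar coordinates, and the same estimate shows that
    the Gamma integral converges, on which the positivity of [frac_const] depends. Integrability of
    [beta] makes the Robin term of bounded functions finite. *)

Section L2_theory.
Context {d} {T : measurableType d} {R : realType}.
Variables (mu : {measure set T -> \bar R}) (X : set T).
Hypothesis mX : measurable X.
Implicit Types u v w : T -> R.

Lemma L2_integrable_sqr u : L2 mu X u ->
  mu.-integrable X (fun x => (u x ^+ 2)%:E).
Proof.
move=> [mu_ uoo]; apply/integrableP; split.
  by apply/measurable_EFinP; exact: measurable_funX.
apply: le_lt_trans uoo; rewrite le_eqVlt; apply/orP; left; apply/eqP.
by apply: eq_integral => x _ /=; rewrite normrX.
Qed.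

Lemma L2_integrableM u v : L2 mu X u -> L2 mu X v ->
  mu.-integrable X (EFin \o (fun x => u x * v x)).
Proof.
move=> u2 v2; have [mu_ _] := u2; have [mv _] := v2.
have iuv := integrableD mX (L2_integrable_sqr u2) (L2_integrable_sqr v2).
apply: (le_integrable mX _ _ iuv).
  by apply/measurable_EFinP; exact: measurable_funM.
move=> x _ /=; rewrite lee_fin [leRHS]ger0_norm ?addr_ge0 ?sqr_ge0//.
by rewrite ler_norml; apply/andP; split; nra.
Qed.

Lemma L2P u : measurable_fun X u ->
  mu.-integrable X (fun x => (u x ^+ 2)%:E) -> L2 mu X u.
Proof.
move=> mu_ /integrableP[_ uoo]; split => //.
apply: le_lt_trans uoo; rewrite le_eqVlt; apply/orP; left; apply/eqP.
by apply: eq_integral => x _ /=; rewrite normrX.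
Qed.

Lemma L2_lin (c : R) u v : L2 mu X u -> L2 mu X v ->
  L2 mu X (fun x => c * u x + v x).
Proof.
move=> u2 v2; have [mu_ _] := u2; have [mv _] := v2.
have mcuv : measurable_fun X (fun x => c * u x + v x).
  by apply: measurable_funD => //; exact: measurable_funM.
apply: L2P => //.
have iuv := integrableD mX (integrableZl mX (2 * c ^+ 2) (L2_integrable_sqr u2))
              (integrableZl mX 2 (L2_integrable_sqr v2)).
apply: (le_integrable mX _ _ iuv).
  by apply/measurable_EFinP; exact: measurable_funX.
move=> x _ /=; rewrite lee_fin ger0_norm ?sqr_ge0//.
rewrite [leRHS]ger0_norm; last first.
  by apply: addr_ge0; apply: mulr_ge0; rewrite ?sqr_ge0//; apply: mulr_ge0;
    rewrite ?sqr_ge0.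
have aux (a b : R) : (a + b) ^+ 2 <= 2 * a ^+ 2 + 2 * b ^+ 2.
  by have h := sqr_ge0 (a - b); nra.
by have := aux (c * u x) (v x); rewrite exprMn mulrA.
Qed.

Lemma L2_cst0 : L2 mu X (fun=> 0).
Proof.
split; first exact: measurable_cst.
by under eq_integral do rewrite normr0 expr0n/=; rewrite integral0.
Qed.

Lemma L2_sub u v : L2 mu X u -> L2 mu X v -> L2 mu X (u \- v).
Proof.
move=> u2 v2; have := L2_lin (-1) v2 u2.
by congr (L2 mu X); apply/funext => x /=; ring.
Qed.

Lemma L2dotC u v : L2dot mu X u v = L2dot mu X v u.
Proof. by apply: eq_Rintegral => x _; rewrite mulrC. Qed.

Lemma L2dot_linl (c : R) u v w : L2 mu X u -> L2 mu X v -> L2 mu X w ->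
  L2dot mu X (fun x => c * u x + v x) w = c * L2dot mu X u w + L2dot mu X v w.
Proof.
move=> u2 v2 w2; rewrite /L2dot -RintegralZl//; last exact: L2_integrableM.
rewrite -RintegralD//; last exact: L2_integrableM.
  by apply: eq_Rintegral => x _; ring.
have := integrableZl mX c (L2_integrableM u2 w2).
by congr (mu.-integrable X _); apply/funext => x /=; rewrite EFinM.
Qed.

Lemma L2dot_linr (c : R) u v w : L2 mu X u -> L2 mu X v -> L2 mu X w ->
  L2dot mu X w (fun x => c * u x + v x) = c * L2dot mu X w u + L2dot mu X w v.
Proof. by move=> u2 v2 w2; rewrite L2dotC L2dot_linl// !(L2dotC w). Qed.

Lemma L2dot_ge0 u : 0 <= L2dot mu X u u.
Proof. by apply: Rintegral_ge0 => x _; exact: sqr_ge0. Qed.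

Lemma L2norm_sqr u : L2norm mu X u ^+ 2 = L2dot mu X u u.
Proof. by rewrite sqr_sqrtr// L2dot_ge0. Qed.

Lemma L2dotE u : L2 mu X u ->
  (\int[mu]_(x in X) (u x ^+ 2)%:E = (L2dot mu X u u)%:E)%E.
Proof.
move=> u2; rewrite /L2dot /Rintegral fineK//.
exact: (integrable_fin_num mX (L2_integrable_sqr u2)).
Qed.

Lemma L2dot_ae u u' v : L2 mu X u -> L2 mu X u' -> L2 mu X v ->
  u = u' %[ae mu in X] -> L2dot mu X u v = L2dot mu X u' v.
Proof.
move=> [mu_ _] [mu' _] [mv _] uu'; congr fine; apply: ae_eq_integral => //.
- by apply/measurable_EFinP; exact: measurable_funM.
- by apply/measurable_EFinP; exact: measurable_funM.
- by apply: filterS uu' => x uu' Xx; rewrite uu'.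
Qed.

Lemma L2dot_eq0 u : L2 mu X u -> L2dot mu X u u = 0 ->
  {ae mu, forall x, X x -> u x = 0}.
Proof.
move=> u2 uu0; have [mu_ _] := u2.
have : (\int[mu]_(x in X) `|(u x ^+ 2)%:E| = 0)%E.
  under eq_integral do rewrite gee0_abs ?lee_fin ?sqr_ge0//.
  by rewrite L2dotE// uu0.
have mu2 : measurable_fun X (fun x => (u x ^+ 2)%:E).
  by apply/measurable_EFinP; exact: measurable_funX.
move/(ae_eq_integral_abs mu mX mu2) => h.
apply: (filterS _ h) => x hx Xx; have [] := hx Xx.
by move/eqP; rewrite sqrf_eq0 => /eqP.
Qed.

(** Fatou in [j] for the squares of [u k - u (phi j)] carries the Cauchy bound over to [u k - w];
    then [w] is [u N] minus an L^2 function. The pointwise limit is given rather than constructed,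
    so that the lemma also applies to [jump] and [killing], whose limits are dictated by the limit
    on [Omega]. *)
Lemma L2_cauchy_lim (u : nat -> T -> R) (phi : nat -> nat) w :
  (forall k, L2 mu X (u k)) -> measurable_fun X w ->
  (forall k, (k <= phi k)%N) ->
  {ae mu, forall x, X x -> u (phi k) x @[k --> \oo] --> w x} ->
  (forall e, 0 < e -> exists N, forall j k, (N <= j)%N -> (N <= k)%N ->
     L2dot mu X (u j \- u k) (u j \- u k) < e) ->
  L2 mu X w /\ forall e, 0 < e -> exists N, forall k, (N <= k)%N ->
     L2dot mu X (u k \- w) (u k \- w) <= e.
Proof.
move=> u2 mw kphi uw cu.
have key e : 0 < e -> exists N, forall k, (N <= k)%N ->
    (\int[mu]_(x in X) ((u k x - w x) ^+ 2)%:E <= e%:E)%E.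
  move=> e0; have [N cN] := cu _ e0; exists N => k Nk.
  have muk j : measurable_fun X (fun x => ((u k x - u (phi j) x) ^+ 2)%:E).
    have [mk _] := u2 k; have [mj _] := u2 (phi j).
    by apply/measurable_EFinP; apply: measurable_funX; exact: measurable_funB.
  have fat := @fatou _ _ _ mu X mX
     (fun j x => ((u k x - u (phi j) x) ^+ 2)%:E) muk (fun j x _ => sqr_ge0 _).
  apply: (@le_trans _ _
    (\int[mu]_(x in X) limn_einf (fun j => ((u k x - u (phi j) x) ^+ 2)%:E))%E).
    apply: ae_ge0_le_integral => //.
    - by move=> x _; rewrite lee_fin sqr_ge0.
    - have [mk _] := u2 k.
      by apply/measurable_EFinP; apply: measurable_funX; exact: measurable_funB.
    - move=> x _; rewrite limn_einf_lim; apply: lime_ge.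
        exact: is_cvg_einfs.
      near=> m; apply: le_ereal_inf_tmp.
      by move=> _ [j /= _ <-]; rewrite lee_fin sqr_ge0.
    (* The lower limit is measurable as the opposite of an upper limit. *)
    - apply: (eq_measurable_fun
        (fun x => - limn_esup (fun j => - ((u k x - u (phi j) x) ^+ 2)%:E))%E).
        by move=> x _; rewrite limn_esupN oppeK.
      apply: measurableT_comp => //; apply: measurable_fun_limn_esup => j.
      exact: measurableT_comp.
    apply: filterS uw => x uw Xx.
    have h : ((u k x - u (phi j) x) ^+ 2)%:E @[j --> \oo] --> ((u k x - w x) ^+ 2)%:E.
      apply: cvg_EFin; first by near=> j.
      rewrite /comp /=.
      have h1 : u k x - u (phi j) x @[j --> \oo] --> u k x - w x.
        by apply: cvgB; [exact: cvg_cst|exact: uw].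
      by rewrite expr2; under eq_fun do rewrite expr2; exact: cvgM.
    by rewrite (cvg_limn_einf_sup h).1.
  apply: le_trans fat _.
  rewrite limn_einf_lim; apply: lime_le; first exact: is_cvg_einfs.
  (* The index [maxn m N] lies in the tail starting at [m] and past the Cauchy threshold [N]. *)
  near=> m; apply: (@le_trans _ _
     (\int[mu]_(x in X) ((u k x - u (phi (maxn m N)) x) ^+ 2)%:E)%E).
    by apply: ereal_inf_lbound; exists (maxn m N) => //=; exact: leq_maxl.
  have uu2 := L2_sub (u2 k) (u2 (phi (maxn m N))).
  by rewrite (L2dotE uu2) lee_fin ltW// cN// (leq_trans (leq_maxr m N)).
have w2 : L2 mu X w.
  have [N kN] := key 1 ltr01.
  have h : L2 mu X (u N \- w).
    split.
      by have [mN _] := u2 N; exact: measurable_funB.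
    apply: le_lt_trans (_ : (_ <= 1%:E)%E) _; last exact: ltry.
    apply: le_trans (kN _ (leqnn N)).
    rewrite le_eqVlt; apply/orP; left; apply/eqP; apply: eq_integral => x _.
    by rewrite -normrX ger0_norm// sqr_ge0.
  have := L2_sub (u2 N) h.
  by congr (L2 mu X); apply/funext => x /=; ring.
split => // e e0; have [N kN] := key _ e0; exists N => k Nk.
by rewrite -lee_fin -L2dotE; [exact: kN|exact: L2_sub].
Unshelve. all: by end_near.
Qed.

End L2_theory.

(** * Almost everywhere convergent subsequences of L^2 Cauchy sequences *)

Section L2_complete.
Context {d} {T : measurableType d} {R : realType}.
Variables (mu : {measure set T -> \bar R}) (X : set T).
Hypothesis mX : measurable X.

(** The increments are at most [(1 + M) 2^-k], a summable bound; [1 + M] in place of the square root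
    of [M] is harmless since [M <= (1 + M)^2]. *)
Lemma series_cvg_telescope (v : nat -> R) (M : R) :
  (forall k, 4 ^+ k * (v k.+1 - v k) ^+ 2 <= M) -> cvgn v.
Proof.
move=> vM.
have M0 : 0 <= M.
  by apply: le_trans (vM 0%N); rewrite mulr_ge0 ?sqr_ge0// exprn_ge0.
have cs : cvgn (series (telescope v)).
  apply: normed_cvg; apply: (@series_le_cvg _ _ (geometric (1 + M) 2^-1)).
  - by move=> k; exact: normr_ge0.
  - by move=> k /=; rewrite mulr_ge0 ?exprn_ge0// addr_ge0.
  - move=> k /=; rewrite exprVn ler_pdivlMr ?exprn_gt0//.
    rewrite -(@ler_pXn2r _ 2) ?nnegrE ?mulr_ge0 ?addr_ge0 ?exprn_ge0//.
    rewrite exprMn real_normK ?num_real// mulrC -exprM mulnC exprM.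
    rewrite [X in X ^+ k * _](_ : _ = 4); last by rewrite expr2; ring.
    by apply: le_trans (vM k) _; nra.
  - by apply: is_cvg_geometric_series; rewrite ger0_norm// invf_lt1// ltr1n.
rewrite (_ : v = fun n => v 0%N + series (telescope v) n); last first.
  by apply/funext => n; exact: eq_sum_telescope.
by apply: is_cvgD => //; exact: is_cvg_cst.
Qed.

(** The sum of the squared increments of the subsequence, weighted by [4^k], has finite integral,
    hence is finite almost everywhere; at such a point every term is below the sum, which is the
    hypothesis of [series_cvg_telescope]. *)
Lemma L2_cauchy_subseq (u : nat -> T -> R) : (forall k, L2 mu X (u k)) ->
  (forall e, 0 < e -> exists N, forall j k, (N <= j)%N -> (N <= k)%N ->
     L2dot mu X (u j \- u k) (u j \- u k) < e) ->
  exists (phi : nat -> nat) (w : T -> R), [/\ forall k, (k <= phi k)%N,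
    measurable_fun X w &
    {ae mu, forall x, X x -> u (phi k) x @[k --> \oo] --> w x}].
Proof.
move=> u2 cu.
(* The factor [4^-k] cancels the weight [4^k]; the remaining [2^-(k+1)] makes the integrals sum to
   at most 1. *)
pose e k : R := 4 ^- k * (2 ^+ k.+1)^-1.
have e0 k : 0 < e k by rewrite mulr_gt0// invr_gt0 exprn_gt0.
have /choice[N hN] : forall k, exists N, forall i j, (N <= i)%N -> (N <= j)%N ->
    L2dot mu X (u i \- u j) (u i \- u j) < e k by move=> k; exact: cu.
(* The partial sums put both [phi k] and [phi k.+1] past [N k]. *)
pose phi k := (k + \sum_(i < k.+1) N i)%N.
have Nphi k : (N k <= phi k)%N.
  by rewrite /phi big_ord_recr /= addnA leq_addl.
have Nphi1 k : (N k <= phi k.+1)%N.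
  apply: leq_trans (Nphi k) _.
  by rewrite /phi [X in (_ <= _ + X)%N]big_ord_recr/= leq_add// leq_addr.
pose v k := u (phi k).
have v2 k : L2 mu X (v k) by exact: u2.
have dv2 k : L2 mu X (v k.+1 \- v k) by exact: L2_sub.
pose g (k : nat) (x : T) : \bar R := (4 ^+ k * (v k.+1 x - v k x) ^+ 2)%:E.
have g0 k x : (0 <= g k x)%E by rewrite lee_fin mulr_ge0 ?sqr_ge0 ?exprn_ge0.
have mg k : measurable_fun X (g k).
  apply/measurable_EFinP; apply: measurable_funM; first exact: measurable_cst.
  by apply: measurable_funX; have [] := dv2 k.
have gle k : (\int[mu]_(x in X) g k x <= (1 / (2 ^ k.+1)%:R)%:E)%E.
  under eq_integral do rewrite /g EFinM.
  rewrite ge0_integralZl_EFin// ?exprn_ge0//; last 2 first.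
  - by move=> x _; rewrite lee_fin sqr_ge0.
  - by apply/measurable_EFinP; apply: measurable_funX; have [] := dv2 k.
  rewrite (L2dotE mX (dv2 k)) -EFinM lee_fin.
  have := hN k _ _ (Nphi1 k) (Nphi k) => /ltW h.
  apply: le_trans (ler_wpM2l _ h) _; first exact: exprn_ge0.
  by rewrite /e mulrA divff ?expf_neq0// natrX.
have ig : mu.-integrable X (fun x => \sum_(k <oo) g k x)%E.
  apply/integrableP; split.
    by apply: (@ge0_emeasurable_sum _ _ _ _ _ xpredT).
  under eq_integral do rewrite gee0_abs ?nneseries_ge0//.
  rewrite integral_nneseries//.
  apply: (@le_lt_trans _ _ (\sum_(k <oo) (1 / (2 ^ k.+1)%:R)%:E)%E).
    by apply: lee_nneseries => // k _ _; apply: integral_ge0.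
  by apply: le_lt_trans (epsilon_trick0 _ ler01) _; exact: ltry.
have cv : {ae mu, forall x, X x -> cvgn (fun k => v k x)}.
  have h := integrable_ae mX ig; apply: (filterS _ h) => x hx Xx.
  have {}hx := hx Xx.
  apply: (@series_cvg_telescope _ (fine (\sum_(k <oo) g k x)%E)) => k.
  rewrite -lee_fin fineK//.
  apply: le_trans (@nneseries_lim_ge _ _ xpredT 0%N k.+1 _); last by [].
  by rewrite big_nat_recr//= leeDr// sume_ge0.
(* The upper limit is measurable whether or not the sequence converges at every point. *)
exists phi, (fun x => fine (limn_esup (fun k => (v k x)%:E))); split.
- by move=> k; exact: leq_addr.
- apply: measurableT_comp; first exact: fine_measurable.
  apply: measurable_fun_limn_esup => k; apply/measurable_EFinP.
  by have [] := v2 k.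
- apply: (filterS _ cv) => x cx Xx; have {}cx := cx Xx.
  have h : (v k x)%:E @[k --> \oo] --> (limn (fun k => v k x))%:E.
    by apply: cvg_EFin; [exact: nearW|exact: cx].
  by rewrite (cvg_limn_einf_sup h).2.
Qed.

End L2_complete.

(** * The operator of a closed form *)

Section abstract_forms.
Context {d} {T : measurableType d} {R : realType}.
Variables (mu : {measure set T -> \bar R}) (X : set T).
Hypothesis mX : measurable X.
Local Notation dot := (L2dot mu X).

(** If [Q = 0] the polynomial is affine and takes the value -1 at [t = - (A + 1) / (2 b)] unless
    [b = 0]; otherwise its minimum is at [t = - b / Q]. Besides Cauchy-Schwarz, it gives
    orthogonality to a minimizer when [A = 0], and an approximate Euler equation for a
    near-minimizer when [A] is small. *)
Lemma discriminant_le (A b Q : R) : 0 <= A -> 0 <= Q ->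
  (forall t, 0 <= A + 2 * t * b + t ^+ 2 * Q) -> b ^+ 2 <= A * Q.
Proof.
move=> A0 Q0 h; have [Q_eq0|Qn0] := eqVneq Q 0.
  have [->|bn0] := eqVneq b 0; first by rewrite expr0n mulr_ge0.
  have := h (- (A + 1) / (2 * b)); rewrite Q_eq0 mulr0 addr0.
  rewrite (_ : A + _ = -1); first by rewrite oppr_ge0 ler10.
  by field.
have {Qn0}Q_gt0 : 0 < Q by rewrite lt0r Qn0.
have := h (- b / Q); rewrite (_ : _ + _ = A - b ^+ 2 / Q).
  by rewrite subr_ge0 ler_pdivrMr.
by field; rewrite gt_eqF.
Qed.

Lemma le0_of_small (x C : R) : 0 <= C -> (forall e, 0 < e -> x <= e * C) ->
  x <= 0.
Proof.
move=> C0 h; rewrite leNgt; apply/negP => x0.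
have C1 : 0 < C + 1 by rewrite ltr_wpDl.
have := h (x / (2 * (C + 1))); rewrite divr_gt0 ?mulr_gt0// => /(_ isT).
rewrite mulrAC ler_pdivlMr ?mulr_gt0//; nra.
Qed.

Lemma L2dot_CS u v : L2 mu X u -> L2 mu X v ->
  dot u v ^+ 2 <= dot u u * dot v v.
Proof.
move=> u2 v2; apply: discriminant_le; rewrite ?L2dot_ge0// => t.
have := L2dot_ge0 mu X (fun x => t * v x + u x).
have w2 := L2_lin mX t v2 u2.
rewrite (L2dot_linl mX)// !(L2dot_linr mX)//.
by rewrite (L2dotC mu X v u) => h; nra.
Qed.

Lemma L2dot_subl u v w : L2 mu X u -> L2 mu X v -> L2 mu X w ->
  dot (u \- v) w = dot u w - dot v w.
Proof.
move=> u2 v2 w2; rewrite (_ : u \- v = fun x => (-1) * v x + u x).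
  by rewrite (L2dot_linl mX)//; ring.
by apply/funext => x /=; ring.
Qed.

Lemma L2dot_subr u v w : L2 mu X u -> L2 mu X v -> L2 mu X w ->
  dot w (u \- v) = dot w u - dot w v.
Proof. by move=> u2 v2 w2; rewrite L2dotC L2dot_subl// !(L2dotC _ _ w). Qed.

(** A consequence of the parallelogram identity; the factors 2 spare square roots. *)
Lemma L2dot_triangle u v w : L2 mu X u -> L2 mu X v -> L2 mu X w ->
  dot (u \- w) (u \- w) <=
  2 * dot (u \- v) (u \- v) + 2 * dot (v \- w) (v \- w).
Proof.
move=> u2 v2 w2.
have aux p r : L2 mu X p -> L2 mu X r ->
    dot (fun x => 1 * p x + r x) (fun x => 1 * p x + r x) <=
    2 * dot p p + 2 * dot r r.
  move=> p2 r2; have := L2dot_ge0 mu X (p \- r).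
  have pr2 := L2_sub mX p2 r2; have qr2 := L2_lin mX 1 p2 r2.
  rewrite L2dot_subl// !L2dot_subr// (L2dot_linl mX)// !(L2dot_linr mX)//.
  by rewrite (L2dotC mu X r p) => h; lra.
apply: le_trans (aux _ _ (L2_sub mX u2 v2) (L2_sub mX v2 w2)).
rewrite (_ : u \- w = fun x => 1 * (u \- v) x + (v \- w) x)//.
by apply/funext => x /=; ring.
Qed.

Lemma L2norm_lt u (e : R) : 0 < e -> (L2norm mu X u < e) = (dot u u < e ^+ 2).
Proof.
move=> e0; rewrite -(@ltr_pXn2r _ 2) ?nnegrE ?sqrtr_ge0 ?ltW//.
by rewrite L2norm_sqr.
Qed.

Section dense.
Variables (D : set (T -> R)).
Hypotheses (DL2 : D `<=` L2 mu X) (dD : densely_defined mu X D).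

(** For [v] in [D] close to [r], orthogonality gives [(r, r) = (r, r - v)], and Cauchy-Schwarz then
    bounds [(r, r)] by the squared distance from [r] to [v]. *)
Lemma dense_orth r : L2 mu X r -> (forall v, D v -> dot r v = 0) ->
  {ae mu, forall x, X x -> r x = 0}.
Proof.
move=> r2 rD; apply: (L2dot_eq0 mX r2).
apply/eqP; rewrite eq_le L2dot_ge0 andbT.
apply: (@le0_of_small _ 1) => // e e0; rewrite mulr1.
have se0 : 0 < Num.sqrt e by rewrite sqrtr_gt0.
have [v Dv] := dD r2 se0; rewrite L2norm_lt// sqr_sqrtr ?(ltW e0)// => /ltW rve.
have v2 := DL2 Dv; have rv2 := L2_sub mX r2 v2.
have := L2dot_CS r2 rv2; rewrite {1}L2dot_subr// (rD v)// subr0 expr2.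
have [->|rr0] := eqVneq (dot r r) 0; first by move=> _; exact: ltW.
rewrite ler_pM2l ?lt0r ?rr0 ?L2dot_ge0// => h; exact: le_trans h rve.
Qed.

End dense.

Variables (D : set (T -> R)) (a : (T -> R) -> (T -> R) -> R).
Hypotheses (ba : bilinear_form_on mu X D a) (sa : symmetric_on D a)
  (na : nonneg_on D a) (ca : closed_form mu X D a)
  (da : densely_defined mu X D).

Let DL2 : D `<=` L2 mu X. Proof. exact: form_dom_sub ba. Qed.

Let D_sub u v : D u -> D v -> D (u \- v).
Proof.
move=> Du Dv; have := form_dom_lin ba (-1) Dv Du.
by congr D; apply/funext => x /=; ring.
Qed.

Let a_subl u v w : D u -> D v -> D w -> a (u \- v) w = a u w - a v w.
Proof.
move=> Du Dv Dw; rewrite (_ : u \- v = fun x => (-1) * v x + u x).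
  by rewrite (form_linl ba)//; ring.
by apply/funext => x /=; ring.
Qed.

Lemma form_norm_lt u (e : R) : D u -> 0 < e ->
  (form_norm mu X a u < e) = (a u u + dot u u < e ^+ 2).
Proof.
move=> Du e0; rewrite -(@ltr_pXn2r _ 2) ?nnegrE ?sqrtr_ge0 ?ltW//.
by rewrite /form_norm sqr_sqrtr L2norm_sqr// addr_ge0 ?na ?L2dot_ge0.
Qed.

Section resolvent.
Variable l : R.
Hypothesis l0 : 0 < l.

Let q u v := a u v + l * dot u v.

Let q_ge0 u : D u -> 0 <= q u u.
Proof.
by move=> Du; rewrite addr_ge0 ?na// mulr_ge0 ?L2dot_ge0// ltW.
Qed.

Let q_linl c u v w : D u -> D v -> D w ->
  q (fun x => c * u x + v x) w = c * q u w + q v w.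
Proof.
move=> Du Dv Dw; have := (DL2 Du, DL2 Dv, DL2 Dw) => -[[u2 v2] w2].
by rewrite /q (form_linl ba)// (L2dot_linl mX)//; ring.
Qed.

Let q_sym u v : D u -> D v -> q u v = q v u.
Proof. by move=> Du Dv; rewrite /q sa// L2dotC. Qed.

Let q_linr c u v w : D u -> D v -> D w ->
  q w (fun x => c * u x + v x) = c * q w u + q w v.
Proof.
move=> Du Dv Dw; rewrite q_sym// ?q_linl// ?(q_sym Dw)//.
exact: form_dom_lin ba _ _ _ _ _.
Qed.

Let q_expand t u v : D u -> D v ->
  q (fun x => t * v x + u x) (fun x => t * v x + u x) =
  q u u + 2 * t * q u v + t ^+ 2 * q v v.
Proof.
move=> Du Dv; have Dw := form_dom_lin ba t Dv Du.
by rewrite q_linl// !q_linr// (q_sym Dv Du); ring.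
Qed.

Let q_CS u v : D u -> D v -> q u v ^+ 2 <= q u u * q v v.
Proof.
move=> Du Dv; apply: discriminant_le; rewrite ?q_ge0// => t.
by rewrite -q_expand// q_ge0//; exact: form_dom_lin ba _ _ _ _ _.
Qed.

(* The solution minimizes [q u u - 2 (h, u)]: minimizing sequences are Cauchy by
   the parallelogram identity. *)
Lemma form_resolvent h : L2 mu X h ->
  exists2 w, D w & forall v, D v -> a w v + l * dot w v = dot h v.
Proof.
move=> h2; pose J u := q u u - 2 * dot h u.
(* Completing the square: the squared norm of [l u - h] is non-negative, and [a u u] is dropped. *)
have Jge u : D u -> - (dot h h / l) <= J u.
  move=> Du; have u2 := DL2 Du.
  have := L2dot_ge0 mu X ((fun x => l * u x + 0) \- h).
  have lu2 := L2_lin mX l u2 (L2_cst0 mu X).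
  have z2 := L2_cst0 mu X.
  have dz v : L2 mu X v -> dot (fun=> 0) v = 0.
    move=> v2; have := L2dot_linl mX 1 z2 z2 v2.
    rewrite (_ : (fun=> 1 * 0 + 0) = (fun=> 0)); last first.
      by apply/funext => x; ring.
    by move=> ?; lra.
  rewrite L2dot_subl// ?L2dot_subr//; last exact: L2_sub.
  rewrite (L2dot_linl mX)// !(L2dot_linr mX)//.
  rewrite (L2dot_linl mX)// (L2dotC mu X u (fun=> 0)) (L2dotC mu X h (fun=> 0)).
  rewrite !dz// (L2dotC mu X u h) => H.
  rewrite lerNl /J /q ler_pdivlMr//.
  have la := mulr_ge0 (ltW l0) (na Du); lra.
have hJ : has_inf (J @` D).
  split; first by exists (J (fun=> 0)), (fun=> 0) => //; exact: form_dom0 ba.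
  by exists (- (dot h h / l)) => _ [u Du <-]; exact: Jge.
pose m := inf (J @` D).
have mJ u : D u -> m <= J u.
  by move=> Du; apply: ge_inf; [have [] := hJ|exists u].
have Jexp t u v : D u -> D v -> J (fun x => t * v x + u x) =
    J u + 2 * t * (q u v - dot h v) + t ^+ 2 * q v v.
  move=> Du Dv; have u2 := DL2 Du; have v2 := DL2 Dv.
  by rewrite /J q_expand// (L2dot_linr mX)//; ring.
have ek0 k : (0 : R) < k.+1%:R^-1 by rewrite invr_gt0.
have /choice[u hu] : forall k, exists u, D u /\ J u < m + k.+1%:R^-1.
  move=> k; have [_ [u Du <-] Ju] := inf_adherent (ek0 k) hJ.
  by exists u.
have Du k : D (u k) by have [] := hu k.
have Ju k : J (u k) < m + k.+1%:R^-1 by have [] := hu k.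
(* At [t = 1/2] the expansion [Jexp] is taken at the midpoint of [u j] and [u k]. Half of the
   left-hand side equals [J (u j) + J (u k)] minus twice the value of [J] at the midpoint, which is
   at least [m]. *)
have qu j k : q (u j \- u k) (u j \- u k) <= 2 * (j.+1%:R^-1 + k.+1%:R^-1).
  have Djk := D_sub (Du j) (Du k).
  have E1 := Jexp 1 _ _ (Du k) Djk.
  have E2 := Jexp 2^-1 _ _ (Du k) Djk.
  have := mJ _ (form_dom_lin ba 2^-1 Djk (Du k)).
  rewrite {}E2; move: E1.
  rewrite (_ : (fun x => _) = u j); last by apply/funext => x /=; ring.
  have := Ju j; have := Ju k.
  move: (q (u j \- u k) _) (q (u k) _ - _) => Q B.
  move: (J _) (J _) => Jk Jj.
  move: (_^-1) => ej; move: (_^-1) => ek.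
  by move=> *; lra.
have eps_small (e : R) : 0 < e -> exists N, forall k, (N <= k)%N -> k.+1%:R^-1 < e.
  move=> e0; have [N _ hN] := near_infty_natSinv_lt (PosNum e0).
  by exists N => k Nk; exact: hN.
have cu e : 0 < e -> exists N, forall j k, (N <= j)%N -> (N <= k)%N ->
    form_norm mu X a (u j \- u k) < e.
  (* The squared form norm is at most [K] times [q]; the 4 below comes from the bound in [qu], with
     both inverses small. *)
  move=> e0; pose K := 1 + l^-1.
  have K0 : 0 < K by rewrite addr_gt0// invr_gt0.
  have [|N hN] := eps_small (e ^+ 2 / (4 * K)).
    by rewrite divr_gt0 ?exprn_gt0// mulr_gt0.
  exists N => j k Nj Nk; have Djk := D_sub (Du j) (Du k).
  rewrite form_norm_lt//.
  apply: (@le_lt_trans _ _ (K * q (u j \- u k) (u j \- u k))).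
    have d0 := L2dot_ge0 mu X (u j \- u k).
    have a0 := na Djk.
    rewrite /q /K; move: (dot _ _) (a _ _) d0 a0 => y x y0 x0.
    have -> : (1 + l^-1) * (x + l * y) = x + y + (l * y + l^-1 * x).
      by field; rewrite gt_eqF.
    by rewrite lerDl addr_ge0// mulr_ge0// ?invr_ge0 ltW.
  have := hN _ Nj; have := hN _ Nk; rewrite !ltr_pdivlMr ?mulr_gt0//.
  have := qu j k; move: (q _ _) => Q.
  move: (_^-1) => ej; move: (_^-1) => ek.
  by move=> *; nra.
have [w Dw uw] := ca Du cu.
exists w => // v Dv.
have smallw e : 0 < e -> exists N, forall k, (N <= k)%N ->
    q (u k \- w) (u k \- w) <= e.
  move=> e0; have L0 : 0 < 1 + l by rewrite addr_gt0.
  have se0 : 0 < Num.sqrt (e / (1 + l)) by rewrite sqrtr_gt0 divr_gt0.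
  move/cvgrPdist_lt : uw => /(_ _ se0)[N _ hN].
  exists N => k Nk; have /= := hN _ Nk.
  rewrite sub0r normrN ger0_norm ?sqrtr_ge0//.
  have Dukw := D_sub (Du k) Dw.
  rewrite form_norm_lt// sqr_sqrtr; last by rewrite ltW// divr_gt0.
  rewrite ltr_pdivlMr// /q.
  move: (na Dukw) (L2dot_ge0 mu X (u k \- w)).
  move: (dot _ _) (a _ _) => y x x0 y0 xye.
  by have xl := mulr_ge0 x0 (ltW l0); lra.
suff : q w v - dot h v = 0 by move/eqP; rewrite subr_eq0 => /eqP.
apply/eqP; rewrite -sqrf_eq0 eq_le sqr_ge0 andbT.
(* The residual of [w] is a difference of two terms whose squares are at most [e] times [q v v]; the
   square of a difference is at most twice the sum of the squares, hence the 4. *)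
apply: (@le0_of_small _ (4 * q v v)); first by rewrite mulr_ge0// q_ge0.
move=> e e0; have [N1 hN1] := eps_small _ e0; have [N2 hN2] := smallw _ e0.
pose k := maxn N1 N2.
(* [J (u k)] is within [e] of the infimum, so moving from [u k] along [v] lowers [J] by at most [e];
   the discriminant of this quadratic polynomial bounds the first variation. *)
have B1 : (q (u k) v - dot h v) ^+ 2 <= e * q v v.
  apply: discriminant_le; rewrite ?q_ge0 ?ltW// => t.
  have := mJ _ (form_dom_lin ba t Dv (Du k)); rewrite Jexp//.
  have := lt_trans (Ju k) (_ : m + k.+1%:R^-1 < m + e).
  rewrite ltrD2l => /(_ (hN1 k (leq_maxl _ _))).
  by move: (q (u k) v - dot h v) (q v v) (J _) => b Q Jk *; lra.
have B2 : q (u k \- w) v ^+ 2 <= e * q v v.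
  apply: le_trans (q_CS (D_sub (Du k) Dw) Dv) _.
  by rewrite ler_wpM2r ?q_ge0// hN2// leq_maxr.
have -> : q w v - dot h v = (q (u k) v - dot h v) - q (u k \- w) v.
  have := (DL2 (Du k), DL2 Dw, DL2 Dv) => -[[uk2 w2] v2].
  by rewrite /q a_subl// L2dot_subl//; ring.
move: B1 B2; move: (q (u k) v - _) (q (_ \- _) _) (q v v) => x y Q *.
have := sqr_ge0 (x + y); nra.
Qed.

End resolvent.

(** For [A] the operator of the form, [w = l (A + l)^-1 v] approaches [v] as [l] grows: with
    [z = w - v] the resolvent equation reads [l (z, z) = - a z z - a v z], which is at most
    [a v v / 4] because [a] is non-negative at [2 z + v]. The choice of [l] makes [(z, z)] smaller
    than [e^2 / 4]. *)
Lemma form_dom_op_dense : densely_defined mu X (op_dom (form_operator mu X D a)).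
Proof.
move=> u e u2 e0; have e20 : 0 < e / 2 by rewrite divr_gt0.
have [v Dv] := da u2 e20; rewrite L2norm_lt// => uv.
have v2 := DL2 Dv.
pose l := a v v / e ^+ 2 + 1.
have l0 : 0 < l by rewrite ltr_wpDl// divr_ge0 ?na// exprn_ge0// ltW.
have [w Dw hw] := form_resolvent l0 (L2_lin mX l v2 (L2_cst0 mu X)).
have w2 := DL2 Dw.
have hw' x : D x -> a w x + l * dot w x = l * dot v x.
  move=> Dx; have x2 := DL2 Dx; rewrite hw//.
  (* Splitting [l] as [(l - 1) + 1] makes linearity applicable with no inner product against the
     zero function. *)
  have -> : (fun y => l * v y + 0) = (fun y => (l - 1) * v y + v y).
    by apply/funext => y; ring.
  by rewrite (L2dot_linl mX)//; ring.
exists w.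
  exists (fun x => l * (v \- w) x + 0); split => //.
    by apply: L2_lin => //; [exact: L2_sub|exact: L2_cst0].
  move=> x Dx; have x2 := DL2 Dx; have vw2 := L2_sub mX v2 w2.
  have -> : (fun y => l * (v \- w) y + 0) =
            (fun y => (l - 1) * (v \- w) y + (v \- w) y).
    by apply/funext => y; ring.
  rewrite (L2dot_linl mX)// L2dot_subl//.
  have := hw' _ Dx; move=> E; lra.
rewrite L2norm_lt//.
apply: le_lt_trans (L2dot_triangle u2 v2 w2) _.
have Dz := D_sub Dw Dv.
have zz : dot (v \- w) (v \- w) = dot (w \- v) (w \- v).
  have wv2 := L2_sub mX w2 v2; have vw2 := L2_sub mX v2 w2.
  by rewrite !L2dot_subl// !L2dot_subr//; ring.
have E1 : a (w \- v) (w \- v) + a v (w \- v) + l * dot (w \- v) (w \- v) = 0.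
  have := hw' _ Dz; rewrite (a_subl Dw Dv Dz) (L2dot_subl w2 v2 (DL2 Dz)).
  by move=> ?; lra.
have E2 : 0 <= 4 * a (w \- v) (w \- v) + 4 * a v (w \- v) + a v v.
  have := na (form_dom_lin ba 2 Dz Dv).
  rewrite (form_linl ba)// ?(form_linr ba)//; last exact: form_dom_lin ba _ _ _ _ _.
  by rewrite (sa Dz Dv) => ?; lra.
rewrite zz; have E3 : 4 * l * dot (w \- v) (w \- v) <= a v v by lra.
have E4 : a v v < e ^+ 2 * l.
  by rewrite /l mulrDr mulrCA divff ?gt_eqF ?exprn_gt0// !mulr1 ltrDl exprn_gt0.
have E5 : 4 * dot (w \- v) (w \- v) < e ^+ 2.
  by rewrite -(ltr_pM2r l0); lra.
rewrite exprMn in uv; lra.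
Qed.

(** Symmetry of the form puts the operator [A] inside its adjoint. Conversely, for [(w, g)] in the
    adjoint, [w' = (A + 1)^-1 (w + g)] is in the domain, and [w - w'] is orthogonal to the range of
    [A + 1], which is all of L^2; hence [w = w'] almost everywhere. *)
Theorem form_operator_selfadjoint :
  selfadjoint_operator mu X (form_operator mu X D a).
Proof.
split.
- by move=> u f [Du f2 _]; split => //; exact: DL2.
- move=> u f g [Du f2 uf] [_ g2 ug].
  have fg2 := L2_sub mX f2 g2.
  have h : {ae mu, forall x, X x -> (f \- g) x = 0}.
    apply: (dense_orth DL2 da fg2) => v Dv.
    by have v2 := DL2 Dv; rewrite L2dot_subl// -uf// -ug// subrr.
  apply: (filterS _ h) => x + Xx => /(_ Xx) /eqP.
  by rewrite /= subr_eq0 => /eqP.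
- exact: form_dom_op_dense.
- move=> w g; split; last first.
    move=> [Dw g2 wg]; split => //; first exact: DL2.
    move=> u f [Du f2 uf].
    by rewrite -uf// sa// wg// L2dotC.
  move=> [w2 g2 adj].
  have [w' Dw' hw'] := form_resolvent ltr01 (L2_lin mX 1 w2 g2).
  have w'2 := DL2 Dw'.
  have ww2 := L2_sub mX w2 w'2.
  have ww' : w = w' %[ae mu in X].
    have : {ae mu, forall x, X x -> (w \- w') x = 0}.
      apply: (L2dot_eq0 mX ww2).
      (* The vector [w - w'] is itself of the form [(A + 1) u]; pairing the adjoint relation with
         this [u] gives its norm. *)
      have [u Du hu] := form_resolvent ltr01 ww2.
      have u2 := DL2 Du.
      have E0 : dot ((w \- w') \- u) w = dot u g.
        apply: adj; split => //; first exact: L2_sub.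
        by move=> v Dv; have v2 := DL2 Dv; rewrite L2dot_subl// -hu//; ring.
      move: E0; rewrite L2dot_subl// => E1.
      have := hu _ Dw'; have := hw' _ Du; rewrite (L2dot_linl mX)//.
      rewrite (sa Du Dw') (L2dotC _ _ u w') (L2dotC _ _ w u) (L2dotC _ _ g u).
      rewrite [X in X = 0]L2dot_subr//; lra.
    move=> h; apply: (filterS _ h) => x + Xx => /(_ Xx) /eqP.
    by rewrite /= subr_eq0 => /eqP.
  have Dw : D w.
    apply: form_dom_ae ba _ _ Dw' w2 _.
    by apply: (filterS _ ww') => x + Xx => /(_ Xx).
  split => // v Dv; have v2 := DL2 Dv.
  rewrite (form_ae ba Dw Dw' Dv ww').1.
  have := hw' _ Dv; rewrite (L2dot_linl mX)// (L2dot_ae mX w2 w'2 v2 ww').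
  by move=> ?; lra.
Qed.

End abstract_forms.

(** * Lebesgue measure on R^n *)

Section lebesgue_rV.
Context {R : realType}.

Lemma lebesgue_measure_translation (t : R) (A : set R) : measurable A ->
  pushforward lebesgue_measure
    ((fun x => x + t) : measurableTypeR R -> measurableTypeR R) A =
  lebesgue_measure A.
Proof.
move=> mA; apply/esym/lebesgue_measure_unique => //=.
  by apply: measurable_funD => //; exact: measurable_cst.
move=> mt _ [[a b]] _ <-.
rewrite /pushforward.
have -> : (fun x : R => x + t) @^-1` `]a, b] = `]a - t, b - t]%classic.
  by apply/seteqP; split => x /=; rewrite !in_itv/= ltrBlDr lerBrDr.
by rewrite !lebesgue_measure_itv/= !lte_fin ltrD2r -!EFinB opprB addrA subrK.
Qed.

Lemma continuous_measurable_rV n (f : 'rV[R]_n -> R) : continuous f ->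
  measurable_fun setT f.
Proof.
move=> cf; apply: (measurability _ (RGenOpens.measurableE R)).
move=> _ [_ [a [b ->] <-]]; rewrite setTI rV_measurableE.
apply: sub_sigma_algebra; apply: open_comp; last exact: interval_open.
by move=> x _; exact: cf.
Qed.

Lemma open_measurable_rV n (U : set 'rV[R]_n) : open U -> measurable U.
Proof. by move=> oU; rewrite rV_measurableE; exact: sub_sigma_algebra. Qed.

Lemma closed_measurable_rV n (F : set 'rV[R]_n) : closed F -> measurable F.
Proof.
move=> cF; rewrite -[F]setCK; apply: measurableC.
by apply: open_measurable_rV; exact: closed_openC.
Qed.

Lemma edot_continuous n (e : 'rV[R]_n) : continuous (fun x => edot x e).
Proof.
apply: continuous_big => [|i _ x]; first exact: (@add_continuous R).
have cx : {for x, continuous (fun y : 'rV[R]_n => y ord0 i)}.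
  exact: coord_continuous.
by apply: continuousM => //; exact: cst_continuous.
Qed.

Lemma enorm_continuous n : continuous (@enorm R n).
Proof.
move=> x; apply: continuous_comp; last exact: sqrt_continuous.
apply: continuous_big => [|i _ y]; first exact: (@add_continuous R).
have cy : {for y, continuous (fun y : 'rV[R]_n => y ord0 i)}.
  exact: coord_continuous.
exact: (continuousM cy cy).
Qed.

Lemma measurable_enorm n : measurable_fun setT (@enorm R n).
Proof. by apply: continuous_measurable_rV; exact: enorm_continuous. Qed.

Lemma enormB_continuous n (c : 'rV[R]_n) :
  continuous (fun x : 'rV[R]_n => enorm (x - c)).
Proof.
move=> x; apply: continuous_comp; last exact: enorm_continuous.
apply: (@continuousB R 'rV[R]_n 'rV[R]_n id (cst c)); first by move=> A.
exact: cst_continuous.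
Qed.

Lemma enorm_ge0 n (x : 'rV[R]_n) : 0 <= enorm x.
Proof. exact: sqrtr_ge0. Qed.

Lemma enorm_sqr n (x : 'rV[R]_n) : enorm x ^+ 2 = edot x x.
Proof.
rewrite sqr_sqrtr; last by apply: sumr_ge0 => i _; exact: sqr_ge0.
by apply: eq_bigr => i _; rewrite expr2.
Qed.

Lemma enormN n (x : 'rV[R]_n) : enorm (- x) = enorm x.
Proof. by congr Num.sqrt; apply: eq_bigr => i _; rewrite mxE sqrrN. Qed.

Lemma enormB n (x y : 'rV[R]_n) : enorm (x - y) = enorm (y - x).
Proof. by rewrite -enormN opprB. Qed.

Lemma le_coord_enorm n (x : 'rV[R]_n) i : `|x ord0 i| <= enorm x.
Proof.
rewrite -sqrtr_sqr ler_wsqrtr// (bigD1 i)//= lerDl.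
by apply: sumr_ge0 => j _; exact: sqr_ge0.
Qed.

(** By induction on the dimension: the translated measure agrees with the product measure on
    rectangles, which determine it. *)
Lemma lebesgue_measure_rV_translation n (t : 'rV[R]_n) (A : set 'rV[R]_n) :
  measurable A ->
  lebesgue_measure_rV n ((fun x => x + t) @^-1` A) = lebesgue_measure_rV n A.
Proof.
elim: n t A => [|n IH] t A mA.
  have -> : (fun x : 'rV[R]_0 => x + t) = id.
    by apply/funext => x; apply/rowP => -[].
  by rewrite preimage_id.
pose t' : 'rV[R]_n := \row_j t ord0 (lift ord0 j).
have mt' : measurable_fun setT (fun x : 'rV[R]_n => x + t').
  apply/measurable_fun_coord_rVP => i; under eq_fun do rewrite mxE.
  by apply: measurable_funD; [exact: measurable_coord_rV|exact: measurable_cst].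
have mt0 : measurable_fun setT (fun x : measurableTypeR R =>
    x + t ord0 ord0 : measurableTypeR R).
  by apply: measurable_funD => //; exact: measurable_cst.
pose tau (p : measurableTypeR R * 'rV[R]_n) : measurableTypeR R * 'rV[R]_n :=
  (p.1 + t ord0 ord0, p.2 + t').
have mtau : measurable_fun setT tau.
  apply/measurable_fun_pair => /=.
    exact: (measurableT_comp mt0 measurable_fst).
  exact: (measurableT_comp mt' measurable_snd).
have consD p : @cons_rV R n p + t = cons_rV (tau p).
  apply/rowP => i; rewrite mxE; case: (unliftP ord0 i) => [j ->|->].
  - by rewrite !cons_rV_lift !mxE.
  - by rewrite !cons_rV0.
have mcA : measurable (@cons_rV R n @^-1` A).
  by rewrite -[X in measurable X]setTI; exact: measurable_cons_rV.
rewrite /= /lebesgue_cons /pushforward.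
rewrite (_ : _ @^-1` _ = tau @^-1` (@cons_rV R n @^-1` A)); last first.
  by apply/seteqP; split => p /=; rewrite consD.
transitivity (pushforward (lebesgue_measure \x lebesgue_measure_rV n)%E tau
  (@cons_rV R n @^-1` A)) => //.
apply/esym/product_measure_unique => // B C mB mC /=.
rewrite /pushforward.
have -> : tau @^-1` (B `*` C) =
  ((fun x : R => x + t ord0 ord0) @^-1` B) `*` ((fun x => x + t') @^-1` C).
  by apply/seteqP; split.
rewrite product_measure1E//; last 2 first.
- by rewrite -[X in measurable X]setTI; exact: mt0.
- by rewrite -[X in measurable X]setTI; exact: mt'.
by rewrite IH// -(lebesgue_measure_translation (t ord0 ord0) mB).
Qed.

Lemma measurable_box n (A : 'I_n -> set (measurableTypeR R)) :
  (forall i, measurable (A i)) ->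
  measurable [set x : 'rV[R]_n | forall i, A i (x ord0 i)].
Proof.
move=> mA.
rewrite [X in measurable X](_ : _ = \big[setI/setT]_(i < n)
    ((fun x : 'rV[R]_n => x ord0 i : measurableTypeR R) @^-1` A i)).
  apply: bigsetI_measurable => i _; rewrite -[X in measurable X]setTI.
  exact: measurable_coord_rV.
rewrite -bigcap_seq; apply/seteqP; split => x /=.
  by move=> xA i _; exact: xA.
by move=> xA i; apply: (xA i) => /=; rewrite mem_index_enum.
Qed.

Lemma lebesgue_measure_rV_ball n (c : 'rV[R]_n) (r : R) : 0 <= r ->
  (lebesgue_measure_rV n [set x | (enorm (x - c) <= r)%R] <= ((2 * r) ^+ n)%:E)%E.
Proof.
move=> r0.
pose B (i : 'I_n) : set (measurableTypeR R) := `[c ord0 i - r, c ord0 i + r]%classic.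
have mB i : measurable (B i) by exact: measurable_itv.
apply: (@le_trans _ _ (lebesgue_measure_rV n [set x | forall i, B i (x ord0 i)])).
  apply: le_measure; rewrite ?inE.
  - have := continuous_measurable_rV (enormB_continuous (c := c)).
    move=> /(_ measurableT _ (measurable_itv `]-oo, r])); rewrite setTI.
    by congr (measurable _); apply/seteqP; split => x /=; rewrite in_itv.
  - exact: measurable_box.
  - move=> x /= xr i; rewrite /B /= in_itv /= -ler_distl.
    by apply: le_trans xr; have := le_coord_enorm (x - c) i; rewrite !mxE.
rewrite lebesgue_measure_rV_box//.
rewrite (eq_bigr (fun=> (2 * r)%:E)); last first.
  move=> i _; rewrite /B lebesgue_measure_itv/= lte_fin.
  case: ifPn => [_|].
    by rewrite -EFinB; congr EFin; ring.
  (* Here [r = 0] and the interval is a single point. *)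
  rewrite -leNgt => h; congr EFin; lra.
by rewrite prodEFin prodr_const card_ord.
Qed.

Definition cube n (N : R) : set 'rV[R]_n := [set x | forall i, `|x ord0 i| <= N].

Arguments cube : clear implicits.

Lemma cubeE n (N : R) : cube n N =
  [set x | forall i, (`[- N, N]%classic : set (measurableTypeR R)) (x ord0 i)].
Proof.
by apply/seteqP; split => x /= xN i; have := xN i; rewrite /= in_itv/= -ler_norml.
Qed.

Lemma measurable_cube n (N : R) : measurable (cube n N).
Proof.
by rewrite cubeE; exact: (@measurable_box n (fun=> _)) (fun=> measurable_itv _).
Qed.

Lemma cube_lty n (N : R) : (lebesgue_measure_rV n (cube n N) < +oo)%E.
Proof.
rewrite cubeE (@lebesgue_measure_rV_box R n (fun=> _)) => [|i]; last first.
  exact: measurable_itv.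
rewrite ltey_eq prode_fin_num// => i _.
by rewrite lebesgue_measure_itv/=; case: ifP.
Qed.

End lebesgue_rV.

Arguments cube : clear implicits.

(** * A bounded open set with Lipschitz boundary has null boundary *)

Section boundary_null.
Context {R : realType} {n : nat}.
Local Notation mu := (@lebesgue_measure_rV R n).
Implicit Types (G : set 'rV[R]_n) (e z : 'rV[R]_n).

Lemma enormZ (t : R) (x : 'rV[R]_n) : enorm (t *: x) = `|t| * enorm x.
Proof.
rewrite -sqrtr_sqr -sqrtrM ?sqr_ge0//; congr Num.sqrt.
by rewrite mulr_sumr; apply: eq_bigr => i _; rewrite mxE exprMn.
Qed.

(* The translates of [G] by [e / (k + 1)] are disjoint and stay in a bounded
   set, so infinitely many disjoint copies of [G] have finite total measure. *)
Lemma disjoint_translates_null G e (M : R) : measurable G ->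
  (forall x i, G x -> `|x ord0 i| <= M) ->
  (forall t x, G x -> G (x + t *: e) -> t = 0) ->
  mu G = 0%E.
Proof.
move=> mG Gb Gt.
pose F (k : nat) := (fun x => x + (k.+1%:R^-1 *: e)) @^-1` G.
have mF k : measurable (F k).
  rewrite -[X in measurable X]setTI.
  suff : measurable_fun setT (fun x : 'rV[R]_n => x + (k.+1%:R^-1 *: e)) by exact.
  apply/measurable_fun_coord_rVP => i; under eq_fun do rewrite mxE.
  by apply: measurable_funD; [exact: measurable_coord_rV|exact: measurable_cst].
have muF k : mu (F k) = mu G by exact: lebesgue_measure_rV_translation.
have tF : trivIset setT F.
  apply/trivIsetP => i j _ _ ij; apply/seteqP; split => // x [/= Fi Fj].
  have : (j.+1%:R^-1 - i.+1%:R^-1 : R) = 0.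
    by apply: (Gt _ _ Fi); rewrite -addrA -scalerDl addrCA subrr addr0.
  move/eqP; rewrite subr_eq0 => /eqP/invr_inj/eqP.
  by rewrite eqr_nat eqSS eq_sym (negbTE ij).
pose N := M + enorm e.
have FB k : F k `<=` cube R n N.
  move=> x /Gb xM i.
  have -> : x ord0 i = (x + k.+1%:R^-1 *: e) ord0 i + (- (k.+1%:R^-1 *: e)) ord0 i.
    by rewrite !mxE addrK.
  apply: le_trans (ler_normD _ _) _; rewrite lerD//.
  apply: le_trans (le_coord_enorm _ _) _; rewrite enormN enormZ.
  rewrite ger0_norm ?invr_ge0// ler_piMl ?enorm_ge0// invf_le1//.
  by rewrite ler1n.
have muB : (mu (cube R n N) < +oo)%E by exact: cube_lty.
have mcube := @measurable_cube R n N.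
have muGfin : mu G \is a fin_num.
  rewrite ge0_fin_numE// -(muF 0%N); apply: le_lt_trans muB.
  by apply: le_measure; rewrite ?inE//; exact: FB.
have H m : (m%:R * fine (mu G) <= fine (mu (cube R n N)))%R.
  rewrite -lee_fin EFinM !fineK//; last by rewrite ge0_fin_numE.
  apply: (@le_trans _ _ (mu (\big[setU/set0]_(k < m) F k))).
    rewrite measure_bigsetU//.
    rewrite (eq_bigr (fun=> mu G)) => [|i _]; last exact: muF.
    by rewrite -(fineK muGfin) sumEFin sumr_const card_ord -EFinM mulr_natl.
  apply: le_measure; rewrite ?inE//; first exact: bigsetU_measurable.
  by rewrite -bigcup_mkord => x [k _ Fk]; exact: (FB k).
rewrite -(fineK muGfin); congr EFin; apply/eqP; rewrite eq_le.
rewrite [X in _ && X]fine_ge0 ?measure_ge0// andbT leNgt; apply/negP => g0.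
have [b Hb] : exists b, forall m, m%:R * fine (mu G) <= b.
  by exists (fine (mu (cube R n N))); exact: H.
have b0 : 0 <= b by have := Hb 0%N; rewrite mulr0n mul0r.
have := Hb (Num.bound (b / fine (mu G))); rewrite leNgt => /negP; apply.
by rewrite -ltr_pdivrMr// archi_boundP// divr_ge0// ltW.
Qed.

Variable Omega : set 'rV[R]_n.
Hypotheses (oO : open Omega) (bO : bounded_set Omega)
  (lO : lipschitz_boundary Omega).

Let boundary := closure Omega `\` Omega.

Lemma bounded_closure_coord : exists M : R,
  forall x i, closure Omega x -> `|x ord0 i| <= M.
Proof.
have [M [Mr OM]] := bO; exists (M + 1) => x i cx.
have OM1 y : Omega y -> `|y ord0 i| <= M + 1.
  move=> Oy; have /OM/(_ _ Oy) : M < M + 1 by rewrite ltrDl.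
  apply: le_trans; rewrite /Num.norm/= mx_normrE.
  by apply: (le_bigmax _ (fun ij => `|y ij.1 ij.2|) (ord0, i)).
(* The bound on [Omega] passes to the closure: a violation is an open condition, so it would occur
   at a point of [Omega]. *)
rewrite leNgt; apply/negP => xM.
have := cx ((fun y : 'rV[R]_n => `|y ord0 i|) @^-1` [set t | M + 1 < t]).
case.
  apply: open_nbhs_nbhs; split => //; apply: open_comp; last exact: open_gt.
  move=> y _; apply: continuous_comp; last exact: norm_continuous.
  exact: coord_continuous.
by move=> y [/OM1 + /=]; rewrite leNgt => /negP.
Qed.

Lemma bounded_measure_lty : (mu Omega < +oo)%E.
Proof.
have [M hM] := bounded_closure_coord.
apply: le_lt_trans (cube_lty n M); apply: le_measure; rewrite ?inE.
- exact: open_measurable_rV.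
- exact: measurable_cube.
- by move=> x /(@subset_closure _ Omega) cx i; exact: hM.
Qed.

(** Near [z] the boundary lies on the graph of [g]: points strictly below belong to [Omega], and
    those strictly above have a neighbourhood that misses [Omega]. Two points of the graph on the
    same vertical line coincide, so [disjoint_translates_null] applies along [e]. *)
Lemma boundary_graph z : boundary z -> exists2 r : R, 0 < r &
  mu (boundary `&` [set x | enorm (x - z) < r]) = 0%E.
Proof.
move=> bz; have : (closure Omega `\` Omega°) z.
  by rewrite (_ : Omega° = Omega)//; exact/interior_id.
move=> /lO[r [e [g [r0 e1 [L gL] H]]]]; exists r => //.
have [M hM] := bounded_closure_coord.
have ee : edot e e = 1 by rewrite -enorm_sqr e1 expr1n.
pose P (x : 'rV[R]_n) : 'rV[R]_n := x - edot x e *: e.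
have edotD (x y : 'rV[R]_n) (t : R) : edot (x + t *: y) e = edot x e + t * edot y e.
  rewrite /edot mulr_sumr -big_split/=; apply: eq_bigr => i _.
  by rewrite !mxE; ring.
have PD x t : P (x + t *: e) = P x.
  by rewrite /P edotD ee mulr1 scalerDl opprD addrACA subrr addr0.
have oB : open [set x : 'rV[R]_n | enorm (x - z) < r].
  apply: (@open_comp _ _ (fun x : 'rV[R]_n => enorm (x - z)) [set t | t < r]).
    by move=> x _; exact: enormB_continuous.
  exact: open_lt.
have graph x : boundary x -> enorm (x - z) < r -> edot x e = g (P x).
  move=> [cx nOx] xr; apply/eqP; rewrite eq_le; apply/andP; split; last first.
    by rewrite leNgt; apply/negP => /(H _ xr).
  rewrite leNgt; apply/negP => gx.
  (* A continuous function such that [g (P x) < h y] puts [y] strictly above the graph, by the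
     Lipschitz bound. The absolute value of [L] is there because no sign of [L] is given. *)
  pose h y := (edot y e - `|L| * enorm (P y - P x)).
  have cP : continuous P.
    move=> y; apply: (@continuousB _ _ _ id (fun y => edot y e *: e)).
      by move=> A.
    apply: (@continuousZr_tmp _ _ _ (fun y : 'rV[R]_n => edot y e)).
    exact: edot_continuous.
  have ch : continuous h.
    move=> y; apply: (@continuousB _ _ _ (fun y => edot y e)
      (fun y => `|L| * enorm (P y - P x))); first exact: edot_continuous.
    apply: (@continuousM _ _ (cst `|L|)); first exact: cst_continuous.
    apply: continuous_comp; last exact: enorm_continuous.
    apply: (@continuousB _ _ _ P (cst (P x))); first exact: cP.
    exact: cst_continuous.
  have [|y [Oy [yr hy]]] := cx
    ([set y | enorm (y - z) < r] `&` h @^-1` [set t | g (P x) < t]).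
    apply: open_nbhs_nbhs; split.
      by apply: openI => //; apply: open_comp; [move=> y _; exact: ch|exact: open_gt].
    split => //=; rewrite /h subrr.
    by rewrite /enorm big1 ?sqrtr0 ?mulr0 ?subr0// => i _; rewrite mxE expr0n.
  have := (H _ yr).1 Oy; apply/negP; rewrite -leNgt.
  have := gL (P y) (P x); rewrite ler_distl => /andP[_ h1].
  move: hy; rewrite /= /h ltrBrDr => /ltW; apply: le_trans.
  apply: le_trans h1 _; rewrite lerD2l ler_wpM2r ?enorm_ge0//.
  exact: ler_norm.
apply: (@disjoint_translates_null _ e M).
- apply: measurableI; last exact: open_measurable_rV.
  apply: measurableD; last exact: open_measurable_rV.
  by apply: closed_measurable_rV; exact: closed_closure.
- by move=> x i [[cx _] _]; exact: hM.
- move=> t x [bx xr] [bxt xtr].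
  have := graph _ bxt xtr; rewrite PD -(graph _ bx xr) edotD ee mulr1 => ?; lra.
Qed.

(** The boundary is closed and bounded, hence covered by finitely many of the balls of
    [boundary_graph]. *)
Lemma boundary_null : mu boundary = 0%E.
Proof.
have clb : closed boundary.
  by apply: closedI; [exact: closed_closure|exact: open_closedC].
have cb : compact boundary.
  apply: bounded_closed_compact => //.
  have [M hM] := bounded_closure_coord.
  exists `|M|; split; first exact: num_real.
  move=> N MN x [cx _]; rewrite /Num.norm/= mx_normrE.
  apply: bigmax_le => [|[i j] _ /=]; first exact: le_trans (ltW MN).
  by rewrite (ord1 i) (le_trans (hM x j cx))// (le_trans (ler_norm M))// ltW.
(* Choice asks for a radius at every point; off the boundary it is arbitrarily 1. *)
have /choice[r hr] : forall z, exists r : R, 0 < r /\ (boundary z ->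
    mu (boundary `&` [set x | enorm (x - z) < r]) = 0%E).
  move=> z; have [/boundary_graph[r r0 H]|nb] := pselect (boundary z).
    by exists r.
  by exists 1.
pose f z := [set x | enorm (x - z) < r z].
have of_ z : open (f z).
  apply: (@open_comp _ _ (fun x : 'rV[R]_n => enorm (x - z)) [set t | t < r z]).
    by move=> x _; exact: enormB_continuous.
  exact: open_lt.
have : cover_compact boundary by rewrite -compact_cover.
move=> /(_ _ boundary f (fun z _ => of_ z))[|D' D'b bD'].
  move=> z bz; exists z => //=.
  rewrite /f /= subrr /enorm big1 ?sqrtr0 ?(hr z).1// => i _.
  by rewrite mxE expr0n.
have mb : measurable boundary by exact: closed_measurable_rV.
apply: measure_negligible => //.
have bD : boundary `<=` \big[setU/set0]_(z <- finmap.enum_fset D') (boundary `&` f z).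
  move=> x bx; have [z zD' fz] := bD' x bx.
  by rewrite -bigcup_seq; exists z.
apply: (negligibleS bD).
rewrite big_seq; elim/big_ind : _ => [|A B|z zD'].
- exact: negligible_set0.
- exact: negligibleU.
- apply/negligibleP; last by apply: (hr z).2; have := D'b z zD'; rewrite inE.
  by apply: measurableI => //; exact: open_measurable_rV.
Qed.

End boundary_null.

(** * The Gamma function and the kernel *)

Section dyadic_integral.
Context {d} {T : measurableType d} {R : realType}.
Variable mu : {measure set T -> \bar R}.

Lemma nneseries_geometric_le (c p : R) : 0 <= c -> 0 <= p < 1 ->
  (\sum_(k <oo) (c * p ^+ k)%:E <= (c / (1 - p))%:E)%E.
Proof.
move=> c0 /andP[p0 p1]; apply: lime_le.
  by apply: is_cvg_nneseries => k _ _; rewrite lee_fin mulr_ge0// exprn_ge0.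
apply: nearW => n; rewrite /= sumEFin lee_fin -mulr_sumr ler_wpM2l//.
rewrite -[leRHS]mul1r ler_pdivlMr ?subr_gt0// big_mkord mulrC -opprB mulNr.
rewrite -subrX1 opprB.
by rewrite gerBl exprn_ge0.
Qed.

Lemma dyadic_small (t : R) : 0 < t <= 1 ->
  exists k, 2 ^- k.+1 < t <= 2 ^- k.
Proof.
move=> /andP[t0 t1].
have ex : exists k, 2 ^- k.+1 < t.
  exists (Num.bound t^-1); rewrite invf_plt ?posrE ?exprn_gt0//.
  apply: lt_le_trans (archi_boundP _) _; first by rewrite invr_ge0 ltW.
  by rewrite -natrX ler_nat ltnW// ltnW// ltn_expl.
case: (ex_minnP ex) => k tk min; exists k; rewrite tk/=.
case: k tk min => [|k] _ min; first by rewrite expr0 invr1.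
by rewrite leNgt; apply/negP => /min; rewrite ltnn.
Qed.

Lemma dyadic_large (t : R) : 1 < t ->
  exists k, 2 ^+ k < t <= 2 ^+ k.+1.
Proof.
move=> t1.
have ex : exists k, t <= 2 ^+ k.+1.
  exists (Num.bound t); apply/ltW.
  apply: lt_le_trans (archi_boundP _) _; first by rewrite ltW// (lt_trans ltr01).
  by rewrite -natrX ler_nat ltnW// ltnW// ltn_expl.
case: (ex_minnP ex) => k tk min; exists k; rewrite tk andbT.
case: k tk min => [|k] _ min; first by rewrite expr0.
by rewrite ltNge; apply/negP => /min; rewrite ltnn.
Qed.

(* Sums over the shells [2^k < g <= 2^(k+1)], whose measure is at most
   [M 2^(m (k+1))]; [p < 1] is the ratio of the resulting geometric series. *)
Lemma dyadic_integral_le (M A p : R) (m : nat) (g F : T -> R) :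
  0 <= M -> 0 <= A -> 0 <= p < 1 ->
  measurable_fun setT g -> measurable_fun setT F ->
  (forall x, 0 <= g x) -> (forall x, 0 <= F x) ->
  (forall r, 0 <= r -> (mu [set x | (g x <= r)%R] <= (M * r ^+ m)%:E)%E) ->
  (forall x, g x = 0 -> F x = 0) ->
  (forall k x, 2 ^- k.+1 < g x <= 2 ^- k -> F x <= A * 2 ^+ (m * k) * p ^+ k) ->
  (forall k x, 2 ^+ k < g x <= 2 ^+ k.+1 -> F x <= A * 2 ^- (m * k) * p ^+ k) ->
  (\int[mu]_x (F x)%:E <= (A * M * (1 + 2 ^+ m) / (1 - p))%:E)%E.
Proof.
move=> M0 A0 p01 mg mF g0 F0 gM Fz Fs Fl; have /andP[p0 p1] := p01.
pose c k : R := A * 2 ^+ (m * k) * p ^+ k.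
pose e k : R := A * 2 ^- (m * k) * p ^+ k.
have c0 k : 0 <= c k by rewrite !mulr_ge0// exprn_ge0.
have e0 k : 0 <= e k by rewrite !mulr_ge0// ?invr_ge0 exprn_ge0.
pose U (r : R) := [set x | g x <= r].
have mU r : measurable (U r).
  have := mg measurableT _ (measurable_itv `]-oo, r]); rewrite setTI.
  by congr (measurable _); apply/seteqP; split => x /=; rewrite in_itv.
(* Shells are enlarged to balls, whose measure is what [gM] controls; [h k] joins the [k]-th small
   ball and the [k]-th large one. *)
pose h k x : \bar R := ((c k * \1_(U (2 ^- k)) x)%:E +
                        (e k * \1_(U (2 ^+ k.+1)) x)%:E)%E.
have mh k : measurable_fun setT (h k).
  by apply: emeasurable_funD; apply/measurable_EFinP; apply: measurable_funM.
have h0 k x : (0 <= h k x)%E.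
  by rewrite adde_ge0// lee_fin mulr_ge0.
have Fh x : ((F x)%:E <= \sum_(k <oo) h k x)%E.
  have H k : ((F x)%:E <= h k x -> (F x)%:E <= \sum_(k <oo) h k x)%E.
    move=> /le_trans; apply.
    apply: le_trans (@nneseries_lim_ge _ _ xpredT 0%N k.+1 _); last by [].
    by rewrite big_nat_recr//= leeDr// sume_ge0.
  have [gx0|gxn0] := eqVneq (g x) 0.
    by rewrite Fz// nneseries_ge0.
  have gx : 0 < g x by rewrite lt0r gxn0 g0.
  have [g1|g1] := leP (g x) 1.
    have [|k /[dup] kg /andP[_ gk]] := @dyadic_small (g x); first by rewrite gx.
    apply: (H k); apply: (@le_trans _ _ (c k * \1_(U (2 ^- k)) x)%:E).
      by rewrite lee_fin indicE mem_set// mulr1; exact: Fs.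
    by rewrite leeDl// lee_fin mulr_ge0.
  have [k /[dup] kg /andP[_ gk]] := @dyadic_large (g x) g1.
  apply: (H k); apply: (@le_trans _ _ (e k * \1_(U (2 ^+ k.+1)) x)%:E).
    by rewrite lee_fin indicE mem_set// mulr1; exact: Fl.
  by rewrite leeDr// lee_fin mulr_ge0.
apply: (@le_trans _ _ (\int[mu]_x (\sum_(k <oo) h k x))%E).
  apply: ge0_le_integral => //.
  - by move=> x _; rewrite lee_fin.
  - exact/measurable_EFinP.
  - exact: (@ge0_emeasurable_sum _ _ _ _ _ xpredT).
rewrite integral_nneseries//.
(* The ball of radius [2^-k] contributes at most [A M p^k]; the one of radius [2^(k+1)] has a bound
   [2^m] times larger. *)
apply: (@le_trans _ _ (\sum_(k <oo) (A * M * (1 + 2 ^+ m) * p ^+ k)%:E)%E).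
  apply: lee_nneseries => [k _ _|k _]; first exact: integral_ge0.
  rewrite ge0_integralD//; last 4 first.
  - by move=> x _; rewrite lee_fin mulr_ge0.
  - by apply/measurable_EFinP; apply: measurable_funM.
  - by move=> x _; rewrite lee_fin mulr_ge0.
  - by apply/measurable_EFinP; apply: measurable_funM.
  have aux (q r : R) : 0 <= q ->
      (\int[mu]_x (q * \1_(U r) x)%:E = q%:E * mu (U r))%E.
    move=> q0; under eq_integral do rewrite EFinM.
    rewrite ge0_integralZl_EFin//; last exact/measurable_EFinP.
    by rewrite integral_indic// setIT.
  rewrite !aux// mulrDr mulr1 mulrDl EFinD; apply: leeD.
    have U1 : (mu (U (2 ^- k)%R) <= (M * (2 ^- k) ^+ m)%:E)%E.
      by apply: gM; rewrite invr_ge0 exprn_ge0.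
    apply: (le_trans (lee_wpmul2l _ U1)); first by rewrite lee_fin.
    rewrite -EFinM lee_fin /c exprVn -exprM mulnC.
    have : 2 ^+ (m * k) != 0 :> R by rewrite expf_neq0.
    move: (2 ^+ _) (p ^+ _) => x y x0.
    by rewrite le_eqVlt; apply/orP; left; apply/eqP; field.
  have U2 : (mu (U (2 ^+ k.+1)%R) <= (M * (2 ^+ k.+1) ^+ m)%:E)%E.
    by apply: gM; rewrite exprn_ge0.
  apply: (le_trans (lee_wpmul2l _ U2)); first by rewrite lee_fin.
  rewrite -EFinM lee_fin /e -exprM mulSn exprD mulnC.
  have : 2 ^+ (m * k) != 0 :> R by rewrite expf_neq0.
  move: (2 ^+ (m * k)) (2 ^+ m) (p ^+ _) => x y z x0.
  by rewrite le_eqVlt; apply/orP; left; apply/eqP; field.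
apply: nneseries_geometric_le => //.
by rewrite !mulr_ge0// addr_ge0// exprn_ge0.
Qed.
End dyadic_integral.

(** * Finiteness and positivity of Gamma, and the normalizing constant *)

Section constants.
Context {R : realType}.

Lemma powR_expV2 (a : R) k : (2 ^- k) `^ a = (2 `^ (- a)) ^+ k.
Proof.
elim: k => [|k IH]; first by rewrite expr0 invr1 powR1 expr0.
rewrite exprS invfM powRM ?invr_ge0 ?exprn_ge0// IH exprS; congr (_ * _).
by rewrite -powR_inv1// -powRrM mulN1r.
Qed.

Lemma powR2N_itv (a : R) : 0 < a -> 0 <= 2 `^ (- a) < 1.
Proof.
move=> a0; rewrite powR_ge0/= powRN invf_lt1 ?powR_gt0//.
by rewrite -[ltLHS](powRr0 2) /powR gt_eqF// ltr_expR mul0r mulr_gt0// ln_gt0// ltr1n.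
Qed.

(** The dyadic estimate on the line, with [g] the absolute value. Near 0 the integrand is at most
    [t^z / t], and [t^z] decays geometrically over the shells; at infinity the exponential absorbs
    [t^(z+1)] and leaves [t^-2]. *)
Lemma Gamma_integrand_lty (z : R) : 0 < z ->
  (\int[lebesgue_measure]_(t in `]0%R, +oo[) (t `^ (z - 1) * expR (- t))%:E < +oo)%E.
Proof.
move=> z0.
have mf : measurable_fun setT (fun t : R => t `^ (z - 1) * expR (- t)).
  apply: measurable_funM; first exact: measurable_powR.
  by apply: measurableT_comp => //; exact: measurableT_comp.
pose F (t : R) := t `^ (z - 1) * expR (- t) * \1_(`]0, +oo[%classic : set R) t.
rewrite integral_mkcond.
(* The 2 pays for [t^-1 <= 2 * 2^k] on the small shells. The factorial comes from
   [t^(N+1) / (N+1)! <= exp t], where [z + 1 <= N + 1]. *)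
pose N := Num.bound z; pose K : R := 2 + (N.+1)`!%:R.
pose p : R := Num.max (2 `^ (- z)) 2^-1.
have /andP[z1 z2] := powR2N_itv z0.
have p0 : 0 <= p by rewrite le_max z1.
have p1 : p < 1 by rewrite gt_max z2 invf_lt1// ltr1n.
have zN : z + 1 <= N.+1%:R by rewrite -natr1 lerD2r ltW// archi_boundP// ltW.
apply: (@le_lt_trans _ _ (\int[lebesgue_measure]_t (F t)%:E)%E).
  rewrite le_eqVlt; apply/orP; left; apply/eqP; apply: eq_integral => t _.
  rewrite /F patchE indicE; by case: (t \in _); rewrite ?mulr1 ?mulr0.
apply: le_lt_trans (_ : (_ <= (K * 2 * (1 + 2 ^+ 1) / (1 - p))%:E)%E) _; last first.
  exact: ltry.
apply: (@dyadic_integral_le _ _ _ lebesgue_measure 2 K p 1 (@Num.norm _ R)) => //.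
- by rewrite addr_ge0.
- by rewrite p0.
- exact: measurable_funM.
- by move=> t; rewrite !mulr_ge0// ?powR_ge0// expR_ge0.
- move=> r r0.
  have -> : [set x : R | `|x| <= r] = `[-r, r]%classic.
    by apply/seteqP; split => x /=; rewrite in_itv /= ler_norml.
  suff : (lebesgue_measure (`[(- r)%R, r]%classic : set R) <= (2 * r ^+ 1)%:E)%E.
    by [].
  rewrite lebesgue_measure_itv/=; case: ifPn => _; rewrite ?EFinN ?lee_fin expr1; lra.
- by move=> t /normr0_eq0 ->; rewrite /F indicE memNset ?mulr0//= in_itv/= ltxx.
- move=> k t; have [t0|t0] := leP t 0.
    rewrite /F indicE memNset ?mulr0//=; last by rewrite in_itv/= andbT ltNge t0.
    by rewrite !mulr_ge0// ?exprn_ge0// addr_ge0.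
  rewrite gtr0_norm// => /andP[t1 t2].
  rewrite /F indicE mem_set ?mulr1/=; last by rewrite in_itv/= andbT.
  have -> : t `^ (z - 1) = t `^ z * t^-1.
    by rewrite powRB ?powRr1 ?(ltW t0)//; rewrite (gt_eqF t0) implybT.
  rewrite mul1n.
  have h1 : t `^ z <= p ^+ k.
    apply: (@le_trans _ _ ((2 ^- k) `^ z)).
      apply: ge0_ler_powR; rewrite ?nnegrE ?invr_ge0 ?exprn_ge0 ?(ltW z0)//.
      exact: ltW.
    by rewrite powR_expV2 lerXn2r ?nnegrE// le_max lexx.
  have h2 : t^-1 <= 2 * 2 ^+ k.
    rewrite -exprS -[leRHS]invrK lef_pV2 ?posrE ?invr_gt0 ?exprn_gt0//.
    exact: ltW.
  have h3 : expR (- t) <= 1 by rewrite -expR0 ler_expR oppr_le0 ltW.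
  have K2 : 2 <= K by rewrite lerDl.
  apply: (@le_trans _ _ (p ^+ k * (2 * 2 ^+ k) * 1)).
    have tV0 : 0 <= t^-1 by rewrite invr_ge0 ltW.
    by rewrite ler_pM ?mulr_ge0 ?powR_ge0 ?expR_ge0// ler_pM ?powR_ge0.
  rewrite mulr1 mulrC ler_wpM2r ?exprn_ge0// ler_wpM2r ?exprn_ge0//.
- move=> k t; have [t0|t0] := leP t 0.
    rewrite /F indicE memNset ?mulr0//=; last by rewrite in_itv/= andbT ltNge t0.
    by rewrite !mulr_ge0// ?invr_ge0 ?exprn_ge0// addr_ge0.
  rewrite gtr0_norm// => /andP[t1 t2].
  rewrite /F indicE mem_set ?mulr1/=; last by rewrite in_itv/= andbT.
  rewrite mul1n.
  have t_ge1 : 1 <= t by rewrite (le_trans _ (ltW t1))// exprn_ege1// ler1n.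
  have h1 : t `^ (z + 1) * expR (- t) <= (N.+1)`!%:R.
    apply: (@le_trans _ _ (t ^+ N.+1 * expR (- t))).
      rewrite ler_wpM2r ?expR_ge0// -powR_mulrn ?(ltW t0)//.
      exact: ler_powR.
    rewrite expRN ler_pdivrMr ?expR_gt0//.
    have := @expR_ge1Dxn _ _ N (ltW t0) => h.
    rewrite mulrC -ler_pdivrMr ?ltr0n ?fact_gt0//.
    by apply: le_trans h; rewrite lerDr.
  have -> : t `^ (z - 1) * expR (- t) = t `^ (z + 1) * expR (- t) * (t^-1 * t^-1).
    have -> : z - 1 = (z + 1) - 2%:R by ring.
    rewrite powRB ?powR_mulrn ?(ltW t0)//; last by rewrite (gt_eqF t0) implybT.
    by rewrite expr2 invfM; ring.
  have h2 : t^-1 <= 2 ^- k by rewrite lef_pV2 ?posrE ?exprn_gt0//; exact: ltW.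
  have h3 : t^-1 <= p ^+ k.
    apply: le_trans h2 _; rewrite -exprVn lerXn2r ?nnegrE ?invr_ge0//.
    by rewrite le_max lexx orbT.
  have tV0 : 0 <= t^-1 by rewrite invr_ge0 ltW.
  rewrite -[leRHS]mulrA ler_pM//.
  + by rewrite mulr_ge0 ?powR_ge0 ?expR_ge0.
  + by rewrite mulr_ge0.
  + by apply: le_trans h1 _; rewrite lerDr.
  + by rewrite ler_pM.
Qed.

(** [Gamma] is the real part of an extended integral, which would be 0 if that integral were
    infinite, hence the preceding lemma. A zero integral would make a positive integrand vanish
    almost everywhere on a half-line of infinite measure. *)
Lemma Gamma_gt0 (z : R) : 0 < z -> 0 < Gamma z.
Proof.
move=> z0; have ltoo := Gamma_integrand_lty z0.
have mf : measurable_fun (`]0, +oo[%classic : set R)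
    (fun t : R => (t `^ (z - 1) * expR (- t))%:E).
  apply/measurable_EFinP; apply: measurable_funTS; apply: measurable_funM.
    exact: measurable_powR.
  by apply: measurableT_comp => //; exact: measurableT_comp.
have ge0 (t : R) : (0 <= (t `^ (z - 1) * expR (- t))%:E)%E.
  by rewrite lee_fin mulr_ge0 ?powR_ge0 ?expR_ge0.
rewrite lt0r /Gamma Rintegral_ge0 ?andbT; last first.
  by move=> t _; rewrite -lee_fin; exact: ge0.
apply/negP => /eqP G0.
have : (\int[lebesgue_measure]_(t in `]0%R, +oo[)
    `|(t `^ (z - 1) * expR (- t))%:E| = 0)%E.
  under eq_integral do rewrite gee0_abs//.
  rewrite -[LHS]fineK ?ge0_fin_numE ?integral_ge0//.
  by move: G0; rewrite /Rintegral => ->.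
have [H _] := ae_eq_integral_abs lebesgue_measure (measurable_itv _) mf.
move=> /H[A [mA A0 sub]].
have : (lebesgue_measure (`]0%R, +oo[%classic : set R) <= lebesgue_measure A)%E.
  apply: le_measure; rewrite ?inE//.
  move=> t t0; apply: sub => /= /(_ t0) [].
  move: t0; rewrite /= in_itv/= andbT => t0.
  by apply/eqP; rewrite mulf_neq0 ?gt_eqF ?powR_gt0 ?expR_gt0.
by rewrite A0 lebesgue_measure_itv/= ltry.
Qed.

Lemma frac_const_gt0 n (s : R) : 0 < s < 1 -> 0 < frac_const n s.
Proof.
move=> /andP[s0 s1]; rewrite /frac_const divr_gt0 ?mulr_gt0 ?powR_gt0 ?pi_gt0//.
- by rewrite Gamma_gt0// divr_gt0// ltr_wpDr// mulr_gt0.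
- by rewrite Gamma_gt0// subr_gt0.
Qed.

End constants.

(** * Uniform integrability of the kernel against min(1, r^2) *)

Section kernel_bound.
Context {R : realType} {n : nat}.
Local Notation mu := (@lebesgue_measure_rV R n).
Implicit Types x y : 'rV[R]_n.

Lemma frac_kernel_ge0 (s : R) x y : 0 <= frac_kernel s x y.
Proof. by rewrite invr_ge0 powR_ge0. Qed.

Lemma frac_kernelC (s : R) x y : frac_kernel s x y = frac_kernel s y x.
Proof. by rewrite /frac_kernel enormB. Qed.

(** On shells around [x] the factor [r^-n] compensates the volume, leaving [r^(2-2s)] on the small
    ones and [r^(-2s)] on the large ones: two geometric ratios below 1, whose maximum is [p]. [K] is
    independent of [x] because the bound on the measure of a ball is independent of its centre. *)
Lemma kernel_integral_le (s c : R) : 0 < s < 1 -> 0 <= c ->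
  exists K : R, forall x (F : 'rV[R]_n -> R), measurable_fun setT F ->
    (forall y, 0 <= F y <=
      c * Num.min 1 (enorm (x - y) ^+ 2) * frac_kernel s x y) ->
    (\int[mu]_y (F y)%:E <= K%:E)%E.
Proof.
move=> /andP[s0 s1] c0.
have a0 : 0 < 2 * s by rewrite mulr_gt0.
have b0 : 0 < 2 - 2 * s by lra.
pose p : R := Num.max (2 `^ (- (2 * s))) (2 `^ (- (2 - 2 * s))).
have /andP[pa0 pa1] := powR2N_itv a0; have /andP[pb0 pb1] := powR2N_itv b0.
have p0 : 0 <= p by rewrite le_max pa0.
have p1 : p < 1 by rewrite gt_max pa1.
(* The factor [2^n] comes from [r^-n <= 2^n 2^(n k)] for [r] above [2^-(k+1)]. *)
pose A := c * 2 ^+ n.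
exists (A * 2 ^+ n * (1 + 2 ^+ n) / (1 - p)) => x F mF Fle.
apply: (@dyadic_integral_le _ _ _ mu (2 ^+ n) A p n (fun y => enorm (y - x))).
- by rewrite exprn_ge0.
- by rewrite mulr_ge0// exprn_ge0.
- by rewrite p0.
- by apply: continuous_measurable_rV; exact: enormB_continuous.
- exact: mF.
- by move=> y; exact: enorm_ge0.
- by move=> y; have /andP[] := Fle y.
- by move=> r r0; rewrite -exprMn; exact: lebesgue_measure_rV_ball.
- move=> y yx0; apply/eqP; rewrite eq_le; have /andP[-> +] := Fle y.
  rewrite enormB yx0 expr0n/= (_ : Num.min 1 0 = 0) ?mulr0 ?mul0r ?andbT//.
  by rewrite minEle ler10.
- move=> k y /andP[y1 y2]; have /andP[_ h] := Fle y; apply: le_trans h _.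
  rewrite /frac_kernel enormB; move: (enorm _) y1 y2 => r r1 r2.
  have r0 : 0 < r by apply: lt_trans r1; rewrite invr_gt0 exprn_gt0.
  have rn : r != 0 by rewrite gt_eqF.
  have E : r ^+ 2 * (r `^ (n%:R + 2 * s))^-1 = r `^ (2 - 2 * s) * r ^- n.
    rewrite powRD ?rn ?implybT// powRB ?rn ?implybT// !powR_mulrn ?(ltW r0)//.
    by rewrite invfM; ring.
  apply: (@le_trans _ _ (c * (r ^+ 2 * (r `^ (n%:R + 2 * s))^-1))).
    rewrite -mulrA ler_wpM2l// ler_wpM2r ?invr_ge0 ?powR_ge0//.
    by rewrite ge_min lexx orbT.
  rewrite E /A -!mulrA ler_wpM2l//.
  have h1 : r `^ (2 - 2 * s) <= p ^+ k.
    apply: (@le_trans _ _ ((2 ^- k) `^ (2 - 2 * s))).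
      apply: ge0_ler_powR; rewrite ?nnegrE ?invr_ge0 ?exprn_ge0 ?(ltW b0)//.
      exact: ltW.
    by rewrite powR_expV2 lerXn2r ?nnegrE// le_max lexx orbT.
  have h2 : r ^- n <= 2 ^+ n * 2 ^+ (n * k).
    rewrite -exprD -mulnS -[leRHS]invrK lef_pV2 ?posrE ?invr_gt0 ?exprn_gt0//.
    rewrite mulnC exprM -exprVn lerXn2r ?nnegrE ?invr_ge0 ?exprn_ge0 ?(ltW r0)//.
    exact: ltW.
  rewrite [leRHS]mulrA [leRHS]mulrC ler_pM// ?powR_ge0//.
  by rewrite invr_ge0 exprn_ge0// ltW.
- move=> k y /andP[y1 y2]; have /andP[_ h] := Fle y; apply: le_trans h _.
  rewrite /frac_kernel enormB; move: (enorm _) y1 y2 => r r1 r2.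
  have r0 : 0 < r by apply: lt_trans r1; rewrite exprn_gt0.
  have rn : r != 0 by rewrite gt_eqF.
  rewrite powRD ?rn ?implybT// powR_mulrn ?(ltW r0)// invfM.
  apply: (@le_trans _ _ (c * (r ^- n * (r `^ (2 * s))^-1))).
    rewrite ler_wpM2r ?mulr_ge0 ?invr_ge0 ?powR_ge0 ?exprn_ge0 ?(ltW r0)//.
    by rewrite -[leRHS]mulr1 ler_wpM2l// ge_min lexx.
  have h1 : (r `^ (2 * s))^-1 <= p ^+ k.
    rewrite -powRN; apply: (@le_trans _ _ ((2 ^- k) `^ (2 * s))).
      rewrite powRN -[2 ^- k]powR_inv1 ?exprn_ge0// -powRrM mulN1r powRN.
      rewrite lef_pV2 ?posrE ?powR_gt0 ?exprn_gt0//.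
      apply: ge0_ler_powR; rewrite ?nnegrE ?exprn_ge0 ?(ltW a0) ?(ltW r0)//.
      exact: ltW.
    by rewrite powR_expV2 lerXn2r ?nnegrE// le_max lexx.
  have h2 : r ^- n <= 2 ^- (n * k).
    rewrite lef_pV2 ?posrE ?exprn_gt0// mulnC exprM lerXn2r ?nnegrE ?exprn_ge0//;
      exact: ltW.
  rewrite -mulrA ler_pM ?mulr_ge0 ?invr_ge0 ?powR_ge0 ?exprn_ge0 ?(ltW r0)//.
    by rewrite ler_peMr// exprn_ege1// ler1n.
  by rewrite ler_pM// ?invr_ge0 ?powR_ge0// ?exprn_ge0// ?(ltW r0).
Qed.

End kernel_bound.

(** * The energy as a pull-back *)

Section product_measure_facts.
Context {d} {T : measurableType d} {R : realType}.
Variable mu : {sigma_finite_measure set T -> \bar R}.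
Local Open Scope ereal_scope.

Lemma ae_prod_fst (P : T -> Prop) : {ae mu, forall x, P x} ->
  {ae mu \x mu, forall z, P z.1}.
Proof.
move=> [N [mN N0 PN]]; exists (N `*` setT); split.
- exact: measurableX.
- transitivity (mu N * mu setT); first exact: product_measure1E.
  by rewrite [mu N]N0 mul0e.
- by move=> z /= nP; split => //; exact: PN.
Qed.

Lemma ae_prod_snd (P : T -> Prop) : {ae mu, forall x, P x} ->
  {ae mu \x mu, forall z, P z.2}.
Proof.
move=> [N [mN N0 PN]]; exists (setT `*` N); split.
- exact: measurableX.
- transitivity (mu setT * mu N); first exact: product_measure1E.
  by rewrite [mu N]N0 mule0.
- by move=> z /= nP; split => //; exact: PN.
Qed.

Lemma integral_prod_swap (f : T * T -> \bar R) : measurable_fun setT f ->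
  (forall z, 0 <= f z) ->
  \int[mu \x mu]_z f (z.2, z.1) = \int[mu \x mu]_z f z.
Proof.
move=> mf f0; rewrite (fubini_tonelli1 f)//.
rewrite (fubini_tonelli1 (fun z => f (z.2, z.1)))//.
  by rewrite /fubini_F /= (fubini_tonelli f).
by apply: measurableT_comp => //; exact: measurable_swap.
Qed.

(** Tonelli measurability is for non-negative integrands, so it is applied to the positive and
    negative parts. *)
Lemma measurable_integral_section (h : T * T -> \bar R) :
  measurable_fun setT h -> measurable_fun setT (fun x => \int[mu]_y h (x, y)).
Proof.
move=> mh.
apply: (eq_measurable_fun (fun x => \int[mu]_y h^\+ (x, y) -
                                    \int[mu]_y h^\- (x, y))).
  move=> x _; rewrite [RHS]integralE; congr (_ - _).
    by apply: eq_integral => y _; rewrite !funeposE.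
  by apply: eq_integral => y _; rewrite !funenegE.
apply: (@emeasurable_funB _ _ _ setT (fun x => \int[mu]_y h^\+ (x, y))
  (fun x => \int[mu]_y h^\- (x, y))).
  apply: (measurable_fun_fubini_tonelli_F (h^\+)) => //.
  exact: measurable_funepos.
apply: (measurable_fun_fubini_tonelli_F (h^\-)) => //.
exact: measurable_funeneg.
Qed.

(** Fubini in the shape used by [energy], whose inner integrals are real numbers; the indicators
    move the two sets into the integrand. *)
Lemma Rintegral_prodE (A B : set T) (g : T * T -> R) :
  measurable A -> measurable B ->
  (mu \x mu).-integrable setT
    (fun z => (\1_A z.1 * \1_B z.2 * g z)%:E) ->
  (\int[mu]_(x in A) (\int[mu]_(y in B) g (x, y)) =
   \int[mu \x mu]_z (\1_A z.1 * \1_B z.2 * g z))%R.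
Proof.
move=> mA mB ig; rewrite Rintegral_mkcond.
have E x : ((fun x => \int[mu]_(y in B) g (x, y)) \_ A)%R x =
    (\int[mu]_y (\1_A x * \1_B y * g (x, y)))%R.
  rewrite patchE; case: ifPn => xA.
    rewrite Rintegral_mkcond; apply: eq_Rintegral => y _.
    rewrite patchE !indicE xA; case: ifPn => yB; rewrite ?mul1r ?mul0r//.
  rewrite /Rintegral integral0_eq// => y _.
  by rewrite indicE (negbTE xA) !mul0r.
rewrite (eq_Rintegral _ (fun x _ => E x)) /Rintegral; congr fine.
rewrite -(integral12_prod_meas1 ig); apply: ae_eq_integral => //.
- apply/measurable_EFinP; apply: measurableT_comp; first exact: fine_measurable.
  have := measurable_int _ ig => mg.
  exact: (measurable_integral_section mg).
- exact: (measurable_integral_section (measurable_int _ ig)).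
(* The inner integral is finite for almost every [x], and there [fine] loses nothing. *)
- have h := ae_integrable1 ig; apply: (filterS _ h) => x ix _.
  by rewrite /= fineK//; exact: (integrable_fin_num measurableT ix).
Qed.

End product_measure_facts.

(** The identity [x^-1 = x |x|^-2] holds at 0 too, where both sides are 0. *)
Lemma measurable_invr (R : realType) : measurable_fun setT (@GRing.inv R).
Proof.
rewrite (_ : @GRing.inv R = fun x => x * `|x| `^ (- 2%:R)).
  apply: measurable_funM => //.
  exact: (measurableT_comp (@measurable_powR R (- 2%:R)) (@normr_measurable R _)).
apply/funext => x; have [->|x0] := eqVneq x 0; first by rewrite invr0 mul0r.
by rewrite powR_invn// real_normK ?num_real// expr2 invfM mulrA divff// mul1r.
Qed.

(** * Square-root weights: increments and the Robin term as L^2 functions *)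

Section robin_energy_form.
Context {R : realType} {n : nat}.
Variables (s : R) (Omega : set 'rV[R]_n) (beta : 'rV[R]_n -> R).
Hypotheses (s01 : 0 < s < 1) (oO : open Omega).
Local Notation mu := (@lebesgue_measure_rV R n).
Local Notation C := (frac_const n s).
Local Notation Oc := (~` Omega).
Hypothesis mbeta : measurable_fun Oc beta.
Implicit Types (u v w : 'rV[R]_n -> R).

Let C0 : 0 < C. Proof. exact: frac_const_gt0. Qed.
Let mO : measurable Omega. Proof. exact: open_measurable_rV. Qed.
Let mOc : measurable Oc. Proof. exact: measurableC. Qed.

Lemma measurable_frac_kernel :
  measurable_fun setT (fun z : 'rV[R]_n * 'rV[R]_n => frac_kernel s z.1 z.2).
Proof.
rewrite (_ : (fun z => _) = (fun z : 'rV[R]_n * 'rV[R]_n =>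
    enorm (z.1 - z.2) `^ (- (n%:R + 2 * s)))); last first.
  by apply/funext => z; rewrite powRN.
apply: (measurableT_comp (@measurable_powR R _)).
apply: (measurableT_comp (@measurable_enorm R n)).
apply/measurable_fun_coord_rVP => i; under eq_fun do rewrite !mxE.
apply: measurable_funB.
  exact: (measurableT_comp (measurable_coord_rV i) measurable_fst).
exact: (measurableT_comp (measurable_coord_rV i) measurable_snd).
Qed.

Definition jump_kernel (z : 'rV[R]_n * 'rV[R]_n) : R :=
  (C / 2 * (\1_Omega z.1 * \1_Omega z.2) + C * (\1_Omega z.1 * \1_Oc z.2)) *
  frac_kernel s z.1 z.2.

(* On the part [Omega x (~` Omega)] only one of the two orders of the arguments
   is kept, so that [E(u, v)] is the inner product of [jump u] and [jump v]. *)
Definition jump u (z : 'rV[R]_n * 'rV[R]_n) : R :=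
  (u z.1 - u z.2) * Num.sqrt (jump_kernel z).

(** The absolute value is that of [Wnorm_sqr]. Cutting [beta] off outside the complement makes this
    a function on the whole space, although [beta] is measurable on the complement only. *)
Definition killing u (x : 'rV[R]_n) : R := u x * Num.sqrt `|(beta \_ Oc) x|.

Lemma jump_kernel_ge0 z : 0 <= jump_kernel z.
Proof.
have C2 : 0 <= C / 2 by rewrite divr_ge0// ltW.
apply: mulr_ge0; last exact: frac_kernel_ge0.
by apply: addr_ge0; (apply: mulr_ge0; first by rewrite // ltW); apply: mulr_ge0;
  rewrite indicE.
Qed.

Lemma measurable_indic_fst (A : set 'rV[R]_n) : measurable A ->
  measurable_fun setT (fun z : 'rV[R]_n * 'rV[R]_n => \1_A z.1 : R).
Proof.
move=> mA; apply: (measurableT_comp _ measurable_fst); exact: measurable_indic.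
Qed.

Lemma measurable_indic_snd (A : set 'rV[R]_n) : measurable A ->
  measurable_fun setT (fun z : 'rV[R]_n * 'rV[R]_n => \1_A z.2 : R).
Proof.
move=> mA; apply: (measurableT_comp _ measurable_snd); exact: measurable_indic.
Qed.

Lemma measurable_diff u : measurable_fun setT u ->
  measurable_fun setT (fun z : 'rV[R]_n * 'rV[R]_n => u z.1 - u z.2).
Proof.
move=> mu_; apply: measurable_funB.
  exact: (measurableT_comp mu_ measurable_fst).
exact: (measurableT_comp mu_ measurable_snd).
Qed.

Lemma measurable_jump_kernel : measurable_fun setT jump_kernel.
Proof.
apply: measurable_funM; last exact: measurable_frac_kernel.
have mf := measurable_indic_fst mO; have ms := measurable_indic_snd mO.
have mc := measurable_indic_snd mOc.
by apply: measurable_funD; (apply: measurable_funM; first exact: measurable_cst);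
  exact: measurable_funM.
Qed.

Lemma measurable_sqrt : measurable_fun setT (@Num.sqrt R).
Proof. by apply: continuous_measurable_fun; exact: sqrt_continuous. Qed.

Lemma measurable_jump u : measurable_fun setT u -> measurable_fun setT (jump u).
Proof.
move=> mu_; apply: measurable_funM; first exact: measurable_diff.
exact: (measurableT_comp measurable_sqrt measurable_jump_kernel).
Qed.

Lemma measurable_killing u : measurable_fun setT u ->
  measurable_fun setT (killing u).
Proof.
move=> mu_; apply: measurable_funM => //; apply: (measurableT_comp measurable_sqrt).
have mb : measurable_fun setT (beta \_ Oc) by apply/(measurable_restrictT _ mOc).
exact: (measurableT_comp (@normr_measurable R setT) mb).
Qed.

Lemma jump_sqr u z : jump u z ^+ 2 = (u z.1 - u z.2) ^+ 2 * jump_kernel z.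
Proof. by rewrite exprMn sqr_sqrtr// jump_kernel_ge0. Qed.

Lemma jumpM u v z :
  jump u z * jump v z = (u z.1 - u z.2) * (v z.1 - v z.2) * jump_kernel z.
Proof.
by rewrite /jump mulrACA -expr2 sqr_sqrtr// jump_kernel_ge0.
Qed.

Lemma killingM u v x :
  killing u x * killing v x = u x * v x * `|(beta \_ Oc) x|.
Proof.
by rewrite /killing mulrACA -expr2 sqr_sqrtr.
Qed.

Let region : set ('rV[R]_n * 'rV[R]_n) := ~` (Oc `*` Oc).
Let mregion : measurable region.
Proof. by apply: measurableC; exact: measurableX. Qed.

Lemma indic_compl (x : 'rV[R]_n) : \1_Oc x = 1 - \1_Omega x :> R.
Proof.
by rewrite !indicE in_setC; case: (x \in Omega); rewrite ?subrr ?subr0.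
Qed.

(** The seminorm of [W_space] counts pairs in both orders, [jump] only those whose first point is in
    [Omega]. The square of [jump u] is at most [C] times the symmetric integrand; the converse bound
    adds the swapped square, whose integral is the same. *)
Lemma jump_lty u : measurable_fun setT u ->
  (\int[mu \x mu]_(z in region)
     (`|u z.1 - u z.2| ^+ 2 * frac_kernel s z.1 z.2)%:E < +oo)%E <->
  (\int[mu \x mu]_z (`|jump u z| ^+ 2)%:E < +oo)%E.
Proof.
have aux (a b : bool) : 1 - (1 - a%:R) * (1 - b%:R) <=
    a%:R * b%:R + 2 * (a%:R * (1 - b%:R)) + 2^-1 * (b%:R * a%:R) +
    b%:R * (1 - a%:R) :> R.
  by case: a; case: b => /=; lra.
move=> mu_; pose D z := (u z.1 - u z.2) ^+ 2 * frac_kernel s z.1 z.2.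
have mD : measurable_fun setT D.
  apply: measurable_funM; last exact: measurable_frac_kernel.
  by apply: measurable_funX; exact: measurable_diff.
have D0 z : 0 <= D z by rewrite mulr_ge0 ?sqr_ge0 ?frac_kernel_ge0.
pose J z := (jump u z) ^+ 2.
have mJ : measurable_fun setT (EFin \o J).
  by apply/measurable_EFinP; apply: measurable_funX; exact: measurable_jump.
have J0 z : (0 <= (EFin \o J) z)%E by rewrite lee_fin sqr_ge0.
have -> : (\int[mu \x mu]_z (`|jump u z| ^+ 2)%:E = \int[mu \x mu]_z (J z)%:E)%E.
  by apply: eq_integral => z _; rewrite real_normK ?num_real.
have -> : (\int[mu \x mu]_(z in region)
     (`|u z.1 - u z.2| ^+ 2 * frac_kernel s z.1 z.2)%:E =
     \int[mu \x mu]_z (D z * \1_region z)%:E)%E.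
  rewrite integral_mkcond; apply: eq_integral => z _.
  rewrite patchE indicE; case: ifPn => zr; rewrite ?zr ?(negbTE zr) ?mulr1 ?mulr0//.
  by rewrite /D real_normK ?num_real.
have regE z : \1_region z = 1 - \1_Oc z.1 * \1_Oc z.2 :> R.
  rewrite !indicE /region !in_setC in_setX !in_setC.
  by case: (z.1 \in Omega); case: (z.2 \in Omega); rewrite /= ?mulr1 ?mulr0; ring.
have mDr : measurable_fun setT (fun z => (D z * \1_region z)%:E).
  by apply/measurable_EFinP; apply: measurable_funM.
have Dr0 z : (0 <= (D z * \1_region z)%:E)%E by rewrite lee_fin mulr_ge0.
have jE z : J z = (C / 2 * (\1_Omega z.1 * \1_Omega z.2) +
    C * (\1_Omega z.1 * \1_Oc z.2)) * D z.
  by rewrite /J jump_sqr /jump_kernel /D; ring.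
split=> fin.
  apply: (@le_lt_trans _ _ (\int[mu \x mu]_z (C%:E * (D z * \1_region z)%:E))%E).
    apply: ge0_le_integral => //.
      by move=> z _; exact: J0.
      exact: (measurable_funeM C%:E mDr).
    move=> z _; rewrite -EFinM lee_fin jE regE !indic_compl.
    rewrite [leRHS](_ : _ = C * (1 - (1 - \1_Omega z.1) * (1 - \1_Omega z.2)) *
      D z); last by ring.
    rewrite ler_wpM2r// !indicE.
    by have := C0; case: (z.1 \in Omega); case: (z.2 \in Omega) => /= ?; lra.
  by rewrite ge0_integralZl_EFin ?(ltW C0)// lte_mul_pinfty// lee_fin ltW.
(* The swapped term serves the pairs whose first point is outside [Omega], where [J z] vanishes. *)
have pw z : D z * \1_region z <= 2 / C * J z + C^-1 * J (z.2, z.1).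
  have Ds : D (z.2, z.1) = D z by rewrite /D /= frac_kernelC; ring.
  rewrite !jE Ds /= !indic_compl regE !indic_compl.
  have Cn : C != 0 by rewrite gt_eqF.
  rewrite [leRHS](_ : _ = (\1_Omega z.1 * \1_Omega z.2 +
    2 * (\1_Omega z.1 * (1 - \1_Omega z.2)) + 2^-1 * (\1_Omega z.2 * \1_Omega z.1) +
    \1_Omega z.2 * (1 - \1_Omega z.1)) * D z); last by field.
  rewrite [leLHS]mulrC; apply: ler_wpM2r; first exact: D0.
  by rewrite !indicE; exact: aux.
have mJs : measurable_fun setT (fun z : 'rV[R]_n * 'rV[R]_n => (J (z.2, z.1))%:E).
  exact: (measurableT_comp mJ (@measurable_swap _ _ _ _)).
apply: (@le_lt_trans _ _ (\int[mu \x mu]_z ((2 / C)%:E * (J z)%:E +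
   (C^-1)%:E * (J (z.2, z.1))%:E))%E).
  apply: ge0_le_integral.
  - exact: measurableT.
  - by move=> z _; exact: Dr0.
  - exact: mDr.
  - exact: (emeasurable_funD (measurable_funeM (2 / C)%:E mJ)
      (measurable_funeM (C^-1)%:E mJs)).
  - by move=> z _; rewrite -!EFinM -EFinD lee_fin; exact: pw.
rewrite ge0_integralD; first last.
- exact: (measurable_funeM (C^-1)%:E mJs).
- by move=> z _; apply: mule_ge0; [rewrite lee_fin invr_ge0 ltW|exact: J0].
- exact: (measurable_funeM (2 / C)%:E mJ).
- by move=> z _; apply: mule_ge0; [rewrite lee_fin divr_ge0 ?(ltW C0)|exact: J0].
- exact: measurableT.
have E1 : (\int[mu \x mu]_z ((2 / C)%:E * (J z)%:E) =
    (2 / C)%:E * \int[mu \x mu]_z (J z)%:E)%E.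
  apply: ge0_integralZl_EFin; [exact: measurableT| |exact: mJ|].
    by move=> z _; exact: J0.
  by rewrite divr_ge0 ?(ltW C0).
have E2 : (\int[mu \x mu]_z ((C^-1)%:E * (J (z.2, z.1))%:E) =
    (C^-1)%:E * \int[mu \x mu]_z (J (z.2, z.1))%:E)%E.
  apply: ge0_integralZl_EFin; [exact: measurableT| |exact: mJs|].
    by move=> z _; exact: J0.
  by rewrite invr_ge0 ltW.
apply: lte_add_pinfty.
  rewrite E1.
  apply: lte_mul_pinfty => //.
  by rewrite lee_fin divr_ge0 ?(ltW C0).
rewrite E2.
have E3 := integral_prod_swap mu mJ J0.
rewrite [X in (_ * X)%E]E3.
apply: lte_mul_pinfty; last exact: fin.
  by rewrite lee_fin invr_ge0 ltW.
by [].
Qed.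

End robin_energy_form.

(** * The energy as a sum of two L^2 inner products *)

Section robin_energy_pullback.
Context {R : realType} {n : nat}.
Variables (s : R) (Omega : set 'rV[R]_n) (beta : 'rV[R]_n -> R).
Hypotheses (s01 : 0 < s < 1) (oO : open Omega).
Local Notation mu := (@lebesgue_measure_rV R n).
Local Notation C := (frac_const n s).
Local Notation Oc := (~` Omega).
Hypothesis mbeta : measurable_fun Oc beta.
Hypothesis beta0 : {ae mu, forall x, Oc x -> 0 <= beta x}.
Implicit Types (u v w : 'rV[R]_n -> R).
Local Notation jump := (jump s Omega).
Local Notation killing := (killing Omega beta).

Let C0 : 0 < C. Proof. exact: frac_const_gt0. Qed.
Let mO : measurable Omega. Proof. exact: open_measurable_rV. Qed.
Let mOc : measurable Oc. Proof. exact: measurableC. Qed.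

(** The three terms of the norm are read as three L^2 conditions on expressions linear in [u], from
    which the structure of [W_space] is inherited. *)
Lemma W_spaceP u : W_space s Omega beta u <->
  [/\ measurable_fun setT u, L2 mu Omega u,
      L2 (mu \x mu)%E setT (jump u) & L2 mu setT (killing u)].
Proof.
rewrite /W_space /=; split=> [[mu_]|[mu_ [mu1 u1] [mj j1] [mk k1]]].
  have mj := measurable_jump s oO mu_.
  have mk := measurable_killing oO mbeta mu_.
  have muO : measurable_fun Omega u by exact: measurable_funTS.
  rewrite /Wnorm_sqr; set A := (\int[mu]_(x in Omega) _)%E.
  set B := (\int[mu]_(x in Oc) _)%E; set D := (\int[_]_(z in _) _)%E.
  have A0 : (0 <= A)%E by apply: integral_ge0 => x _; rewrite lee_fin sqr_ge0.
  have B0 : (0 <= B)%E.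
    by apply: integral_ge0 => x _; rewrite lee_fin mulr_ge0 ?sqr_ge0.
  have D0 : (0 <= D)%E.
    by apply: integral_ge0 => z _; rewrite lee_fin mulr_ge0 ?sqr_ge0 ?frac_kernel_ge0.
  move=> fin.
  have fA : (A < +oo)%E.
    by apply: le_lt_trans fin; rewrite -addeA leeDl// adde_ge0.
  have fB : (B < +oo)%E.
    by apply: le_lt_trans fin; rewrite addeAC leeDr// adde_ge0.
  have fD : (D < +oo)%E by apply: le_lt_trans fin; rewrite leeDr// adde_ge0.
  split => //; split => //.
    exact: (jump_lty s01 oO mu_).1 fD.
  apply: le_lt_trans fB; rewrite le_eqVlt; apply/orP; left; apply/eqP.
  rewrite /B [RHS]integral_mkcond; apply: eq_integral => x _.
  rewrite -normrX expr2 killingM normrM normr_id !patchE.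
  by case: ifPn => _; rewrite ?normr0 ?mulr0// -expr2 normrX.
split => //; rewrite /Wnorm_sqr.
have jD := (jump_lty s01 oO mu_).2 j1.
apply: lte_add_pinfty; last exact: jD.
apply: lte_add_pinfty; first exact: u1.
apply: le_lt_trans k1; rewrite le_eqVlt; apply/orP; left; apply/eqP.
rewrite [LHS]integral_mkcond; apply: eq_integral => x _.
rewrite -normrX expr2 killingM normrM normr_id !patchE.
by case: ifPn => _; rewrite ?normr0 ?mulr0// -expr2 normrX.
Qed.

Definition robin_dot u v : R :=
  L2dot (mu \x mu)%E setT (jump u) (jump v) +
  L2dot mu setT (killing u) (killing v).

(** Non-negativity of [beta] almost everywhere removes the absolute value in [killing], and Fubini
    merges the two iterated integrals into one against [jump_kernel]. *)
Lemma robin_energyE u v : W_space s Omega beta u -> W_space s Omega beta v ->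
  robin_energy s Omega beta u v = robin_dot u v.
Proof.
move=> /W_spaceP[mu_ u2 ju2 ku2] /W_spaceP[mv v2 jv2 kv2].
rewrite /robin_energy /robin_dot; congr (_ + _); last first.
  rewrite /L2dot Rintegral_mkcond /Rintegral; congr fine; apply: ae_eq_integral => //.
  - apply/measurable_EFinP; apply/(measurable_restrictT _ mOc).
    apply: measurable_funM; last exact: measurable_funTS.
    by apply: measurable_funM => //; exact: measurable_funTS.
  - apply/measurable_EFinP.
    by apply: measurable_funM; [have [] := ku2|have [] := kv2].
  apply: filterS beta0 => x b0 _; congr EFin.
  rewrite killingM !patchE; case: ifPn => xO; last by rewrite normr0 mulr0.
  by rewrite ger0_norm; [ring|exact: b0 (set_mem xO)].
pose g (z : 'rV[R]_n * 'rV[R]_n) :=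
  (u z.1 - u z.2) * (v z.1 - v z.2) * frac_kernel s z.1 z.2.
have mg : measurable_fun setT g.
  apply: measurable_funM; last exact: measurable_frac_kernel.
  by apply: measurable_funM; exact: measurable_diff.
have ij := L2_integrableM measurableT ju2 jv2.
(* Each piece of the energy is dominated by [c^-1] times the product of [jump u] and [jump v], which
   is integrable. *)
have cut (A : set 'rV[R]_n) c : measurable A -> 0 < c ->
    (forall z, c * (\1_Omega z.1 * \1_A z.2) * frac_kernel s z.1 z.2 <=
       jump_kernel s Omega z) ->
    (mu \x mu)%E.-integrable setT (fun z => (\1_Omega z.1 * \1_A z.2 * g z)%:E).
  move=> mA c0 cK.
  have ic := integrableZl measurableT c^-1 ij.
  apply: (le_integrable measurableT _ _ ic).
    apply/measurable_EFinP; apply: measurable_funM => //.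
    by apply: measurable_funM; [exact: measurable_indic_fst|exact: measurable_indic_snd].
  move=> z _; rewrite /= lee_fin (jumpM Omega s01) /g.
  have := cK z; have := jump_kernel_ge0 Omega s01 z.
  move: (jump_kernel s Omega z) (_ - _) (v _ - _) => K p q K0 cKz.
  have -> : \1_Omega z.1 * \1_A z.2 * (p * q * frac_kernel s z.1 z.2) =
    p * q * (\1_Omega z.1 * \1_A z.2 * frac_kernel s z.1 z.2) by ring.
  have -> : c^-1 * (p * q * K) = p * q * (c^-1 * K) by ring.
  have a0 : 0 <= \1_Omega z.1 * \1_A z.2 * frac_kernel s z.1 z.2.
    by rewrite mulr_ge0 ?frac_kernel_ge0// mulr_ge0// indicE.
  rewrite !(normrM (p * q)) ler_wpM2l//.
  rewrite (ger0_norm a0) ger0_norm; last by rewrite mulr_ge0 ?invr_ge0 ?(ltW c0).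
  by rewrite ler_pdivlMl// mulrA.
have iOO : (mu \x mu)%E.-integrable setT
    (fun z => (\1_Omega z.1 * \1_Omega z.2 * g z)%:E).
  apply: (cut _ (C / 2)) => //; first by rewrite divr_gt0.
  move=> z; rewrite /jump_kernel ler_wpM2r ?frac_kernel_ge0// lerDl.
  by apply: mulr_ge0; [exact: ltW|apply: mulr_ge0; rewrite indicE].
have iOc : (mu \x mu)%E.-integrable setT
    (fun z => (\1_Omega z.1 * \1_Oc z.2 * g z)%:E).
  apply: (cut _ C) => // z.
  rewrite /jump_kernel ler_wpM2r ?frac_kernel_ge0// lerDr.
  by apply: mulr_ge0; [rewrite divr_ge0 ?(ltW C0)|apply: mulr_ge0; rewrite indicE].
rewrite /energy (Rintegral_prodE mO mO iOO) (Rintegral_prodE mO mOc iOc).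
rewrite -!RintegralZl// -RintegralD//.
- by apply: eq_Rintegral => z _; rewrite (jumpM Omega s01) /jump_kernel /g; ring.
- exact: (integrableZl measurableT (C / 2) iOO).
- exact: (integrableZl measurableT C iOc).
Qed.

End robin_energy_pullback.

(** * The Robin extension *)

Section robin_extension.
Context {R : realType} {n : nat}.
Variables (s : R) (Omega : set 'rV[R]_n) (beta : 'rV[R]_n -> R).
Hypotheses (s01 : 0 < s < 1) (oO : open Omega).
Local Notation mu := (@lebesgue_measure_rV R n).
Local Notation C := (frac_const n s).
Local Notation Oc := (~` Omega).
Hypothesis Olty : (mu Omega < +oo)%E.
Hypothesis mbeta : measurable_fun Oc beta.
Implicit Types (u v w : 'rV[R]_n -> R).
Local Notation ext := (robin_ext s Omega beta).

Let mO : measurable Omega. Proof. exact: open_measurable_rV. Qed.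
Let mOc : measurable Oc. Proof. exact: measurableC. Qed.

Lemma robin_ext_in u x : Omega x -> ext u x = u x.
Proof. by move=> Ox; rewrite /robin_ext mem_set. Qed.

Lemma robin_ext_boundary u x : ~ Omega x -> closure Omega x -> ext u x = 0.
Proof. by move=> Ox cx; rewrite /robin_ext memNset// mem_set. Qed.

Lemma robin_ext_out u x : ~ closure Omega x -> ext u x =
  C / (C * rho s Omega x + beta x) * L2dot mu Omega u (frac_kernel s x).
Proof.
move=> cx; rewrite /robin_ext memNset ?memNset//.
by move=> Ox; exact/cx/subset_closure.
Qed.

Lemma measurable_frac_kernel1 x (A : set 'rV[R]_n) :
  measurable_fun A (frac_kernel s x).
Proof.
apply: measurable_funTS.
exact: (measurable_fun_pair2 x (measurable_frac_kernel s)).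
Qed.

Lemma L2_bounded u (B : R) : measurable_fun Omega u ->
  (forall x, Omega x -> `|u x| <= B) -> L2 mu Omega u.
Proof.
move=> mu_ uB; split => //.
apply: (@le_lt_trans _ _ (\int[mu]_(x in Omega) (B ^+ 2)%:E)%E).
  apply: ge0_le_integral.
  - exact: mO.
  - by move=> x _; rewrite lee_fin sqr_ge0.
  - apply/measurable_EFinP; apply: measurable_funX.
    exact: (measurableT_comp (@normr_measurable R setT) mu_).
  - exact: measurable_cst.
  - move=> x Ox; rewrite lee_fin lerXn2r ?nnegrE ?uB//.
    exact: le_trans (uB x Ox).
by rewrite integral_cst//= lte_mul_pinfty// lee_fin sqr_ge0.
Qed.

Lemma kernel_bounded x : ~ closure Omega x ->
  exists B : R, forall y, Omega y -> `|frac_kernel s x y| <= B.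
Proof.
move=> cx; have oC : open (~` closure Omega).
  by apply: closed_openC; exact: closed_closure.
have /nbhs_ballP[d /= d0 xd] := open_nbhs_nbhs (conj oC cx).
have a0 : 0 <= n%:R + 2 * s :> R.
  by have /andP[/ltW s0 _] := s01; rewrite addr_ge0// mulr_ge0.
exists (d `^ (n%:R + 2 * s))^-1 => y Oy.
rewrite ger0_norm ?frac_kernel_ge0// /frac_kernel.
(* The ball around [x] is one of the sup norm, and it contains the Euclidean ball of the same
   radius. *)
have dxy : d <= enorm (x - y).
  rewrite leNgt; apply/negP => xyd; apply: (xd y); last exact: subset_closure.
  split => // i j; rewrite (ord1 i) /ball /=.
  by apply: le_lt_trans xyd; have := le_coord_enorm (x - y) j; rewrite !mxE.
rewrite lef_pV2 ?posrE ?powR_gt0//; last exact: lt_le_trans dxy.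
by apply: ge0_ler_powR => //; rewrite nnegrE ?(ltW d0) ?enorm_ge0.
Qed.

Lemma frac_kernel_L2 x : ~ closure Omega x -> L2 mu Omega (frac_kernel s x).
Proof.
move=> /kernel_bounded[B kB]; apply: (L2_bounded _ kB).
exact: measurable_frac_kernel1.
Qed.

Lemma cst1_L2 : L2 mu Omega (fun=> 1).
Proof. by apply: (@L2_bounded _ 1) => // x _; rewrite normr1. Qed.

Lemma rhoE x : rho s Omega x = L2dot mu Omega (fun=> 1) (frac_kernel s x).
Proof. by apply: eq_Rintegral => y _; rewrite mul1r. Qed.

Lemma rho_ge0 x : 0 <= rho s Omega x.
Proof. by apply: Rintegral_ge0 => y _; exact: frac_kernel_ge0. Qed.

Lemma robin_ext_lin (c : R) u v : L2 mu Omega u -> L2 mu Omega v ->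
  ext (fun x => c * u x + v x) = (fun x => c * ext u x + ext v x).
Proof.
move=> u2 v2; apply/funext => x.
have [Ox|Ox] := pselect (Omega x); first by rewrite !robin_ext_in.
have [cx|cx] := pselect (closure Omega x).
  by rewrite !robin_ext_boundary//; ring.
by rewrite !robin_ext_out// (L2dot_linl mO)//; [ring|exact: frac_kernel_L2].
Qed.

Lemma robin_ext_eq u v : (forall x, Omega x -> u x = v x) -> ext u = ext v.
Proof.
move=> uv; apply/funext => x.
have [Ox|Ox] := pselect (Omega x); first by rewrite !robin_ext_in// uv.
have [cx|cx] := pselect (closure Omega x).
  by rewrite !robin_ext_boundary.
rewrite !robin_ext_out//; congr (_ * _); apply: eq_Rintegral => y.
by rewrite inE => Oy; rewrite uv.
Qed.

Lemma robin_ext_ae u v : L2 mu Omega u -> L2 mu Omega v ->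
  u = v %[ae mu in Omega] -> {ae mu, forall x, ext u x = ext v x}.
Proof.
move=> u2 v2 uv; apply: filterS (uv) => x uvx.
have [Ox|Ox] := pselect (Omega x); first by rewrite !robin_ext_in// uvx.
have [cx|cx] := pselect (closure Omega x).
  by rewrite !robin_ext_boundary.
rewrite !robin_ext_out//; congr (_ * _).
by apply: (L2dot_ae mO) => //; exact: frac_kernel_L2.
Qed.

Lemma measurable_kernel_integral u : measurable_fun Omega u ->
  measurable_fun setT (fun x => L2dot mu Omega u (frac_kernel s x)).
Proof.
move=> mu_; pose h (z : 'rV[R]_n * 'rV[R]_n) : \bar R :=
  ((u \_ Omega) z.2 * frac_kernel s z.1 z.2)%:E.
have mh : measurable_fun setT h.
  apply/measurable_EFinP; apply: measurable_funM; last exact: measurable_frac_kernel.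
  apply: (measurableT_comp _ measurable_snd).
  exact/(measurable_restrictT _ mO).
apply: (eq_measurable_fun (fun x => fine (\int[mu]_y h (x, y)))%E).
  move=> x _; rewrite /L2dot Rintegral_mkcond /Rintegral; congr fine.
  apply: eq_integral => y _; rewrite /h /= !patchE.
  by case: ifPn => _; rewrite ?mul0r.
apply: measurableT_comp; first exact: fine_measurable.
exact: measurable_integral_section mh.
Qed.

Lemma measurable_robin_ext u : measurable_fun Omega u ->
  measurable_fun setT (ext u).
Proof.
move=> mu_; have mc : measurable (closure Omega).
  by apply: closed_measurable_rV; exact: closed_closure.
apply: (eq_measurable_fun (fun x => (u \_ Omega) x +
  ((fun x => C / (C * rho s Omega x + beta x) *
    L2dot mu Omega u (frac_kernel s x)) \_ (~` closure Omega)) x)).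
  move=> x _; rewrite !patchE.
  have [Ox|Ox] := pselect (Omega x).
    rewrite robin_ext_in// mem_set// memNset ?addr0//= => h.
    by apply: h; exact: subset_closure.
  rewrite (memNset Ox) add0r.
  have [cx|cx] := pselect (closure Omega x).
    by rewrite robin_ext_boundary// memNset//= => h; exact: h.
  by rewrite robin_ext_out// mem_set.
apply: measurable_funD; first exact/(measurable_restrictT _ mO).
apply/(measurable_restrictT _ (measurableC mc)).
have mbc : measurable_fun (~` closure Omega) beta.
  exact: (measurable_funS mOc (subsetC (@subset_closure _ Omega)) mbeta).
have mI w : measurable_fun Omega w -> measurable_fun (~` closure Omega)
    (fun x => L2dot mu Omega w (frac_kernel s x)).
  by move=> mw; apply: measurable_funTS; exact: measurable_kernel_integral.
apply: measurable_funM; last exact: mI.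
apply: measurable_funM; first exact: measurable_cst.
apply: (measurableT_comp (@measurable_invr R)).
apply: measurable_funD; last exact: mbc.
apply: measurable_funM; first exact: measurable_cst.
apply: (eq_measurable_fun (fun x => L2dot mu Omega (fun=> 1) (frac_kernel s x))).
  by move=> x _; rewrite rhoE.
by apply: mI; exact: measurable_cst.
Qed.

End robin_extension.

(** * Pointwise minimality of the Robin extension *)

Section robin_minimality.
Context {R : realType} {n : nat}.
Variables (s : R) (Omega : set 'rV[R]_n) (beta : 'rV[R]_n -> R).
Hypotheses (s01 : 0 < s < 1) (oO : open Omega).
Local Notation mu := (@lebesgue_measure_rV R n).
Local Notation C := (frac_const n s).
Local Notation Oc := (~` Omega).
Hypothesis Olty : (mu Omega < +oo)%E.
Implicit Types (u v w : 'rV[R]_n -> R).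
Local Notation ext := (robin_ext s Omega beta).

Let C0 : 0 < C. Proof. exact: frac_const_gt0. Qed.
Let mO : measurable Omega. Proof. exact: open_measurable_rV. Qed.

Lemma kernel_sqr_integrable v y : L2 mu Omega v -> ~ closure Omega y ->
  mu.-integrable Omega (fun x => (v x ^+ 2 * frac_kernel s y x)%:E).
Proof.
move=> v2 cy; have [B kB] := kernel_bounded s01 cy.
have iv := integrableZl mO B (L2_integrable_sqr v2).
have [mv _] := v2; have mk := @measurable_frac_kernel1 R n s y Omega.
apply: (le_integrable mO _ _ iv).
  apply/measurable_EFinP; apply: measurable_funM; last exact: mk.
  exact: measurable_funX.
move=> x Ox; rewrite /= lee_fin !normrM mulrC ler_wpM2r//.
by apply: le_trans (kB x Ox) _; exact: ler_norm.
Qed.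

(** Expansion in powers of [t]; every coefficient is finite because the kernel based at a point off
    the closure is bounded on [Omega]. *)
Lemma kernel_quadratic v y t : L2 mu Omega v -> ~ closure Omega y ->
  (\int[mu]_(x in Omega) ((v x - t) ^+ 2 * frac_kernel s y x)%:E =
   ((\int[mu]_(x in Omega) (v x ^+ 2 * frac_kernel s y x))%R
    - 2 * t * L2dot mu Omega v (frac_kernel s y) + t ^+ 2 * rho s Omega y)%:E)%E.
Proof.
move=> v2 cy.
have i2 := kernel_sqr_integrable v2 cy.
have k2 := frac_kernel_L2 s01 oO Olty cy.
have c2 := cst1_L2 oO Olty.
have ij := L2_integrableM mO v2 k2; have ik := L2_integrableM mO c2 k2.
have i1 : mu.-integrable Omega
    (EFin \o (fun x => - (2 * t) * (v x * frac_kernel s y x))).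
  exact: (integrableZl mO (- (2 * t)) ij).
have i0 : mu.-integrable Omega
    (EFin \o (fun x => t ^+ 2 * (1 * frac_kernel s y x))).
  exact: (integrableZl mO (t ^+ 2) ik).
have i21 : mu.-integrable Omega (EFin \o (fun x =>
    v x ^+ 2 * frac_kernel s y x + - (2 * t) * (v x * frac_kernel s y x))).
  exact: (integrableD mO i2 i1).
have iall := integrableD mO i21 i0.
have E : (fun x => (v x - t) ^+ 2 * frac_kernel s y x) = (fun x =>
    v x ^+ 2 * frac_kernel s y x + - (2 * t) * (v x * frac_kernel s y x) +
    t ^+ 2 * (1 * frac_kernel s y x)).
  by apply/funext => x; ring.
have -> : (\int[mu]_(x in Omega) ((v x - t) ^+ 2 * frac_kernel s y x)%:E =
    (\int[mu]_(x in Omega) ((v x - t) ^+ 2 * frac_kernel s y x))%:E)%E.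
  rewrite /Rintegral fineK//; have := integrable_fin_num mO iall.
  congr (is_true (_ \is a fin_num)); apply: eq_integral => x _.
  by rewrite (congr1 (@^~ x) E).
congr EFin; rewrite E (RintegralD mO i21 i0) (RintegralD mO i2 i1).
rewrite (RintegralZl _ mO ij) (RintegralZl _ mO ik) rhoE.
by rewrite mulNr.
Qed.

(** This is the exterior condition at [y] with the denominator cleared. If the denominator is 0,
    then [rho] vanishes there, and the integral of [v] against the kernel vanishes too: it is the
    slope of a polynomial in [t] that is affine and non-negative. *)
Lemma robin_ext_equation v y : L2 mu Omega v -> ~ closure Omega y ->
  0 <= beta y ->
  (C * rho s Omega y + beta y) * ext v y =
  C * L2dot mu Omega v (frac_kernel s y).
Proof.
move=> v2 cy b0; rewrite robin_ext_out//.
set S := C * rho s Omega y + beta y; set I1 := L2dot _ _ _ _.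
have [S0|S0] := eqVneq S 0; last by field.
have r0 : rho s Omega y = 0.
  have h : 0 <= C * rho s Omega y by rewrite mulr_ge0 ?rho_ge0 ?(ltW C0).
  have : C * rho s Omega y = 0 by move: S0; rewrite /S; lra.
  by move/eqP; rewrite mulf_eq0 (gt_eqF C0) => /eqP.
suff -> : I1 = 0 by rewrite !mulr0.
pose I2 := (\int[mu]_(x in Omega) (v x ^+ 2 * frac_kernel s y x))%R.
have I20 : 0 <= I2.
  by apply: Rintegral_ge0 => x _; rewrite mulr_ge0 ?sqr_ge0 ?frac_kernel_ge0.
have : (- I1) ^+ 2 <= I2 * 0.
  apply: discriminant_le => // t.
  rewrite mulrN -lee_fin; have := kernel_quadratic t v2 cy; rewrite r0 => <-.
  by apply: integral_ge0 => x _; rewrite lee_fin mulr_ge0 ?sqr_ge0 ?frac_kernel_ge0.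
by rewrite mulr0 sqrrN => h; apply/eqP; rewrite -sqrf_eq0 eq_le h sqr_ge0.
Qed.

(* By [kernel_quadratic] the right-hand side is a quadratic polynomial in [t],
   critical at [ext v y] by [robin_ext_equation]. *)
Lemma robin_ext_pointwise_min v y t : L2 mu Omega v -> ~ closure Omega y ->
  0 <= beta y ->
  (C%:E * (\int[mu]_(x in Omega) ((v x - ext v y) ^+ 2 * frac_kernel s y x)%:E)
    + (ext v y ^+ 2 * beta y)%:E <=
   C%:E * (\int[mu]_(x in Omega) ((v x - t) ^+ 2 * frac_kernel s y x)%:E)
    + (t ^+ 2 * beta y)%:E)%E.
Proof.
move=> v2 cy b0; have := robin_ext_equation v2 cy b0.
rewrite !kernel_quadratic// -!EFinM -!EFinD lee_fin.
move: (Rintegral _ _ _) (L2dot _ _ _ _) (rho_ge0 s Omega y) => I2 I1.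
move: (rho _ _ _) (ext v y) b0 C0 => r e; move: (beta y) C => b c b0 c0 r0 E.
have h : 0 <= (c * r + b) * (t - e) ^+ 2.
  by rewrite mulr_ge0 ?sqr_ge0// addr_ge0// mulr_ge0// ltW.
have -> : c * (I2 - 2 * e * I1 + e ^+ 2 * r) + e ^+ 2 * b =
   c * I2 - 2 * e * (c * I1) + e ^+ 2 * (c * r + b) by ring.
have -> : c * (I2 - 2 * t * I1 + t ^+ 2 * r) + t ^+ 2 * b =
   c * I2 - 2 * t * (c * I1) + t ^+ 2 * (c * r + b) by ring.
rewrite -E -subr_ge0; apply: le_trans h _; rewrite le_eqVlt; apply/orP; left.
by apply/eqP; ring.
Qed.

End robin_minimality.

(** * The Robin extension stays in [W_space] and decreases the energy *)

Section robin_projection.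
Context {R : realType} {n : nat}.
Variables (s : R) (Omega : set 'rV[R]_n) (beta : 'rV[R]_n -> R).
Hypotheses (s01 : 0 < s < 1) (oO : open Omega).
Local Notation mu := (@lebesgue_measure_rV R n).
Local Notation C := (frac_const n s).
Local Notation Oc := (~` Omega).
Hypothesis Olty : (mu Omega < +oo)%E.
Hypothesis bnull : mu (closure Omega `\` Omega) = 0%E.
Hypothesis mbeta : measurable_fun Oc beta.
Hypothesis beta0 : {ae mu, forall x, Oc x -> 0 <= beta x}.
Implicit Types (u v w : 'rV[R]_n -> R).
Local Notation ext := (robin_ext s Omega beta).
Local Notation jump := (jump s Omega).
Local Notation killing := (killing Omega beta).
Local Notation W := (W_space s Omega beta).
Local Notation Q := (robin_dot s Omega beta).

Let C0 : 0 < C. Proof. exact: frac_const_gt0. Qed.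
Let mO : measurable Omega. Proof. exact: open_measurable_rV. Qed.
Let mOc : measurable Oc. Proof. exact: measurableC. Qed.

(** The part of the energy density that sees the values on [Omega] only. *)
Let inner v (z : 'rV[R]_n * 'rV[R]_n) : R :=
  C / 2 * (\1_Omega z.1 * \1_Omega z.2) * (v z.1 - v z.2) ^+ 2 *
  frac_kernel s z.1 z.2.

(** The two arguments separate the values on [Omega], taken from [v], from those outside, taken from
    [w]. *)
Let outer v w (z : 'rV[R]_n * 'rV[R]_n) : R :=
  C * (\1_Omega z.1 * \1_Oc z.2) * (v z.1 - w z.2) ^+ 2 *
  frac_kernel s z.1 z.2.

Let inner_ge0 v z : 0 <= inner v z.
Proof.
rewrite mulr_ge0 ?frac_kernel_ge0// mulr_ge0 ?sqr_ge0//.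
by apply: mulr_ge0; [rewrite divr_ge0 ?(ltW C0)|apply: mulr_ge0; rewrite indicE].
Qed.

Let outer_ge0 v w z : 0 <= outer v w z.
Proof.
rewrite mulr_ge0 ?frac_kernel_ge0// mulr_ge0 ?sqr_ge0//.
by apply: mulr_ge0; [exact: ltW|apply: mulr_ge0; rewrite indicE].
Qed.

Let measurable_inner v : measurable_fun setT v ->
  measurable_fun setT (fun z => (inner v z)%:E).
Proof.
move=> mv; apply/measurable_EFinP; apply: measurable_funM; last first.
  exact: measurable_frac_kernel.
apply: measurable_funM; last by apply: measurable_funX; exact: measurable_diff.
apply: measurable_funM; first exact: measurable_cst.
apply: measurable_funM; first exact: measurable_indic_fst.
exact: measurable_indic_snd.
Qed.

Let measurable_outer v w : measurable_fun setT v -> measurable_fun setT w ->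
  measurable_fun setT (fun z => (outer v w z)%:E).
Proof.
move=> mv mw; apply/measurable_EFinP; apply: measurable_funM; last first.
  exact: measurable_frac_kernel.
apply: measurable_funM; last first.
  apply: measurable_funX; apply: measurable_funB.
    exact: (measurableT_comp mv measurable_fst).
  exact: (measurableT_comp mw measurable_snd).
apply: measurable_funM; first exact: measurable_cst.
apply: measurable_funM; first exact: measurable_indic_fst.
exact: measurable_indic_snd.
Qed.

(** Tonelli makes the variable outside [Omega] the last one to be integrated, so that for fixed [y]
    the integrand depends on [w] through the number [w y] alone and can be minimized point by
    point. *)
Let energy_split v w : measurable_fun setT v -> measurable_fun setT w ->
  (forall x, Omega x -> w x = v x) ->
  (\int[mu \x mu]_z (jump w z ^+ 2)%:E + \int[mu]_y (killing w y ^+ 2)%:E =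
   \int[mu \x mu]_z (inner v z)%:E +
   \int[mu]_y ((\int[mu]_x (outer v w (x, y))%:E) + (killing w y ^+ 2)%:E))%E.
Proof.
move=> mv mw wv.
have o0 z : (0 <= (outer v w z)%:E)%E by rewrite lee_fin.
have mout := measurable_outer mv mw.
have mG := measurable_fun_fubini_tonelli_G (m1 := mu) _ mout o0.
have mk : measurable_fun setT (fun y => (killing w y ^+ 2)%:E).
  apply/measurable_EFinP; apply: measurable_funX.
  exact: measurable_killing.
transitivity (\int[mu \x mu]_z ((inner v z)%:E + (outer v w z)%:E) +
   \int[mu]_y (killing w y ^+ 2)%:E)%E.
  congr (_ + _)%E; apply: eq_integral => z _; rewrite -EFinD; congr EFin.
  rewrite (jump_sqr Omega s01) /jump_kernel /inner /outer.
  have [zO1|zO1] := pselect (Omega z.1); last first.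
    by rewrite [\1_Omega z.1]indicE memNset//=; ring.
  rewrite (wv _ zO1).
  have [zO2|zO2] := pselect (Omega z.2); first by rewrite (wv _ zO2); ring.
  by rewrite [\1_Omega z.2]indicE memNset//=; ring.
rewrite ge0_integralD; first last.
- exact: mout.
- by move=> z _; exact: o0.
- exact: measurable_inner.
- by move=> z _; rewrite lee_fin.
- exact: measurableT.
rewrite -addeA; congr (_ + _)%E.
rewrite (fubini_tonelli2 _ mout o0).
have E : (\int[mu]_y ((\int[mu]_x (outer v w (x, y))%:E) +
    (killing w y ^+ 2)%:E) = \int[mu]_y (\int[mu]_x (outer v w (x, y))%:E) +
    \int[mu]_y (killing w y ^+ 2)%:E)%E.
  apply: ge0_integralD.
  - exact: measurableT.
  - by move=> y _; apply: integral_ge0 => x _; exact: o0.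
  - exact: mG.
  - by move=> y _; rewrite lee_fin sqr_ge0.
  - exact: mk.
by rewrite E.
Qed.

(** Stated between extended reals, since finiteness of the left-hand side is one of the things to be
    deduced from it. *)
Let energy_le v : measurable_fun setT v -> L2 mu Omega v ->
  (\int[mu \x mu]_z (jump (ext v) z ^+ 2)%:E +
     \int[mu]_y (killing (ext v) y ^+ 2)%:E <=
   \int[mu \x mu]_z (jump v z ^+ 2)%:E + \int[mu]_y (killing v y ^+ 2)%:E)%E.
Proof.
move=> mv v2; have [mvO _] := v2.
have me := measurable_robin_ext s oO mbeta mvO.
have ev x : Omega x -> ext v x = v x by exact: robin_ext_in.
rewrite (energy_split mv me ev) (energy_split mv mv) => [|//].
apply: leeD2l; apply: ae_ge0_le_integral.
- exact: measurableT.
- move=> y _; apply: adde_ge0; last by rewrite lee_fin sqr_ge0.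
  by apply: integral_ge0 => x _; rewrite lee_fin.
- apply: emeasurable_funD.
    apply: (measurable_fun_fubini_tonelli_G _ (measurable_outer mv me)) => z.
    by rewrite lee_fin.
  by apply/measurable_EFinP; apply: measurable_funX; exact: measurable_killing.
- move=> y _; apply: adde_ge0; last by rewrite lee_fin sqr_ge0.
  by apply: integral_ge0 => x _; rewrite lee_fin.
- apply: emeasurable_funD.
    apply: (measurable_fun_fubini_tonelli_G _ (measurable_outer mv mv)) => z.
    by rewrite lee_fin.
  by apply/measurable_EFinP; apply: measurable_funX; exact: measurable_killing.
(* On the boundary [ext v] is an arbitrary 0 and minimizes nothing; being a null set, it is
   discarded. *)
have nb : {ae mu, forall y, ~ (closure Omega `\` Omega) y}.
  exists (closure Omega `\` Omega); split => //.
    apply: measurableD => //; apply: closed_measurable_rV; exact: closed_closure.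
  by move=> y /= /contrapT.
apply: filterS2 nb beta0 => y nby b0 _.
have [Oy|Oy] := pselect (Omega y).
  rewrite le_eqVlt; apply/orP; left; apply/eqP; congr (_ + _)%E.
    by apply: eq_integral => x _; rewrite /outer /= ev.
  by rewrite /killing ev.
have cy : ~ closure Omega y by move=> cy; apply: nby.
have key w : (\int[mu]_x (outer v w (x, y))%:E + (killing w y ^+ 2)%:E =
   C%:E * (\int[mu]_(x in Omega) ((v x - w y) ^+ 2 * frac_kernel s y x)%:E) +
   (w y ^+ 2 * beta y)%:E)%E.
  congr (_ + _)%E; last first.
    congr EFin; rewrite expr2 killingM patchE mem_set// ger0_norm ?b0//.
  rewrite -ge0_integralZl_EFin ?(ltW C0)//; last 2 first.
  - by move=> x _; rewrite lee_fin mulr_ge0 ?sqr_ge0 ?frac_kernel_ge0.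
  - apply/measurable_EFinP; apply: measurable_funM.
      apply: measurable_funX; apply: measurable_funB => //.
    exact: measurable_frac_kernel1.
  rewrite [RHS]integral_mkcond; apply: eq_integral => x _.
  rewrite patchE /outer /= frac_kernelC !indicE (mem_set (Oy : Oc y)) mulr1.
  case: ifPn => xO; last by rewrite mulr0 !mul0r.
  by rewrite -EFinM /=; congr EFin; ring.
by rewrite !key; apply: (robin_ext_pointwise_min s01 oO Olty (v y) v2 cy); exact: b0.
Qed.

Let L2_of_sqr (d : measure_display) (T : measurableType d)
    (nu : {measure set T -> \bar R}) (f : T -> R) : measurable_fun setT f ->
  (\int[nu]_x (f x ^+ 2)%:E < +oo)%E -> L2 nu setT f.
Proof.
move=> mf foo; split => //; apply: le_lt_trans foo.
rewrite le_eqVlt; apply/orP; left; apply/eqP; apply: eq_integral => x _.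
by rewrite real_normK ?num_real.
Qed.

Lemma robin_ext_W v : W v -> W (ext v) /\ Q (ext v) (ext v) <= Q v v.
Proof.
move=> /(W_spaceP s01 oO mbeta)[mv v2 jv kv].
have [mvO _] := v2.
have me := measurable_robin_ext s oO mbeta mvO.
have := energy_le mv v2.
rewrite (L2dotE measurableT jv) (L2dotE measurableT kv) -EFinD => le.
have J0 : (0 <= \int[mu \x mu]_z (jump (ext v) z ^+ 2)%:E)%E.
  by apply: integral_ge0 => z _; rewrite lee_fin sqr_ge0.
have K0 : (0 <= \int[mu]_y (killing (ext v) y ^+ 2)%:E)%E.
  by apply: integral_ge0 => z _; rewrite lee_fin sqr_ge0.
have je : L2 (mu \x mu)%E setT (jump (ext v)).
  apply: L2_of_sqr; first exact: measurable_jump.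
  apply: le_lt_trans (ltry _); apply: le_trans le; exact: leeDl.
have ke : L2 mu setT (killing (ext v)).
  apply: L2_of_sqr; first exact: measurable_killing.
  apply: le_lt_trans (ltry _); apply: le_trans le; exact: leeDr.
split.
  apply/(W_spaceP s01 oO mbeta); split => //.
  split; first exact: measurable_funTS.
  have [_ h] := v2; apply: le_lt_trans h; rewrite le_eqVlt; apply/orP; left.
  by apply/eqP; apply: eq_integral => x; rewrite inE => Ox; rewrite robin_ext_in.
by rewrite -lee_fin /robin_dot EFinD -(L2dotE measurableT je) -(L2dotE measurableT ke).
Qed.

End robin_projection.

Lemma L2_ae_eq {d} {T : measurableType d} {R : realType}
    (mu : {measure set T -> \bar R}) (X : set T) (u v : T -> R) :
  measurable X -> L2 mu X u -> measurable_fun X v -> u = v %[ae mu in X] ->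
  L2 mu X v.
Proof.
move=> mX [mu_ uoo] mv uv; split => //; apply: le_lt_trans uoo.
rewrite le_eqVlt; apply/orP; left; apply/eqP; apply: ge0_ae_eq_integral.
- exact: mX.
- apply/measurable_EFinP; apply: measurable_funX.
  exact: (measurableT_comp (@normr_measurable R setT) mv).
- apply/measurable_EFinP; apply: measurable_funX.
  exact: (measurableT_comp (@normr_measurable R setT) mu_).
- by move=> x _; rewrite lee_fin sqr_ge0.
- by move=> x _; rewrite lee_fin sqr_ge0.
- by apply: (filterS _ uv) => x uvx Xx; rewrite uvx.
Qed.

(** * Algebra of the Robin form and identification of its operator *)

Section robin_form_theory.
Context {R : realType} {n : nat}.
Variables (s : R) (Omega : set 'rV[R]_n) (beta : 'rV[R]_n -> R).
Hypotheses (s01 : 0 < s < 1) (oO : open Omega).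
Local Notation mu := (@lebesgue_measure_rV R n).
Local Notation Oc := (~` Omega).
Hypothesis Olty : (mu Omega < +oo)%E.
Hypothesis bnull : mu (closure Omega `\` Omega) = 0%E.
Hypothesis mbeta : measurable_fun Oc beta.
Hypothesis beta0 : {ae mu, forall x, Oc x -> 0 <= beta x}.
Implicit Types (u v w : 'rV[R]_n -> R).
Local Notation ext := (robin_ext s Omega beta).
Local Notation jump := (jump s Omega).
Local Notation killing := (killing Omega beta).
Local Notation W := (W_space s Omega beta).
Local Notation Q := (robin_dot s Omega beta).
Local Notation D := (robin_dom s Omega beta).
Local Notation a := (robin_form s Omega beta).

Let mO : measurable Omega. Proof. exact: open_measurable_rV. Qed.
Let WP u := W_spaceP s01 oO mbeta u.

Lemma jump_lin (c : R) u v :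
  jump (fun x => c * u x + v x) = (fun z => c * jump u z + jump v z).
Proof. by apply/funext => z; rewrite /jump; ring. Qed.

Lemma killing_lin (c : R) u v :
  killing (fun x => c * u x + v x) = (fun x => c * killing u x + killing v x).
Proof. by apply/funext => x; rewrite /killing; ring. Qed.

Lemma W_lin (c : R) u v : W u -> W v -> W (fun x => c * u x + v x).
Proof.
move=> /WP[mu_ u2 ju ku] /WP[mv v2 jv kv]; apply/WP; split.
- by apply: measurable_funD => //; exact: measurable_funM.
- exact: L2_lin.
- by rewrite jump_lin; exact: L2_lin.
- by rewrite killing_lin; exact: L2_lin.
Qed.

Lemma W_cst0 : W (fun=> 0).
Proof.
apply/WP; split; first exact: measurable_cst.
- exact: L2_cst0.
- rewrite (_ : jump _ = fun=> 0); first exact: L2_cst0.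
  by apply/funext => z; rewrite /jump subrr mul0r.
- rewrite (_ : killing _ = fun=> 0); first exact: L2_cst0.
  by apply/funext => z; rewrite /killing mul0r.
Qed.

Lemma robin_dotC u v : Q u v = Q v u.
Proof. by rewrite /robin_dot L2dotC [X in _ + X]L2dotC. Qed.

Lemma robin_dot_ge0 u : 0 <= Q u u.
Proof. by rewrite addr_ge0// L2dot_ge0. Qed.

Lemma robin_dot_linl (c : R) u v w : W u -> W v -> W w ->
  Q (fun x => c * u x + v x) w = c * Q u w + Q v w.
Proof.
move=> /WP[mu_ u2 ju ku] /WP[mv v2 jv kv] /WP[mw w2 jw kw].
rewrite /robin_dot jump_lin killing_lin (L2dot_linl measurableT c ju jv jw).
by rewrite (L2dot_linl measurableT c ku kv kw); ring.
Qed.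

Lemma robin_dot_linr (c : R) u v w : W u -> W v -> W w ->
  Q w (fun x => c * u x + v x) = c * Q w u + Q w v.
Proof.
by move=> Wu Wv Ww; rewrite robin_dotC robin_dot_linl// !(robin_dotC w).
Qed.

Lemma jump_ae u v : {ae mu, forall x, u x = v x} ->
  jump u = jump v %[ae (mu \x mu)%E in setT].
Proof.
move=> uv; have h1 := ae_prod_fst uv; have h2 := ae_prod_snd uv.
by apply: (filterS2 _ _ h1 h2) => z e1 e2 _; rewrite /jump e1 e2.
Qed.

Lemma killing_ae u v : {ae mu, forall x, u x = v x} ->
  killing u = killing v %[ae mu in setT].
Proof. by move=> uv; apply: (filterS _ uv) => x e _; rewrite /killing e. Qed.

Lemma W_ae u v : W u -> measurable_fun setT v -> {ae mu, forall x, u x = v x} ->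
  W v.
Proof.
move=> /WP[mu_ u2 ju ku] mv uv; apply/WP; split => //.
- apply: (L2_ae_eq mO u2); first exact: measurable_funTS.
  by apply: (filterS _ uv) => x e _.
- apply: (L2_ae_eq measurableT ju); last exact: jump_ae.
  exact: measurable_jump.
- apply: (L2_ae_eq measurableT ku); last exact: killing_ae.
  exact: measurable_killing.
Qed.

Lemma robin_dot_ae u v w : W u -> W v -> W w -> {ae mu, forall x, u x = v x} ->
  Q u w = Q v w.
Proof.
move=> /WP[mu_ u2 ju ku] /WP[mv v2 jv kv] /WP[mw w2 jw kw] uv.
rewrite /robin_dot (L2dot_ae measurableT ju jv jw (jump_ae uv)).
by rewrite (L2dot_ae measurableT ku kv kw (killing_ae uv)).
Qed.

Lemma robin_formE u v : D u -> D v -> a u v = Q (ext u) (ext v).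
Proof. by move=> [_ Wu] [_ Wv]; exact: (robin_energyE s01 oO mbeta beta0). Qed.

Lemma robin_form_bilinear : bilinear_form_on mu Omega D a.
Proof.
have De u v : D u -> L2 mu Omega v -> u = v %[ae mu in Omega] -> D v.
  move=> [u2 Wu] v2 uv; split; first exact: v2.
  have [mv _] := v2; have me := measurable_robin_ext s oO mbeta mv.
  exact: (W_ae Wu me (robin_ext_ae beta s01 oO Olty u2 v2 uv)).
have Dl (c : R) u v : D u -> D v -> D (fun x => c * u x + v x).
  move=> [u2 Wu] [v2 Wv]; split; first exact: L2_lin.
  by rewrite /= (robin_ext_lin beta s01 oO Olty c u2 v2); exact: W_lin.
have linl (c : R) u v w : D u -> D v -> D w ->
    a (fun x => c * u x + v x) w = c * a u w + a v w.
  move=> Du Dv Dw; rewrite (robin_formE (Dl c u v Du Dv) Dw).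
  rewrite (robin_formE Du Dw) (robin_formE Dv Dw).
  have [u2 Wu] := Du; have [v2 Wv] := Dv; have [w2 Ww] := Dw.
  by rewrite (robin_ext_lin beta s01 oO Olty c u2 v2) (robin_dot_linl c Wu Wv Ww).
have sym u v : D u -> D v -> a u v = a v u.
  by move=> Du Dv; rewrite (robin_formE Du Dv) (robin_formE Dv Du) robin_dotC.
split.
- by move=> u [].
- exact: De.
- split; first exact: L2_cst0.
  exact: (robin_ext_W s01 oO Olty bnull mbeta beta0 W_cst0).1.
- exact: Dl.
- move=> u u' v Du Du' Dv uu'.
  have h : a u v = a u' v.
    rewrite (robin_formE Du Dv) (robin_formE Du' Dv).
    have [u2 Wu] := Du; have [u'2 Wu'] := Du'; have [v2 Wv] := Dv.
    exact: (robin_dot_ae Wu Wu' Wv (robin_ext_ae beta s01 oO Olty u2 u'2 uu')).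
  split; first exact: h.
  rewrite (sym v u Dv Du) (sym v u' Dv Du'); exact: h.
- exact: linl.
- move=> c u v w Du Dv Dw; rewrite (sym w _ Dw (Dl c u v Du Dv)).
  by rewrite (linl c u v w Du Dv Dw) (sym w u Dw Du) (sym w v Dw Dv).
Qed.

Lemma robin_form_symmetric : symmetric_on D a.
Proof.
by move=> u v Du Dv; rewrite (robin_formE Du Dv) (robin_formE Dv Du) robin_dotC.
Qed.

Lemma robin_form_nonneg : nonneg_on D a.
Proof. by move=> u Du; rewrite (robin_formE Du Du) robin_dot_ge0. Qed.

(* Among the functions with given values on [Omega], [ext v] minimizes [Q], so
   it is [Q]-orthogonal to the functions vanishing on [Omega]. *)
Lemma robin_ext_orth u v : D u -> W v -> Q (ext u) v = Q (ext u) (ext v).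
Proof.
move=> [u2 Wu] Wv; have [We _] := robin_ext_W s01 oO Olty bnull mbeta beta0 Wv.
pose w x := -1 * ext v x + v x.
have Ww : W w by exact: W_lin.
have w0 x : Omega x -> w x = 0 by move=> Ox; rewrite /w robin_ext_in//; ring.
(* Adding [t w] to [ext u] keeps the values on [Omega], hence the Robin extension, which remains
   [ext u]; its energy is therefore not above that of the sum. The constant term 0 turns the
   discriminant bound into orthogonality. *)
have H t : 0 <= 0 + 2 * t * Q (ext u) w + t ^+ 2 * Q w w.
  have Wt : W (fun x => t * w x + ext u x) by exact: W_lin.
  have [_] := robin_ext_W s01 oO Olty bnull mbeta beta0 Wt.
  have -> : ext (fun x => t * w x + ext u x) = ext u.
    by apply: robin_ext_eq => x Ox; rewrite w0// mulr0 add0r robin_ext_in.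
  rewrite (robin_dot_linl t Ww Wu Wt) (robin_dot_linr t Ww Wu Ww).
  rewrite (robin_dot_linr t Ww Wu Wu) (robin_dotC w (ext u)).
  by move: (Q _ _) (Q (ext u) w) (Q w w) => *; lra.
have := discriminant_le (lexx 0) (robin_dot_ge0 w) H.
rewrite mul0r => h.
have : Q (ext u) w = 0 by apply/eqP; rewrite -sqrf_eq0 eq_le h sqr_ge0.
rewrite /w (robin_dot_linr (-1) We Wv Wu).
by move: (Q _ _) (Q (ext u) v) => *; lra.
Qed.

(** Supplies test functions: those of the weak formulation enter the form domain through it, and so
    do the Lipschitz functions in the density argument. *)
Lemma robin_dom_W v : W v -> D v.
Proof.
move=> Wv; have /WP[_ v2 _ _] := Wv; split; first exact: v2.
exact: (robin_ext_W s01 oO Olty bnull mbeta beta0 Wv).1.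
Qed.

Lemma robin_operatorP u f : form_operator mu Omega D a u f <->
  [/\ L2 mu Omega u, W (ext u), L2 mu Omega f &
      robin_weak_solution s Omega beta f (ext u)].
Proof.
split=> [[Du f2 H]|[u2 Wu f2 [_ H]]].
  have [u2 Wu] := Du; split; [exact: u2|exact: Wu|exact: f2|].
  split; first exact: Wu.
  move=> v Wv; rewrite (robin_energyE s01 oO mbeta beta0 Wu Wv).
  rewrite (robin_ext_orth Du Wv).
  have Dv := robin_dom_W Wv.
  by rewrite -(robin_formE Du Dv); exact: H.
split; [by split|exact: f2|].
move=> v [v2 Wv]; rewrite /robin_form (H _ Wv).
by apply: eq_Rintegral => x; rewrite inE => Ox; rewrite robin_ext_in.
Qed.

End robin_form_theory.

(** * Closedness of the Robin form *)

Section robin_form_closedness.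
Context {R : realType} {n : nat}.
Variables (s : R) (Omega : set 'rV[R]_n) (beta : 'rV[R]_n -> R).
Hypotheses (s01 : 0 < s < 1) (oO : open Omega).
Local Notation mu := (@lebesgue_measure_rV R n).
Local Notation Oc := (~` Omega).
Hypothesis Olty : (mu Omega < +oo)%E.
Hypothesis bnull : mu (closure Omega `\` Omega) = 0%E.
Hypothesis mbeta : measurable_fun Oc beta.
Hypothesis beta0 : {ae mu, forall x, Oc x -> 0 <= beta x}.
Local Notation ext := (robin_ext s Omega beta).
Local Notation jump := (jump s Omega).
Local Notation killing := (killing Omega beta).
Local Notation W := (W_space s Omega beta).
Local Notation D := (robin_dom s Omega beta).
Local Notation a := (robin_form s Omega beta).

Let mO : measurable Omega. Proof. exact: open_measurable_rV. Qed.
Let WP u := W_spaceP s01 oO mbeta u.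

Lemma L2dot_cvg {d} {T : measurableType d} (nu : {measure set T -> \bar R})
    (X : set T) (u : nat -> T -> R) w g : measurable X ->
  (forall k, L2 nu X (u k)) -> L2 nu X w -> L2 nu X g ->
  (forall e, 0 < e -> exists N, forall k, (N <= k)%N ->
     L2dot nu X (u k \- w) (u k \- w) <= e) ->
  L2dot nu X (u k) g @[k --> \oo] --> L2dot nu X w g.
Proof.
move=> mX u2 w2 g2 uw; apply/cvgrPdist_le => e e0.
have G0 := L2dot_ge0 nu X g.
(* The 1 keeps the denominator positive when [g] vanishes almost everywhere. *)
have [|N hN] := uw (e ^+ 2 / (1 + L2dot nu X g g)).
  by rewrite divr_gt0 ?exprn_gt0// ltr_pwDl.
exists N => // k /= Nk.
rewrite distrC -(L2dot_subl mX (u2 k) w2 g2).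
rewrite -(@ler_pXn2r _ 2) ?nnegrE ?(ltW e0)// real_normK ?num_real//.
apply: le_trans (L2dot_CS mX (L2_sub mX (u2 k) w2) g2) _.
apply: le_trans (ler_wpM2r G0 (hN k Nk)) _.
rewrite -mulrA ger_pMr ?exprn_gt0// mulrC ler_pdivrMr ?ltr_pwDl//.
by rewrite mul1r lerDr.
Qed.

(** The squared form norm is a sum of three squared L^2 norms, so the Cauchy property splits into
    three. A subsequence converges almost everywhere on [Omega]; off the closure its Robin
    extensions converge at every point, by L^2 convergence tested against the kernel. Increments and
    Robin terms then converge almost everywhere and [L2_cauchy_lim] applies to each. *)
Lemma robin_form_closed : closed_form mu Omega D a.
Proof.
move=> u Du cu.
have B := robin_form_bilinear s01 oO Olty bnull mbeta beta0.
have na := robin_form_nonneg s01 oO mbeta beta0.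
have u2 k : L2 mu Omega (u k) by have [] := Du k.
have Wu k : W (ext (u k)) by have [] := Du k.
have subE (T' : Type) (f g : T' -> R) : f \- g = fun x => -1 * g x + f x.
  by apply/funext => x /=; ring.
have Dsub f g : D f -> D g -> D (f \- g).
  by move=> Df Dg; rewrite subE; exact: (form_dom_lin B (-1) Dg Df).
have aE f g : D f -> D g -> a (f \- g) (f \- g) =
    L2dot (mu \x mu)%E setT (jump (ext f) \- jump (ext g))
      (jump (ext f) \- jump (ext g)) +
    L2dot mu setT (killing (ext f) \- killing (ext g))
      (killing (ext f) \- killing (ext g)).
  move=> Df Dg; have Dfg := Dsub _ _ Df Dg.
  rewrite (robin_formE s01 oO mbeta beta0 Dfg Dfg) /robin_dot.
  rewrite subE (robin_ext_lin beta s01 oO Olty (-1) Dg.1 Df.1).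
  by rewrite jump_lin killing_lin !subE.
have cauchy e : 0 < e -> exists N, forall j k, (N <= j)%N -> (N <= k)%N ->
    [/\ L2dot mu Omega (u j \- u k) (u j \- u k) < e,
        L2dot (mu \x mu)%E setT (jump (ext (u j)) \- jump (ext (u k)))
          (jump (ext (u j)) \- jump (ext (u k))) < e &
        L2dot mu setT (killing (ext (u j)) \- killing (ext (u k)))
          (killing (ext (u j)) \- killing (ext (u k))) < e].
  move=> e0; have se0 : 0 < Num.sqrt e by rewrite sqrtr_gt0.
  have [N hN] := cu _ se0; exists N => j k Nj Nk.
  have := hN j k Nj Nk; rewrite (form_norm_lt mu Omega na (Dsub _ _ (Du j) (Du k)) se0).
  rewrite sqr_sqrtr ?(ltW e0)// (aE _ _ (Du j) (Du k)).
  move: (L2dot_ge0 mu Omega (u j \- u k))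
    (L2dot_ge0 (mu \x mu)%E setT (jump (ext (u j)) \- jump (ext (u k))))
    (L2dot_ge0 mu setT (killing (ext (u j)) \- killing (ext (u k)))).
  move: (L2dot _ _ _ _) (L2dot _ _ _ _) (L2dot _ _ _ _) => x y z x0 y0 z0 xyz.
  by split; lra.
have c1 e : 0 < e -> exists N, forall j k, (N <= j)%N -> (N <= k)%N ->
    L2dot mu Omega (u j \- u k) (u j \- u k) < e.
  by move=> /cauchy[N hN]; exists N => j k Nj Nk; have [] := hN j k Nj Nk.
have c2 e : 0 < e -> exists N, forall j k, (N <= j)%N -> (N <= k)%N ->
    L2dot (mu \x mu)%E setT (jump (ext (u j)) \- jump (ext (u k)))
          (jump (ext (u j)) \- jump (ext (u k))) < e.
  by move=> /cauchy[N hN]; exists N => j k Nj Nk; have [] := hN j k Nj Nk.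
have c3 e : 0 < e -> exists N, forall j k, (N <= j)%N -> (N <= k)%N ->
    L2dot mu setT (killing (ext (u j)) \- killing (ext (u k)))
          (killing (ext (u j)) \- killing (ext (u k))) < e.
  by move=> /cauchy[N hN]; exists N => j k Nj Nk; have [] := hN j k Nj Nk.
have [phi [w [kphi mw uw]]] := L2_cauchy_subseq mO u2 c1.
have [w2 l1] := L2_cauchy_lim mO u2 mw kphi uw c1.
have me := measurable_robin_ext s oO mbeta mw.
have l1' e : 0 < e -> exists N, forall k, (N <= k)%N ->
    L2dot mu Omega (u (phi k) \- w) (u (phi k) \- w) <= e.
  by move=> /l1[N hN]; exists N => k Nk; apply: hN; exact: leq_trans (kphi k).
have euw : {ae mu, forall x, ext (u (phi k)) x @[k --> \oo] --> ext w x}.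
  apply: (filterS _ uw) => x uwx.
  have [Ox|Ox] := pselect (Omega x).
    rewrite robin_ext_in//; under eq_fun do rewrite robin_ext_in//.
    exact: uwx.
  have [cx|cx] := pselect (closure Omega x).
    rewrite robin_ext_boundary//; under eq_fun do rewrite robin_ext_boundary//.
    exact: cvg_cst.
  rewrite robin_ext_out//; under eq_fun do rewrite robin_ext_out//.
  apply: cvgM; first exact: cvg_cst.
  apply: (L2dot_cvg mO (fun k => u2 (phi k)) w2 _ l1').
  exact: frac_kernel_L2.
have juw : {ae (mu \x mu)%E, forall z, [set: 'rV[R]_n * 'rV[R]_n] z ->
    jump (ext (u (phi k))) z @[k --> \oo] --> jump (ext w) z}.
  have h1 := ae_prod_fst euw; have h2 := ae_prod_snd euw.
  apply: (filterS2 _ _ h1 h2) => z e1 e2 _.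
  exact: (cvgM (cvgB e1 e2) (cvg_cst _)).
have kuw : {ae mu, forall x, [set: 'rV[R]_n] x ->
    killing (ext (u (phi k))) x @[k --> \oo] --> killing (ext w) x}.
  apply: (filterS _ euw) => x e1 _; exact: (cvgM e1 (cvg_cst _)).
have ju k : L2 (mu \x mu)%E setT (jump (ext (u k))).
  by have /WP[] := Wu k.
have ku k : L2 mu setT (killing (ext (u k))).
  by have /WP[] := Wu k.
have mj := measurable_jump s oO me.
have mk := measurable_killing oO mbeta me.
have [jw l2] := L2_cauchy_lim measurableT ju mj kphi juw c2.
have [kw l3] := L2_cauchy_lim measurableT ku mk kphi kuw c3.
have Dw : D w.
  split; first exact: w2.
  apply/WP; split; [exact: me| |exact: jw|exact: kw].
  apply: (L2_ae_eq mO w2); first exact: measurable_funTS.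
  by apply: aeW => x Ox; rewrite robin_ext_in.
exists w; first exact: Dw.
apply/cvgrPdist_lt => e e0.
(* Three terms of at most [e^2 / 4] leave a strict inequality. *)
have e4 : 0 < e ^+ 2 / 4 by rewrite divr_gt0// exprn_gt0.
have [N1 h1] := l1 _ e4; have [N2 h2] := l2 _ e4; have [N3 h3] := l3 _ e4.
exists (maxn N1 (maxn N2 N3)) => // k /=; rewrite !geq_max => /and3P[k1 k2 k3].
rewrite sub0r normrN ger0_norm ?sqrtr_ge0//.
rewrite (form_norm_lt mu Omega na (Dsub _ _ (Du k) Dw) e0) (aE _ _ (Du k) Dw).
move: (h1 k k1) (h2 k k2) (h3 k k3) e4.
move: (L2dot _ _ _ _) (L2dot _ _ _ _) (L2dot _ _ _ _) (e ^+ 2) => x y z q.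
by move=> *; lra.
Qed.

End robin_form_closedness.

(** * Density *)

Section lipschitz_in_W.
Context {R : realType} {n : nat}.
Variables (s : R) (Omega : set 'rV[R]_n) (beta : 'rV[R]_n -> R).
Hypotheses (s01 : 0 < s < 1) (oO : open Omega).
Local Notation mu := (@lebesgue_measure_rV R n).
Local Notation C := (frac_const n s).
Local Notation Oc := (~` Omega).
Hypothesis Olty : (mu Omega < +oo)%E.
Hypothesis bint : mu.-integrable Oc (EFin \o beta).
Local Notation jump := (jump s Omega).
Local Notation killing := (killing Omega beta).

Let C0 : 0 < C. Proof. exact: frac_const_gt0. Qed.
Let mO : measurable Omega. Proof. exact: open_measurable_rV. Qed.
Let mOc : measurable Oc. Proof. exact: measurableC. Qed.
Let mbeta : measurable_fun Oc beta.
Proof. by apply/measurable_EFinP; exact: measurable_int bint. Qed.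

Lemma killing_bounded_L2 (f : 'rV[R]_n -> R) (B : R) : measurable_fun setT f ->
  (forall x, `|f x| <= B) -> L2 mu setT (killing f).
Proof.
move=> mf fB; have mk := measurable_killing oO mbeta mf.
apply: (L2P mk).
have ib := (integrable_mkcond _ mOc).1 bint.
have iB := integrableZl measurableT (B ^+ 2) ib.
apply: (le_integrable measurableT _ _ iB).
  by apply/measurable_EFinP; exact: measurable_funX.
move=> x _; rewrite expr2 killingM.
have -> : ((EFin \o beta) \_ Oc) x = ((beta \_ Oc) x)%:E.
  by rewrite !patchE; case: ifPn.
rewrite /= lee_fin !normrM normr_id ler_wpM2r//.
rewrite -expr2 -[leRHS]expr2 lerXn2r ?nnegrE//.
by apply: le_trans (fB x) _; exact: ler_norm.
Qed.

(** The Lipschitz bound serves near the diagonal and the sup bound away from it, which gives min(1,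
    r^2). The integral in [y] is then bounded uniformly in [x], and [x] ranges over [Omega], of
    finite measure. *)
Lemma jump_lipschitz_L2 (f : 'rV[R]_n -> R) (B L : R) : measurable_fun setT f ->
  (forall x, `|f x| <= B) -> (forall x y, `|f x - f y| <= L * enorm (x - y)) ->
  L2 (mu \x mu)%E setT (jump f).
Proof.
move=> mf fB fL.
pose c := L ^+ 2 + (2 * B) ^+ 2.
have fc x y : (f x - f y) ^+ 2 <= c * Num.min 1 (enorm (x - y) ^+ 2).
  have h1 : (f x - f y) ^+ 2 <= L ^+ 2 * enorm (x - y) ^+ 2.
    rewrite -real_normK ?num_real// -exprMn lerXn2r ?nnegrE//.
    exact: le_trans (fL x y).
  have h2 : (f x - f y) ^+ 2 <= (2 * B) ^+ 2.
    rewrite -real_normK ?num_real// lerXn2r ?nnegrE//.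
      by rewrite mulr_ge0//; exact: le_trans (fB x).
    by apply: le_trans (ler_normB _ _) _; have := fB x; have := fB y; lra.
  rewrite minEle; case: ifPn => _.
    by rewrite mulr1 (le_trans h2)// lerDr sqr_ge0.
  by rewrite (le_trans h1)// ler_wpM2r ?sqr_ge0// lerDl sqr_ge0.
have c0 : 0 <= C * c by rewrite mulr_ge0 ?(ltW C0)// addr_ge0// sqr_ge0.
have [K hK] := @kernel_integral_le R n s _ s01 c0.
(* A majorant with weight [C] for all second points: the factor 1/2 inside [Omega] is given up. *)
pose F (z : 'rV[R]_n * 'rV[R]_n) : R :=
  \1_Omega z.1 * (C * (f z.1 - f z.2) ^+ 2 * frac_kernel s z.1 z.2).
have g0 z : 0 <= C * (f z.1 - f z.2) ^+ 2 * frac_kernel s z.1 z.2.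
  by rewrite mulr_ge0 ?frac_kernel_ge0// mulr_ge0 ?sqr_ge0// ltW.
have mg : measurable_fun setT (fun z : 'rV[R]_n * 'rV[R]_n =>
    C * (f z.1 - f z.2) ^+ 2 * frac_kernel s z.1 z.2).
  apply: measurable_funM; last exact: measurable_frac_kernel.
  apply: measurable_funM; first exact: measurable_cst.
  by apply: measurable_funX; exact: measurable_diff.
have F0 z : (0 <= (F z)%:E)%E by rewrite lee_fin mulr_ge0 ?indicE.
have mF : measurable_fun setT (fun z => (F z)%:E).
  apply/measurable_EFinP; apply: measurable_funM => //.
  exact: measurable_indic_fst.
have JF z : `|jump f z| ^+ 2 <= F z.
  rewrite real_normK ?num_real// (jump_sqr Omega s01) /jump_kernel /F.
  rewrite indic_compl.
  have d0 := sqr_ge0 (f z.1 - f z.2); have k0 := frac_kernel_ge0 s z.1 z.2.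
  have E : \1_Omega z.1 * (C * (f z.1 - f z.2) ^+ 2 * frac_kernel s z.1 z.2) -
    (f z.1 - f z.2) ^+ 2 * ((C / 2 * (\1_Omega z.1 * \1_Omega z.2) +
     C * (\1_Omega z.1 * (1 - \1_Omega z.2))) * frac_kernel s z.1 z.2) =
    C / 2 * (\1_Omega z.1 * \1_Omega z.2) *
    ((f z.1 - f z.2) ^+ 2 * frac_kernel s z.1 z.2) by field.
  rewrite -subr_ge0 E; apply: mulr_ge0; last exact: mulr_ge0.
  by apply: mulr_ge0; [rewrite divr_ge0 ?(ltW C0)|rewrite mulr_ge0 ?indicE].
split; first exact: measurable_jump.
apply: (@le_lt_trans _ _ (\int[mu \x mu]_z (F z)%:E)%E).
  apply: ge0_le_integral.
  - exact: measurableT.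
  - by move=> z _; rewrite lee_fin sqr_ge0.
  - apply/measurable_EFinP; apply: measurable_funX.
    have mj := measurable_jump s oO mf.
    exact: (measurableT_comp (@normr_measurable R setT) mj).
  - exact: mF.
  - by move=> z _; rewrite lee_fin.
rewrite (fubini_tonelli1 _ mF F0).
(* The absolute value makes the bound non-negative, as no sign of [K] is given. *)
apply: (@le_lt_trans _ _ (\int[mu]_(x in Omega) `|K|%:E)%E); last first.
  by rewrite integral_cst//= lte_mul_pinfty.
rewrite [leRHS]integral_mkcond; apply: ge0_le_integral.
- exact: measurableT.
- by move=> x _; apply: integral_ge0 => y _; exact: F0.
- exact: (measurable_fun_fubini_tonelli_F _ mF F0).
- apply/(measurable_restrictT _ mO); exact: measurable_cst.
- move=> x _; rewrite patchE /fubini_F; case: ifPn => xO; last first.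
    by rewrite integral0_eq// => y _; rewrite /F /= indicE (negbTE xO) mul0r.
  apply: (@le_trans _ _ K%:E); last by rewrite lee_fin ler_norm.
  apply: (hK x) => [|y].
    apply: (measurable_fun_pair2 x); apply: measurable_funM => //.
    exact: measurable_indic_fst.
  rewrite /F /= indicE xO mul1r; apply/andP; split; first exact: (g0 (x, y)).
  rewrite ler_wpM2r ?frac_kernel_ge0// -mulrA ler_wpM2l ?(ltW C0)//.
Qed.

Lemma lipschitz_W (f : 'rV[R]_n -> R) (B L : R) : measurable_fun setT f ->
  (forall x, `|f x| <= B) -> (forall x y, `|f x - f y| <= L * enorm (x - y)) ->
  W_space s Omega beta f.
Proof.
move=> mf fB fL; apply/(W_spaceP s01 oO mbeta); split.
- exact: mf.
- by apply: (@L2_bounded _ _ _ oO Olty _ B) => //; exact: measurable_funTS.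
- exact: jump_lipschitz_L2 fB fL.
- exact: killing_bounded_L2 fB.
Qed.

End lipschitz_in_W.

(** * From approximable indicators to density in L^2 *)

Section L2_density.
Context {d} {T : measurableType d} {R : realType}.
Variables (mu : {measure set T -> \bar R}) (X : set T).
Hypotheses (mX : measurable X) (Xlty : (mu X < +oo)%E).
Variable D : set (T -> R).
Hypotheses (DL2 : D `<=` L2 mu X) (D0 : D (fun=> 0))
  (Dlin : forall (c : R) u v, D u -> D v -> D (fun x => c * u x + v x)).
Hypothesis Dindic : forall A (e : R), measurable A -> 0 < e ->
  exists2 v, D v & L2dot mu X (\1_A \- v) (\1_A \- v) < e.

Let approx (u : T -> R) := L2 mu X u /\ forall e : R, 0 < e ->
  exists2 v, D v & L2dot mu X (u \- v) (u \- v) < e.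

Let approx_indic A : measurable A -> approx \1_A.
Proof.
move=> mA; split; last by move=> e; exact: Dindic.
split; first exact: measurable_indic.
apply: (@le_lt_trans _ _ (\int[mu]_(x in X) 1%:E)%E).
  apply: ge0_le_integral.
  - exact: mX.
  - by move=> x _; rewrite lee_fin sqr_ge0.
  - apply/measurable_EFinP; apply: measurable_funX.
    apply: (measurableT_comp (@normr_measurable R setT)).
    exact: measurable_indic.
  - exact: measurable_cst.
  - move=> x _; rewrite lee_fin indicE; case: (x \in A) => /=.
      by rewrite normr1 expr1n.
    by rewrite normr0 expr0n.
by rewrite integral_cst//= mul1e.
Qed.

Let approx_lin (c : R) u v : approx u -> approx v ->
  approx (fun x => c * u x + v x).
Proof.
move=> [u2 ua] [v2 va]; split; first exact: L2_lin.
move=> e e0; have c0 : 0 < 1 + c ^+ 2 by rewrite ltr_pwDl// sqr_ge0.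
have [|u' Du' uu'] := ua (e / (4 * (1 + c ^+ 2))).
  by rewrite divr_gt0// mulr_gt0.
have [|v' Dv' vv'] := va (e / 4); first by rewrite divr_gt0.
exists (fun x => c * u' x + v' x); first exact: Dlin.
have u'2 := DL2 Du'; have v'2 := DL2 Dv'.
have m2 := L2_lin mX c u'2 v2.
apply: le_lt_trans (L2dot_triangle mX (L2_lin mX c u2 v2) m2
  (L2_lin mX c u'2 v'2)) _.
have z2 := L2_cst0 mu X; have du2 := L2_sub mX u2 u'2.
(* The multiple by [c] is again written as [(c - 1)] plus 1 times, in the shape of the linearity
   lemmas. *)
have -> : (fun x => c * u x + v x) \- (fun x => c * u' x + v x) =
    (fun x => (c - 1) * (u \- u') x + (u \- u') x).
  by apply/funext => x /=; ring.
have -> : (fun x => c * u' x + v x) \- (fun x => c * u' x + v' x) = v \- v'.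
  by apply/funext => x /=; ring.
rewrite (L2dot_linl mX)// ?(L2dot_linr mX)//; last exact: L2_lin.
move: uu'; rewrite ltr_pdivlMr ?mulr_gt0// => uu'.
move: vv'; rewrite ltr_pdivlMr// => vv'.
move: (L2dot_ge0 mu X (u \- u')) uu' vv'.
move: (L2dot mu X (u \- u') _) (L2dot mu X (v \- v') _) => x y x0 xe ye.
have -> : 2 * ((c - 1) * ((c - 1) * x + x) + ((c - 1) * x + x)) + 2 * y =
  2 * (c ^+ 2 * x) + 2 * y by ring.
have c20 := mulr_ge0 (sqr_ge0 c) x0.
by nra.
Qed.

Let approx_lim u (v : nat -> T -> R) : L2 mu X u -> (forall k, approx (v k)) ->
  (forall e : R, 0 < e -> exists k, L2dot mu X (u \- v k) (u \- v k) < e) ->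
  approx u.
Proof.
move=> u2 va uv; split => // e e0; have e4 : 0 < e / 4 by rewrite divr_gt0.
have [k uvk] := uv _ e4; have [v2 vka] := va k.
have [w Dw vw] := vka _ e4; exists w => //.
by apply: le_lt_trans (L2dot_triangle mX u2 v2 (DL2 Dw)) _; lra.
Qed.

Let approx0 : approx (fun=> 0).
Proof.
split; first exact: L2_cst0.
move=> e e0; exists (fun=> 0) => //.
rewrite /L2dot (_ : (fun x => _) = fun=> 0) /Rintegral ?integral0//.
by apply/funext => x /=; ring.
Qed.

Import HBNNSimple.

(** Induction on the number of values, [approx_lin] adding one indicator at a time. *)
Let approx_nnsfun (h : {nnsfun T >-> R}) : approx h.
Proof.
have [m [c [A [mA hE]]]] : exists (m : nat) (c : 'I_m -> R) (A : 'I_m -> set T),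
    (forall i, measurable (A i)) /\ forall x, h x = \sum_(i < m) c i * \1_(A i) x.
  eexists; eexists; eexists; split; last by move=> x; exact: fimfunEord.
  by move=> i; exact: measurable_sfunP.
rewrite (_ : (h : T -> R) = fun x => \sum_(i < m) c i * \1_(A i) x); last first.
  exact/funext.
elim: m c A mA {hE} => [|m IH] c A mA.
  by under eq_fun do rewrite big_ord0.
under eq_fun do rewrite big_ord_recl.
apply: approx_lin; first exact: approx_indic.
by apply: (IH (fun i => c (lift ord0 i)) (fun i => A (lift ord0 i))) => i.
Qed.

(** Simple functions increase to [u], so the squared error is dominated by [u^2] and dominated
    convergence applies. *)
Let approx_ge0 (u : T -> R) : measurable_fun setT u ->
  (forall x, 0 <= u x) -> L2 mu X u ->
  approx u.
Proof.
move=> mu_ u0 u2.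
have mu' : measurable_fun setT (EFin \o u) by exact/measurable_EFinP.
pose h := nnsfun_approx measurableT mu'.
have hu x : h k x @[k --> \oo] --> u x.
  have u0' y : setT y -> (0 <= (EFin \o u) y)%E by rewrite /= lee_fin.
  by have /fine_cvgP[] := cvg_nnsfun_approx measurableT mu' u0' (x := x) I.
have nd x : {homo (fun k => h k x) : m p / (m <= p)%N >-> m <= p}.
  by move=> m p mp; exact/lefP/nd_nnsfun_approx.
have hle k x : h k x <= u x.
  rewrite -(cvg_lim _ (hu x))//; apply: nondecreasing_cvgn_le => //.
  by apply/cvg_ex; exists (u x); exact: hu.
apply: (@approx_lim _ (fun k => h k)) => // e e0.
have mh k : measurable_fun X (fun x => ((u x - h k x) ^+ 2)%:E).
  apply/measurable_EFinP; apply: measurable_funX; apply: measurable_funB.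
    exact: measurable_funTS.
  exact: measurable_funTS.
have cv : {ae mu, forall x, X x -> ((u x - h k x) ^+ 2)%:E @[k --> \oo] --> 0%:E}.
  apply: aeW => x _; apply: cvg_EFin; first exact: nearW.
  have h1 : (u x - h k x) @[k --> \oo] --> (0 : R).
    by rewrite -(subrr (u x)); apply: cvgB; [exact: cvg_cst|exact: hu].
  by rewrite -(mulr0 (0 : R)); exact: (cvgM h1 h1).
have dom : {ae mu, forall x k, X x ->
    (`|((u x - h k x) ^+ 2)%:E| <= (u x ^+ 2)%:E)%E}.
  apply: aeW => x k _; rewrite gee0_abs ?lee_fin ?sqr_ge0//.
  rewrite ler_pXn2r ?nnegrE ?subr_ge0//.
  by rewrite gerBl.
have [_ _ cvint] := dominated_convergence mX mh (measurable_cst _) cv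
  (L2_integrable_sqr u2) dom.
move: cvint; rewrite integral0 => /fine_cvgP[_] /cvgrPdist_lt/(_ e e0)[N _ hN].
exists N; have := hN N (leqnn N); rewrite /= sub0r normrN ger0_norm.
  by apply: le_lt_trans; rewrite le_eqVlt; apply/orP; left; apply/eqP.
by apply: fine_ge0; apply: integral_ge0 => x _; rewrite lee_fin sqr_ge0.
Qed.

(** [u] is measurable on [X] only: it is extended by 0, then split into positive and negative
    parts. *)
Lemma indic_dense : densely_defined mu X D.
Proof.
move=> u e u2 e0; have [mu_ _] := u2.
have mr : measurable_fun setT (u \_ X) by exact/(measurable_restrictT _ mX).
have rE x : X x -> (u \_ X) x = u x by move=> Xx; rewrite patchE mem_set.
have r2 : L2 mu X (u \_ X).
  apply: (L2P (measurable_funTS mr)).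
  apply: eq_integrable (L2_integrable_sqr u2) => //.
  by move=> x; rewrite inE => Xx; rewrite rE.
pose p x : R := Num.max ((u \_ X) x) 0.
pose q x : R := Num.max (- (u \_ X) x) 0.
have mp : measurable_fun setT p by apply: measurable_maxr.
have mq : measurable_fun setT q.
  by apply: measurable_maxr => //; exact: measurableT_comp.
have sub (f : T -> R) : measurable_fun setT f -> (forall x, `|f x| <= `|(u \_ X) x|) ->
    L2 mu X f.
  move=> mf fu; apply: (L2P (measurable_funTS mf)).
  apply: (le_integrable mX _ _ (L2_integrable_sqr r2)).
    by apply/measurable_EFinP; apply: measurable_funX; exact: measurable_funTS.
  by move=> x _; rewrite /= lee_fin !normrX ler_pXn2r ?nnegrE.
have pa : approx p.
  apply: approx_ge0 => //; first by move=> x; rewrite le_max lexx orbT.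
  by apply: sub => // x; rewrite /p maxEle; case: ifPn; rewrite ?normr0.
have qa : approx q.
  apply: approx_ge0 => //; first by move=> x; rewrite le_max lexx orbT.
  by apply: sub => // x; rewrite /q maxEle; case: ifPn; rewrite ?normr0 ?normrN.
have [_ ra] := approx_lin (-1) qa pa.
have e20 : 0 < e ^+ 2 by rewrite exprn_gt0.
have [v Dv uv] := ra _ e20; exists v => //.
rewrite L2norm_lt//; apply: le_lt_trans uv; rewrite le_eqVlt; apply/orP; left.
apply/eqP; apply: eq_Rintegral => x; rewrite inE => Xx /=.
have -> : u x = -1 * q x + p x.
  rewrite /p /q rE// !maxEle.
  by have [h|h] := leP (u x) 0; have [h'|h'] := leP (- u x) 0; lra.
by [].
Qed.

End L2_density.

(** * Approximation of indicators by Lipschitz functions *)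

Section lipschitz_approximation.
Context {R : realType} {n : nat}.
Local Notation mu := (@lebesgue_measure_rV R n).
Variable Omega : set 'rV[R]_n.
Hypotheses (mO : measurable Omega) (Olty : (mu Omega < +oo)%E).
Implicit Types f g phi : 'rV[R]_n -> R.

Let lip f := exists L, forall x y, `|f x - f y| <= L * enorm (x - y).

(** The distance is that of L^1, where errors add up; it controls the one of L^2 since differences
    of functions with values in [0, 1] are at most 1 in absolute value. The same range keeps
    products Lipschitz and close. *)
Let approx f := [/\ measurable_fun setT f, forall x, 0 <= f x <= 1 &
  forall e, 0 < e -> exists phi, [/\ measurable_fun setT phi, lip phi,
    forall x, 0 <= phi x <= 1 &
    (\int[mu]_(x in Omega) `|phi x - f x|%:E < e%:E)%E]].

Let mnorm f g : measurable_fun setT f -> measurable_fun setT g ->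
  measurable_fun Omega (fun x => `|f x - g x|%:E).
Proof.
move=> mf mg; apply/measurable_EFinP; apply: measurable_funTS.
apply: (measurableT_comp (@normr_measurable R setT)).
exact: measurable_funB.
Qed.

Let int_add (F G H : 'rV[R]_n -> R) : measurable_fun Omega (EFin \o F) ->
  measurable_fun Omega (EFin \o G) -> measurable_fun Omega (EFin \o H) ->
  (forall x, 0 <= F x) -> (forall x, 0 <= G x) -> (forall x, 0 <= H x) ->
  (forall x, F x <= G x + H x) ->
  (\int[mu]_(x in Omega) (F x)%:E <=
   \int[mu]_(x in Omega) (G x)%:E + \int[mu]_(x in Omega) (H x)%:E)%E.
Proof.
move=> mF mG mH F0 G0 H0 FGH.
rewrite -ge0_integralD//.
- apply: ge0_le_integral => //.
  + by move=> x _; rewrite lee_fin.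
  + exact: emeasurable_funD.
  + by move=> x _; rewrite -EFinD lee_fin.
- by move=> x _; rewrite lee_fin.
- by move=> x _; rewrite lee_fin.
Qed.

Let approx_onem f : approx f -> approx (fun x => 1 - f x).
Proof.
move=> [mf f01 fa]; split.
- by apply: measurable_funB.
- by move=> x; have := f01 x; lra.
- move=> e /fa[phi [mphi [L hL] phi01 le]]; exists (fun x => 1 - phi x); split.
  + by apply: measurable_funB.
  + exists L => x y; rewrite (_ : _ - _ = - (phi x - phi y)); last by ring.
    by rewrite normrN.
  + by move=> x; have := phi01 x; lra.
  + have E x : `|1 - phi x - (1 - f x)| = `|phi x - f x|.
      by rewrite distrC; congr `|_|; ring.
    under eq_integral do rewrite E.
    exact: le.
Qed.

Let approxM f g : approx f -> approx g -> approx (fun x => f x * g x).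
Proof.
move=> [mf f01 fa] [mg g01 ga]; split.
- exact: measurable_funM.
- by move=> x; have := f01 x; have := g01 x; nra.
- move=> e e0; have e20 : 0 < e / 2 by rewrite divr_gt0.
  have [phi [mphi [L hL] p01 ple]] := fa _ e20.
  have [psi [mpsi [M hM] q01 qle]] := ga _ e20.
  have prod (a b c d : R) : `|b| <= 1 -> `|c| <= 1 ->
      `|a * b - c * d| <= `|a - c| + `|b - d|.
    move=> b1 c1; have -> : a * b - c * d = (a - c) * b + c * (b - d) by ring.
    apply: le_trans (ler_normD _ _) _; rewrite !normrM.
    by have := normr_ge0 (a - c); have := normr_ge0 (b - d); nra.
  have n01 (t : R) : 0 <= t <= 1 -> `|t| <= 1.
    by move=> /andP[t0 t1]; rewrite ger0_norm.
  exists (fun x => phi x * psi x); split.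
  + exact: measurable_funM.
  + exists (L + M) => x y; rewrite mulrDl.
    apply: le_trans (lerD (hL x y) (hM x y)).
    by apply: prod; exact: n01.
  + by move=> x; have := p01 x; have := q01 x; nra.
  + rewrite (splitr e) EFinD; apply: le_lt_trans (lteD ple qle).
    apply: int_add => //.
    * by apply: mnorm; exact: measurable_funM.
    * exact: mnorm.
    * exact: mnorm.
    * by move=> x; apply: prod; exact: n01.
Qed.

(** Pointwise limits are L^1 limits by dominated convergence with bound 1, integrable on [Omega]. *)
Let approx_lim (f : nat -> 'rV[R]_n -> R) g : (forall k, approx (f k)) ->
  (forall x, f k x @[k --> \oo] --> g x) -> approx g.
Proof.
move=> fa fg.
have mf k : measurable_fun setT (f k) by have [] := fa k.
have f01 k x : 0 <= f k x <= 1 by have [_ + _] := fa k; exact.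
have g01 x : 0 <= g x <= 1.
  apply/andP; split.
    by apply: (cvgr_to_ge (fg x)); apply: nearW => k; case/andP: (f01 k x).
  by apply: (cvgr_to_le (fg x)); apply: nearW => k; case/andP: (f01 k x).
have mg : measurable_fun setT g.
  exact: (measurable_fun_cvg mf (fun x _ => fg x)).
split => // e e0; have e20 : 0 < e / 2 by rewrite divr_gt0.
have cv : {ae mu, forall x, Omega x -> `|f k x - g x|%:E @[k --> \oo] --> 0%:E}.
  apply: aeW => x _; apply: cvg_EFin; first exact: nearW.
  rewrite -(normr0 R) -(subrr (g x)); apply: cvg_norm.
  by apply: cvgB; [exact: fg|exact: cvg_cst].
have dom : {ae mu, forall x k, Omega x -> (`| `|f k x - g x|%:E | <= 1%:E)%E}.
  apply: aeW => x k _; rewrite gee0_abs lee_fin//.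
  by have := f01 k x; have := g01 x; rewrite ler_norml; lra.
have i1 : mu.-integrable Omega (fun=> 1%:E).
  apply/integrableP; split; first exact: measurable_cst.
  under eq_integral do rewrite abse1.
  by rewrite integral_cst// mul1e.
have [_ _ cvint] := dominated_convergence mO (fun k => mnorm (mf k) mg)
  (measurable_cst _) cv i1 dom.
have [k ke] : exists k, (\int[mu]_(x in Omega) `|f k x - g x|%:E < (e / 2)%:E)%E.
  move: cvint; rewrite integral0 => /fine_cvgP[fin /cvgr_lt/(_ _ e20) lt].
  have [N _ /(_ N (leqnn N))[Nfin Nlt]] := filterI fin lt.
  exists N; rewrite /= in Nfin Nlt.
  by rewrite -(fineK Nfin) lte_fin.
have [_ _ /(_ _ e20)[phi [mphi Lphi p01 ple]]] := fa k.
exists phi; split => //.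
rewrite (splitr e) EFinD; apply: le_lt_trans (lteD ple ke).
apply: int_add => //; try exact: mnorm.
move=> x; have -> : phi x - g x = (phi x - f k x) + (f k x - g x) by ring.
exact: ler_normD.
Qed.

Let approx_halfspace (i : 'I_n) (a : R) :
  approx \1_[set x : 'rV[R]_n | a < x ord0 i].
Proof.
have clamp (u v : R) : `|Num.min 1 (Num.max 0 u) - Num.min 1 (Num.max 0 v)| <=
    `|u - v|.
  have h1 := ler_norm (u - v); have h2 := ler_norm (v - u).
  have h0 := normr_ge0 (u - v); rewrite distrC in h2.
  rewrite ler_norml !minEle !maxEle.
  case: (leP 0 u) => ?; case: (leP 0 v) => ?; rewrite ?ler10;
    case: (leP 1 u) => ?; case: (leP 1 v) => ?; apply/andP; split; lra.
(* Ramps of slope [k + 1] starting at the face of the half-space; being 0 on the face, they converge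
   everywhere to the indicator of the open half-space. *)
pose f k (x : 'rV[R]_n) : R := Num.min 1 (Num.max 0 (k.+1%:R * (x ord0 i - a))).
apply: (@approx_lim f).
- move=> k.
  have mf : measurable_fun setT (f k).
    apply: measurable_minr => //; apply: measurable_maxr => //.
    apply: measurable_funM => //; apply: measurable_funB => //.
    exact: measurable_coord_rV.
  have f01 x : 0 <= f k x <= 1.
    by rewrite /f le_min ler01 le_max lexx /= ge_min lexx.
  split => // e e0; exists (f k); split => //.
    exists k.+1%:R => x y.
    apply: (@le_trans _ _ (k.+1%:R * `|(x - y) ord0 i|)); last first.
      by rewrite ler_wpM2l// le_coord_enorm.
    rewrite !mxE -[X in X * _](@ger0_norm _ k.+1%:R)// -normrM.
    have -> : k.+1%:R * (x ord0 i - y ord0 i) =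
      k.+1%:R * (x ord0 i - a) - k.+1%:R * (y ord0 i - a) by ring.
    exact: clamp.
  under eq_integral => x _ do rewrite subrr normr0.
  by rewrite integral0 lte_fin.
- move=> x; rewrite indicE; case: (ltP a (x ord0 i)) => ax; last first.
    rewrite memNset/=; last by apply/negP; rewrite -leNgt.
    rewrite (_ : (fun k => f k x) = fun=> 0); first exact: cvg_cst.
    apply/funext => k; rewrite /f max_l ?min_r//.
    by rewrite mulr_ge0_le0 ?subr_le0.
  rewrite mem_set//=; apply: cvg_near_cst.
  have xa : 0 < x ord0 i - a by rewrite subr_gt0.
  have := near_infty_natSinv_lt (PosNum xa); apply: filterS => k /= /ltW kx.
  rewrite /f min_l// le_max; apply/orP; right.
  by rewrite -ler_pdivrMl// mulr1.
Qed.

(** The sets with approximable indicator form a sigma-algebra: complements are [1 - f],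
    intersections are products, countable unions are limits of finite ones. It contains the
    half-spaces that generate the Borel sets. *)
Let approx_measurable (A : set 'rV[R]_n) : measurable A -> approx \1_A.
Proof.
pose S : set (set 'rV[R]_n) := [set A | approx \1_A].
have SC B : S B -> S (~` B).
  move=> /approx_onem SB; rewrite /S /= (_ : \1_(~` B) = fun x => 1 - \1_B x)//.
  by apply/funext => x; rewrite indicC indicE; case: (x \in B) => /=; ring.
have SI B B' : S B -> S B' -> S (B `&` B').
  by rewrite /S /= => hB hB'; rewrite indicI; exact: approxM.
have S0 : S set0.
  rewrite /S /= indic0; split => //; first by move=> x; rewrite lexx ler01.
  move=> e e0; exists (fun=> 0); split => //.
  - by exists 0 => x y; rewrite subrr normr0 mul0r.
  - by move=> x; rewrite lexx ler01.
  - under eq_integral => x _ do rewrite subrr normr0.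
    by rewrite integral0 lte_fin.
have SU B B' : S B -> S B' -> S (B `|` B').
  by move=> hB hB'; rewrite -[_ `|` _]setCK setCU; apply/SC/SI; exact: SC.
have Sbig (F : nat -> set 'rV[R]_n) : (forall i, S (F i)) ->
    S (\bigcup_i F i).
  move=> SF; apply: (@approx_lim (fun k => \1_(\big[setU/set0]_(i < k) F i))).
    by move=> k; apply: (big_ind S).
  move=> x; rewrite indicE; case: (pselect ((\bigcup_i F i) x)) => Fx.
    rewrite mem_set//; apply: cvg_near_cst; have [i _ Fix] := Fx.
    exists i.+1 => // k /= ik; rewrite indicE mem_set//.
    by rewrite -bigcup_mkord; exists i.
  rewrite memNset//; apply: cvg_near_cst; apply: nearW => k.
  rewrite indicE memNset// => Fk; apply: Fx; move: Fk.
  by rewrite -bigcup_mkord => -[i _ Fi]; exists i.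
suff : @rV_measurable R n `<=` S by apply.
apply: smallest_sub.
  split => //; first by move=> B SB; rewrite setTD; exact: SC.
rewrite -bigcup_seq; apply: bigcup_sub => i _ _ [B mB <-]; rewrite setTI.
(* Open rays generate the Borel sets of the line, so a second induction over generated sets, on each
   coordinate, ends at half-spaces. *)
have : <<s @RGenOInfty.G R >> B.
  by have := mB; rewrite [X in X B](RGenOInfty.measurableE R).
move: B {mB}; apply: smallest_sub.
  split => /=.
  - by rewrite preimage_set0.
  - by move=> B SB; rewrite setTD -preimage_setC; exact: SC.
  - by move=> F SF; rewrite preimage_bigcup; exact: Sbig.
move=> _ [a ->] /=.
have := approx_halfspace i a; congr approx; congr indic.
by apply/seteqP; split => x /=; rewrite in_itv/= andbT.
Qed.

Lemma indic_lipschitz_approx (A : set 'rV[R]_n) (e : R) :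
  measurable A -> 0 < e -> exists phi, [/\ measurable_fun setT phi,
    exists L, forall x y, `|phi x - phi y| <= L * enorm (x - y),
    forall x, 0 <= phi x <= 1 &
    L2dot mu Omega (\1_A \- phi) (\1_A \- phi) < e].
Proof.
move=> mA e0; have [mi i01 /(_ _ e0)[phi [mphi Lphi p01 ple]]] :=
  approx_measurable mA.
exists phi; split => //.
(* The difference lies in [-1, 1], so its square is at most its absolute value. *)
have le1 : (\int[mu]_(x in Omega) (((\1_A \- phi) x) * ((\1_A \- phi) x))%:E <=
    \int[mu]_(x in Omega) `|phi x - \1_A x|%:E)%E.
  apply: ge0_le_integral => //.
  - by move=> x _; rewrite lee_fin -expr2 sqr_ge0.
  - apply/measurable_EFinP; apply: measurable_funTS; apply: measurable_funM;
      exact: measurable_funB.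
  - exact: mnorm.
  - move=> x _; rewrite lee_fin /= -expr2 -real_normK ?num_real// distrC expr2.
    rewrite ler_piMl// ler_norml; have := i01 x; have := p01 x; lra.
rewrite /L2dot /Rintegral -lte_fin fineK; first exact: le_lt_trans le1 ple.
rewrite ge0_fin_numE; last first.
  by apply: integral_ge0 => x _; rewrite lee_fin -expr2 sqr_ge0.
by apply: le_lt_trans le1 (lt_trans ple _); rewrite ltry.
Qed.

End lipschitz_approximation.

(** * Density of the form domain and conclusion *)

Lemma robin_form_dense (R : realType) (n : nat) (s : R) (Omega : set 'rV[R]_n)
    (beta : 'rV[R]_n -> R) : 0 < s < 1 -> open Omega ->
    (lebesgue_measure_rV n Omega < +oo)%E ->
    lebesgue_measure_rV n (closure Omega `\` Omega) = 0%E ->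
    (lebesgue_measure_rV n).-integrable (~` Omega) (EFin \o beta) ->
    {ae lebesgue_measure_rV n, forall x, (~` Omega) x -> 0 <= beta x} ->
  densely_defined (lebesgue_measure_rV n) Omega (robin_dom s Omega beta).
Proof.
move=> s01 oO Olty bnull bint beta0.
have mO := open_measurable_rV oO.
have mbeta : measurable_fun (~` Omega) beta.
  by apply/measurable_EFinP; exact: measurable_int bint.
have [DL2 _ D0 Dlin _ _ _] :=
  robin_form_bilinear s01 oO Olty bnull mbeta beta0.
apply: (indic_dense mO Olty DL2 D0 Dlin) => A e mA e0.
have [phi [mphi [L hL] phi01 hA]] := indic_lipschitz_approx mO Olty mA e0.
exists phi; last exact: hA.
apply: (robin_dom_W s01 oO Olty bnull mbeta beta0).
apply: (lipschitz_W s01 oO Olty bint mphi (B := 1) _ hL) => x.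
by have /andP[p0 p1] := phi01 x; rewrite ger0_norm.
Qed.

Theorem theorem3p18 (R : realType) (n : nat) (s : R) (Omega : set 'rV[R]_n)
    (beta : 'rV[R]_n -> R)
    (n_ge1 : (1 <= n)%N)
    (s_itv : 0 < s < 1)
    (Omega_open : open Omega)
    (Omega_bounded : bounded_set Omega)
    (Omega_lipschitz : lipschitz_boundary Omega)
    (beta_L1 : (lebesgue_measure_rV n).-integrable (~` Omega) (EFin \o beta))
    (beta_ge0 : {ae lebesgue_measure_rV n,
       forall x, (~` Omega) x -> 0 <= beta x}) :
  let mu := lebesgue_measure_rV n in
  let D := robin_dom s Omega beta in
  let a := robin_form s Omega beta in
  let A := form_operator mu Omega D a in
  [/\ bilinear_form_on mu Omega D a,
      symmetric_on D a,
      nonneg_on D a,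
      closed_form mu Omega D a &
      densely_defined mu Omega D] /\
  [/\ selfadjoint_operator mu Omega A,
      op_dom A =
        [set u | [/\ L2 mu Omega u,
                    W_space s Omega beta (robin_ext s Omega beta u) &
                    exists2 f, L2 mu Omega f &
                      robin_weak_solution s Omega beta f
                        (robin_ext s Omega beta u)]] &
      forall u f : 'rV[R]_n -> R, A u f <->
        [/\ L2 mu Omega u,
            W_space s Omega beta (robin_ext s Omega beta u),
            L2 mu Omega f &
            robin_weak_solution s Omega beta f (robin_ext s Omega beta u)]].
Proof.
set mu := lebesgue_measure_rV n; set D := robin_dom s Omega beta.
set a := robin_form s Omega beta; set A := form_operator mu Omega D a.
have Olty := bounded_measure_lty Omega_open Omega_bounded.
have bnull := boundary_null Omega_open Omega_bounded Omega_lipschitz.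
have mO := open_measurable_rV Omega_open.
have mbeta : measurable_fun (~` Omega) beta.
  by apply/measurable_EFinP; exact: measurable_int beta_L1.
have ba : bilinear_form_on mu Omega D a.
  exact (robin_form_bilinear s_itv Omega_open Olty bnull mbeta beta_ge0).
have sa : symmetric_on D a.
  exact (robin_form_symmetric s_itv Omega_open mbeta beta_ge0).
have na : nonneg_on D a.
  exact (robin_form_nonneg s_itv Omega_open mbeta beta_ge0).
have ca : closed_form mu Omega D a.
  exact (robin_form_closed s_itv Omega_open Olty bnull mbeta beta_ge0).
have da : densely_defined mu Omega D.
  exact (robin_form_dense s_itv Omega_open Olty bnull beta_L1 beta_ge0).
have AP := robin_operatorP s_itv Omega_open Olty bnull mbeta beta_ge0.
split; first by split.
split.
- exact (form_operator_selfadjoint mO ba sa na ca da).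
- apply/seteqP; split => [u [f /AP[u2 Wu f2 uf]]|u [u2 Wu [f f2 uf]]].
    by split => //; exists f.
  by exists f; exact/AP.
- exact AP.
Qed.
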